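(* Let $Y$ be a Young set and let $H$ be a finite group. Let $\mathcal R=\mathcal R_{Y,H}$ be the graded free abelian group, with the maps $m$, $\Delta$, $\delta$, $e$, $\epsilon$, defined in the context. (1) The maps $m$ (multiplication), $\Delta$ (comultiplication), $e$ (unit) and $\epsilon$ (counit) make $\mathcal R$ into a graded, connected, commutative, and cocommutative Hopf algebra over $\mathbb Z$. (2) The maps $m$ (multiplication), $\delta$ (comultiplication), $e$ (unit) and $\epsilon$ (counit), together with the basis $\big(\bigsqcup_{N}\operatorname{Irr}(G_N)\big)_{\mathrm{Set}^\times}$, make $\mathcal R$ into a PSH algebra, i.e. a graded, connected, positive, self-adjoint Hopf algebra over $\mathbb Z$.
   Context: Young sets. $\mathrm{Set}^{\mathrm{inj}}$ is the category of finite sets and injective maps, $\mathrm{Set}^\times$ the groupoid of finite sets and bijections. A Young set is a functor $Y:\mathrm{Set}^{\mathrm{inj}}\to\mathrm{Set}^{\mathrm{inj}}$, $N\mapsto Y_N$, with $Y_\emptyset=\emptyset$ and $Y_K\cap Y_L=Y_{K\cap L}$ for all subsets $K,L$ of the same finite set $N$; here for $K\subseteq N$ the set $Y_K$ is regarded as a subset of $Y_N$ via the injection induced by the inclusion. For an injection $w$ we write $w$ also for $Y_w$. Groups. $\Bbbk$ is an algebraically closed field of characteristic zero; representations are finite-dimensional and over $\Bbbk$. For a finite set $N$, $S_N$ is its symmetric group, $\operatorname{Fun}(Y_N,H)$ is the group of functions $Y_N\to H$ under pointwise multiplication, $S_N$ acts on it by $(wf)(y)=f(w^{-1}y)$, and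 $G_N=S_N\ltimes\operatorname{Fun}(Y_N,H)$, with product $(w_1,f_1)(w_2,f_2)=(w_1w_2,(w_2^{-1}f_1)f_2)$. For a subset $Y'\subseteq Y_N$, $\operatorname{Fun}(Y',H)$ is identified with the subgroup of functions in $\operatorname{Fun}(Y_N,H)$ that are trivial outside $Y'$. For disjoint finite sets $K,L$ with $N=K\sqcup L$ put $Y_{K,L}=Y_K\sqcup Y_L\subseteq Y_N$, $S_{K,L}=\{w\in S_N: wK=K, wL=L\}$, $G_{K,L}=S_{K,L}\ltimes\operatorname{Fun}(Y_{K,L},H)\subseteq G_N$ (canonically isomorphic to $G_K\times G_L$), $P_{K,L}^{N}=S_{K,L}\ltimes\operatorname{Fun}(Y_N,H)$, and $U_{K,L}^{N}=\operatorname{Fun}(Y_N\setminus Y_{K,L},H)$; one has $P_{K,L}^N=G_{K,L}\ltimes U_{K,L}^N$. Functors. $\mathrm{i}_{K,L}^{N}:\operatorname{Rep}(G_{K,L})\to\operatorname{Rep}(G_N)$ is inflation from $G_{K,L}$ to $P_{K,L}^N$ (letting $U_{K,L}^N$ act trivially) followed by induction to $G_N$. $\mathrm{r}^N_{K,L}:\operatorname{Rep}(G_N)\to\operatorname{Rep}(G_{K,L})$ sends $V$ to the subspace $V^{U_{K,L}^N}$ of fixed vectors. $\operatorname{res}^N_{K,L}:\operatorname{Rep}(G_N)\to\operatorname{Rep}(G_{K,L})$ is ordinary restriction. The group $\mathcal R$. $R(G)$ is the Grothendieck group of $\operatorname{Rep}(G)$, free abelian on the set $\operatorname{Irr}(G)$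 of isomorphism classes of irreducible representations; $R(G_{K,L})$ is identified with $R(G_K)\otimes_{\mathbb Z}R(G_L)$. For a bijection $w:N\to M$, $\operatorname{Ad}_w:R(G_N)\to R(G_M)$ is transport of structure $\rho\mapsto\rho(w^{-1}\cdot w)$ along the isomorphism $G_M\to G_N$, $g\mapsto w^{-1}gw$, induced by $w$ and functoriality of $Y$. Then $\mathcal R_{Y,H}=\big(\bigoplus_{N}R(G_N)\big)_{\mathrm{Set}^\times}$, the sum being over finite sets $N$ and the subscript meaning that one imposes $\rho=\operatorname{Ad}_w\rho$ for all such $\rho,w$. It is free abelian on $\big(\bigsqcup_N\operatorname{Irr}(G_N)\big)_{\mathrm{Set}^\times}$ (the quotient set), graded with $R(G_N)$ in degree $\#N$. Structure maps. $m:\mathcal R\otimes_{\mathbb Z}\mathcal R\to\mathcal R$ is the sum of the maps $R(G_K)\otimes R(G_L)\cong R(G_{K,L})\xrightarrow{\mathrm{i}_{K,L}^{K\sqcup L}}R(G_{K\sqcup L})$. For $\rho\in R(G_N)$, $\Delta(\rho)=\sum_{K}\operatorname{res}^N_{K,K^c}\rho$ and $\delta(\rho)=\sum_K\mathrm{r}^N_{K,K^c}\rho$, where $K$ runs over a set of representatives for the $S_N$-orbits of subsets of $N$, $K^c=N\setminus K$, and the summands lie in $R(G_{K,K^c})\cong R(G_K)\otimes R(G_{K^c})$. $e:\mathbb Z\to\mathcal R$ sends $1$ to the trivial representation of the trivial group $G_\emptyset$; $\epsilon:\mathcal R\to\mathbb Z$ sends that element to $1$ and every other basis element to $0$. (These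 maps are well defined on coinvariants.) Connected means that $e:\mathbb Z\to\mathcal R_0$ is an isomorphism onto the degree $0$ part. A PSH algebra (Zelevinsky) is a graded connected Hopf algebra over $\mathbb Z$ which is a free abelian group with a distinguished homogeneous basis such that: (positivity) the multiplication, comultiplication, unit and counit send non-negative combinations of basis elements to non-negative combinations of basis elements (using the tensor product basis on the tensor square, and $\{1\}$ on $\mathbb Z$); and (self-adjointness) multiplication and comultiplication are adjoint to one another, as are unit and counit, for the inner products making these bases orthonormal. *)

(* Defs.v *)
From HB Require Import structures.
Set Warnings "-notation-overridden,-ambiguous-paths,-redundant-canonical-projection".
From mathcomp Require Import all_boot all_order all_algebra all_fingroup.
From mathcomp Require Import mxrepresentation character.
From mathcomp Require Import boolp.
From mathcomp.multinomials Require Import freeg.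

Set Implicit Arguments.
Unset Strict Implicit.
Unset Printing Implicit Defensive.

Import Order.TTheory GroupScope GRing.Theory Num.Theory.

Record injection (K N : finType) := Injection {
  inj_fun :> {ffun K -> N};
  inj_proof : injectiveb inj_fun
}.

Lemma injP (K N : finType) (a : injection K N) : injective a.
Proof. exact/injectiveP/inj_proof. Qed.

Lemma mk_inj_proof (K N : finType) (f : K -> N) :
  injective f -> injectiveb [ffun x => f x].
Proof. by move=> fI; apply/injectiveP => x y; rewrite !ffunE => /fI. Qed.

Definition mk_inj (K N : finType) (f : K -> N) (fI : injective f) :=
  Injection (mk_inj_proof fI).

Lemma mk_injE (K N : finType) (f : K -> N) (fI : injective f) x :
  mk_inj fI x = f x.
Proof. exact: ffunE. Qed.

Lemma injection_eqP (K N : finType) (a b : injection K N) : a =1 b -> a = b.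
Proof.
case: a b => [a pa] [b pb] /= /ffunP e; case: b / e pb => pb.
by congr Injection; apply: bool_irrelevance.
Qed.

Definition inj_idm (N : finType) : injection N N := mk_inj (@inj_id N).

Definition inj_cmp (K M N : finType) (a : injection M N) (b : injection K M) :
  injection K N := mk_inj (inj_comp (@injP _ _ a) (@injP _ _ b)).

Definition sub_fin (N : finType) (K : {set N}) : finType := {x : N | x \in K}.

Definition inj_sub (N : finType) (K : {set N}) : injection (sub_fin K) N :=
  @mk_inj (sub_fin K) N val val_inj.

Lemma inl_injective (K L : finType) : injective (@inl K L).
Proof. by move=> x y []. Qed.

Lemma inr_injective (K L : finType) : injective (@inr K L).
Proof. by move=> x y []. Qed.

Definition inj_left (K L : finType) : injection K (K + L)%type :=
  mk_inj (@inl_injective K L).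

Definition inj_right (K L : finType) : injection L (K + L)%type :=
  mk_inj (@inr_injective K L).

Definition inj_perm (N : finType) (w : {perm N}) : injection N N :=
  mk_inj (@perm_inj N w).

Lemma inj_idmE (N : finType) x : inj_idm N x = x.
Proof. exact: mk_injE. Qed.

Lemma inj_cmpE (K M N : finType) (a : injection M N) (b : injection K M) x :
  inj_cmp a b x = a (b x).
Proof. exact: mk_injE. Qed.

Lemma inj_permE (N : finType) (w : {perm N}) x : inj_perm w x = w x.
Proof. exact: mk_injE. Qed.

Definition inj_im (K N : finType) (a : injection K N) : {set N} :=
  [set a x | x : K].

Record young_set := YoungSet {
  yobj :> finType -> finType;
  ymap : forall K N : finType, injection K N -> injection (yobj K) (yobj N);
  ymap_id : forall N, ymap (inj_idm N) = inj_idm (yobj N);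
  ymap_comp : forall (K M N : finType) (a : injection M N) (b : injection K M),
    ymap (inj_cmp a b) = inj_cmp (ymap a) (ymap b);
  yobj_empty : forall N : finType, #|N| = 0%N -> #|yobj N| = 0%N;
  yobj_cap : forall (N : finType) (K L : {set N}),
    inj_im (ymap (inj_sub K)) :&: inj_im (ymap (inj_sub L))
    = inj_im (ymap (inj_sub (K :&: L)))
}.

Arguments ymap Y {K N} a : rename.

Record bijection (N M : finType) := Bijection {
  bij_to : injection N M;
  bij_of : injection M N;
  bij_toK : cancel bij_to bij_of;
  bij_ofK : cancel bij_of bij_to
}.

Section YoungGroups.

Variables (Y : young_set) (H : finGroupType).

Lemma ymap_idE (N : finType) y : ymap Y (inj_idm N) y = y.
Proof. by rewrite ymap_id inj_idmE. Qed.

Lemma ymap_compE (K M N : finType) (a : injection M N) (b : injection K M) y :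
  ymap Y (inj_cmp a b) y = ymap Y a (ymap Y b y).
Proof. by rewrite ymap_comp inj_cmpE. Qed.

Lemma ymap_eq (K N : finType) (a b : injection K N) : a =1 b -> ymap Y a =1 ymap Y b.
Proof. by move/injection_eqP->. Qed.

Section Group.
Variable N : finType.

Definition yact (w : {perm N}) (y : Y N) : Y N := ymap Y (inj_perm w) y.

Lemma yact1 y : yact 1 y = y.
Proof.
rewrite /yact -[RHS]ymap_idE; apply: ymap_eq => x.
by rewrite inj_permE perm1 inj_idmE.
Qed.

(* MathComp composes permutations from left to right. *)
Lemma yactM w1 w2 y : yact (w2 * w1) y = yact w1 (yact w2 y).
Proof.
rewrite /yact -ymap_compE; apply: ymap_eq => x.
by rewrite inj_cmpE !inj_permE permM.
Qed.

Lemma yactK w : cancel (yact w) (yact w^-1).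
Proof. by move=> y; rewrite -yactM mulgV yact1. Qed.

Lemma yactKV w : cancel (yact w^-1) (yact w).
Proof. by move=> y; rewrite -yactM mulVg yact1. Qed.

Definition fun_act (w : {perm N}) (f : {ffun Y N -> H}) : {ffun Y N -> H} :=
  [ffun y => f (yact w^-1 y)].

Record ygroup := YGroup { yg_perm : {perm N}; yg_fun : {ffun Y N -> H} }.

Definition ygroup_pair g := (yg_perm g, yg_fun g).
Definition pair_ygroup p := YGroup p.1 p.2.
Lemma ygroup_pairK : cancel ygroup_pair pair_ygroup. Proof. by case. Qed.

HB.instance Definition _ := Finite.copy ygroup (can_type ygroup_pairK).

(* [w1 w2 : {perm N}] is first w2, then w1, hence the product [w2 * w1]. *)
Definition yg_mul (g1 g2 : ygroup) : ygroup :=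
  YGroup (yg_perm g2 * yg_perm g1)
    [ffun y => fun_act (yg_perm g2)^-1 (yg_fun g1) y * yg_fun g2 y].

Definition yg_one : ygroup := YGroup 1 [ffun=> 1].

Definition yg_inv (g : ygroup) : ygroup :=
  YGroup (yg_perm g)^-1 [ffun y => (fun_act (yg_perm g) (yg_fun g) y)^-1].

Lemma ygroupP (g h : ygroup) :
  yg_perm g = yg_perm h -> yg_fun g =1 yg_fun h -> g = h.
Proof. by case: g h => [w f] [v e] /= -> /ffunP->. Qed.

Lemma yg_mulA : associative yg_mul.
Proof.
move=> g1 g2 g3; apply: ygroupP => [|y] /=; first by rewrite mulgA.
by rewrite !ffunE /= !invgK yactM mulgA.
Qed.

Lemma yg_mul1g : left_id yg_one yg_mul.
Proof.
move=> g; apply: ygroupP => [|y] /=; first by rewrite mulg1.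
by rewrite !ffunE mul1g.
Qed.

Lemma yg_mulVg : left_inverse yg_one yg_inv yg_mul.
Proof.
move=> g; apply: ygroupP => [|y] /=; first by rewrite mulgV.
by rewrite !ffunE /= invgK yactK mulVg.
Qed.

HB.instance Definition _ :=
  Finite_isGroup.Build ygroup yg_mulA yg_mul1g yg_mulVg.

Lemma yg_permM (g h : ygroup) : yg_perm (g * h) = yg_perm h * yg_perm g.
Proof. by []. Qed.

Lemma yg_funM (g h : ygroup) y :
  yg_fun (g * h) y = yg_fun g (yact (yg_perm h) y) * yg_fun h y.
Proof. by rewrite !ffunE invgK. Qed.

Lemma yg_perm1 : yg_perm (1 : ygroup) = 1. Proof. by []. Qed.
Lemma yg_fun1 y : yg_fun (1 : ygroup) y = 1. Proof. exact: ffunE. Qed.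

Lemma yg_permV (g : ygroup) : yg_perm g^-1 = (yg_perm g)^-1. Proof. by []. Qed.

Lemma yg_funV (g : ygroup) y :
  yg_fun g^-1 y = (yg_fun g (yact (yg_perm g)^-1 y))^-1.
Proof. by rewrite !ffunE. Qed.

End Group.

Section Conjugation.
Variables (N M : finType) (w : bijection N M).

Lemma conj_perm_inj (v : {perm M}) :
  injective (fun x => bij_of w (v (bij_to w x))).
Proof. by move=> x y /injP/perm_inj/injP. Qed.

(* The isomorphism G_M -> G_N, g |-> w^-1 g w. *)
Definition yg_conj (g : ygroup M) : ygroup N :=
  YGroup (perm (@conj_perm_inj (yg_perm g)))
         [ffun y => yg_fun g (ymap Y (bij_to w) y)].

Lemma yg_conjM : {in [set: ygroup M] &, {morph yg_conj : g h / g * h}}.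
Proof.
move=> g h _ _; apply: ygroupP => [|y] /=.
  by apply/permP => x; rewrite !permE /= !permE bij_ofK.
rewrite !ffunE /= !invgK /yact -!ymap_compE; congr (yg_fun g _ * _).
by apply: ymap_eq => x; rewrite !inj_cmpE !inj_permE permE bij_ofK.
Qed.

Canonical yg_conj_morphism := Morphism yg_conjM.

End Conjugation.

(* A decomposition N = K |_| L is given by injections a : K -> N and
   b : L -> N with complementary images. *)

Definition inj_stab (K N : finType) (a : injection K N) (w : {perm N}) : bool :=
  w @: inj_im a == inj_im a.

Section Pullback.
Variables (K N : finType) (a : injection K N).

Definition pull_fun (w : {perm N}) : {ffun K -> K} :=
  [ffun x => odflt x [pick z | a z == w (a x)]].

(* The restriction of w to K, when w maps K to itself. *)
Definition pull_perm (w : {perm N}) : {perm K} := insubd (1 : {perm K}) (pull_fun w).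

Lemma pull_funE w x : inj_stab a w -> a (pull_fun w x) = w (a x).
Proof.
move=> /eqP st; rewrite ffunE; case: pickP => [z /eqP //| no].
have: w (a x) \in inj_im a by rewrite -st imset_f ?imset_f.
by case/imsetP => z _ e; have:= no z; rewrite e eqxx.
Qed.

Lemma pull_permE w x : inj_stab a w -> a (pull_perm w x) = w (a x).
Proof.
move=> st; rewrite -pull_funE // -pvalE.
have fI : injectiveb (pull_fun w).
  apply/injectiveP => y z e; apply: (@injP _ _ a); apply: (@perm_inj _ w).
  by rewrite -!pull_funE // e.
by rewrite (_ : pval _ = pull_fun w) //; have := val_insubd (1 : {perm K}) (pull_fun w); rewrite fI.
Qed.

Lemma inj_stab1 : inj_stab a 1.
Proof. by rewrite /inj_stab (eq_imset _ (@perm1 N)) imset_id. Qed.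

Lemma inj_stabM v w : inj_stab a v -> inj_stab a w -> inj_stab a (v * w).
Proof.
move=> /eqP sv /eqP sw; rewrite /inj_stab.
by rewrite (eq_imset _ (permM v w)) imset_comp sv sw.
Qed.

Lemma inj_stabV v : inj_stab a v -> inj_stab a v^-1.
Proof.
move=> /eqP sv; rewrite /inj_stab -{1}sv -imset_comp.
by rewrite (eq_imset _ (_ : _ =1 id)) ?imset_id // => x /=; rewrite permK.
Qed.

Lemma yact_pull w y :
  inj_stab a w -> yact w (ymap Y a y) = ymap Y a (yact (pull_perm w) y).
Proof.
move=> st; rewrite /yact -!ymap_compE; apply: ymap_eq => x.
by rewrite !inj_cmpE !inj_permE pull_permE.
Qed.

Definition yg_pull (g : ygroup N) : ygroup K :=
  YGroup (pull_perm (yg_perm g)) [ffun y => yg_fun g (ymap Y a y)].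

Lemma yg_pullM g h : inj_stab a (yg_perm g) -> inj_stab a (yg_perm h) ->
  yg_pull (g * h) = yg_pull g * yg_pull h.
Proof.
move=> sg sh; apply: ygroupP => [|y].
  apply/permP => x; apply: (@injP _ _ a).
  by rewrite yg_permM permM !pull_permE ?inj_stabM // permM.
by rewrite yg_funM /= ffunE yg_funM !ffunE yact_pull.
Qed.

End Pullback.

Section Decomposition.
Variables (K L N : finType) (a : injection K N) (b : injection L N).

Definition ysub : {set Y N} := inj_im (ymap Y a) :|: inj_im (ymap Y b).

Definition KL_stab (w : {perm N}) : bool := inj_stab a w && inj_stab b w.

Definition parabolic_set : {set ygroup N} := [set g | KL_stab (yg_perm g)].

Definition levi_set : {set ygroup N} :=
  [set g | KL_stab (yg_perm g)
           & [forall y, (y \notin ysub) ==> (yg_fun g y == 1)]].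

Definition unipotent_set : {set ygroup N} :=
  [set g | yg_perm g == 1 & [forall y, (y \in ysub) ==> (yg_fun g y == 1)]].

Lemma yact_ysub w y : KL_stab w -> (yact w y \in ysub) = (y \in ysub).
Proof.
suff sub v z : KL_stab v -> z \in ysub -> yact v z \in ysub.
  move=> sw; apply/idP/idP; last exact: sub.
  have sV : KL_stab w^-1 by case/andP: sw => *; rewrite /KL_stab !inj_stabV.
  by move/(sub _ _ sV); rewrite yactK.
case/andP=> sa sb; rewrite !inE => /orP[] /imsetP[x _ ->]; apply/orP.
  by left; rewrite yact_pull // imset_f.
by right; rewrite yact_pull // imset_f.
Qed.

Lemma KL_stab1 : KL_stab 1. Proof. by rewrite /KL_stab !inj_stab1. Qed.

Lemma KL_stabM v w : KL_stab v -> KL_stab w -> KL_stab (v * w).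
Proof. by case/andP=> ? ? /andP[? ?]; rewrite /KL_stab !inj_stabM. Qed.

Lemma KL_stabV v : KL_stab v -> KL_stab v^-1.
Proof. by case/andP=> ? ?; rewrite /KL_stab !inj_stabV. Qed.

Lemma parabolic_group_set : group_set parabolic_set.
Proof.
apply/group_setP; split=> [|g h]; rewrite !inE ?yg_perm1 ?KL_stab1 //.
by move=> sg sh; rewrite yg_permM KL_stabM.
Qed.

Lemma levi_group_set : group_set levi_set.
Proof.
apply/group_setP; split=> [|g h].
  rewrite inE yg_perm1 KL_stab1; apply/forallP => y.
  by rewrite yg_fun1 eqxx implybT.
rewrite !inE => /andP[sg /forallP tg] /andP[sh /forallP th].
rewrite yg_permM KL_stabM //=; apply/forallP => y; apply/implyP => ny.
rewrite yg_funM (eqP (implyP (th y) ny)) mulg1.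
by apply: (implyP (tg _)); rewrite yact_ysub.
Qed.

Lemma unipotent_group_set : group_set unipotent_set.
Proof.
apply/group_setP; split=> [|g h].
  by rewrite inE eqxx; apply/forallP => y; rewrite yg_fun1 eqxx implybT.
rewrite !inE => /andP[/eqP sg /forallP tg] /andP[/eqP sh /forallP th].
rewrite yg_permM sg sh mulg1 eqxx andTb; apply/forallP => y; apply/implyP => yy.
by rewrite yg_funM sh yact1 (eqP (implyP (th y) yy)) (eqP (implyP (tg y) yy)) mulg1.
Qed.

(* P_{K,L}^N, G_{K,L} and U_{K,L}^N *)
Canonical parabolic : {group ygroup N} := Group parabolic_group_set.
Canonical levi : {group ygroup N} := Group levi_group_set.
Canonical unipotent : {group ygroup N} := Group unipotent_group_set.

Lemma levi_parabolic : levi \subset parabolic.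
Proof. by apply/subsetP => g; rewrite !inE => /andP[]. Qed.

Lemma levi_norm_unipotent : levi \subset 'N(unipotent).
Proof.
apply/subsetP => g /(subsetP levi_parabolic); rewrite !inE => sg.
apply/subsetP => _ /imsetP[u + ->].
rewrite !inE => /andP[/eqP su /forallP tu]; rewrite conjgE.
rewrite !yg_permM yg_permV su mulg1 mulgV eqxx andTb.
apply/forallP => y; apply/implyP => yy; rewrite !yg_funM yg_permM yg_funV.
rewrite su mulg1 yactK.
by rewrite (eqP (implyP (tu _) _)) ?yact_ysub // mul1g mulVg.
Qed.

(* The retraction P_{K,L}^N -> G_{K,L} = G_K * G_L; its kernel is U_{K,L}^N
   and its restriction to G_{K,L} is the canonical isomorphism. *)
Definition parabolic_proj (g : ygroup N) : ygroup K * ygroup L :=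
  (yg_pull a g, yg_pull b g).

Lemma parabolic_projM : {in parabolic &, {morph parabolic_proj : g h / g * h}}.
Proof.
move=> g h; rewrite !inE => /andP[ga gb] /andP[ha hb].
by rewrite /parabolic_proj !yg_pullM.
Qed.

Canonical parabolic_proj_morphism := Morphism parabolic_projM.

Lemma levi_isoM : {in levi &, {morph parabolic_proj : g h / g * h}}.
Proof.
by move=> g h /(subsetP levi_parabolic) + /(subsetP levi_parabolic); apply: parabolic_projM.
Qed.

Definition levi_iso := Morphism levi_isoM.

End Decomposition.
End YoungGroups.

(* A representation is a homomorphism g |-> V g from G to invertible matrices,
   acting on row vectors on the right; left modules correspond to these through
   g |-> g^-1.  The constructions below are natural in G, so they commute with
   this correspondence. *)
Section Representations.

Variable k : fieldType.

Record irrep (gT : finGroupType) (G : {group gT}) := Irrep {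
  irrep_dim : nat;
  irrep_mx :> mx_representation k G irrep_dim;
  irrepP : mx_irreducible irrep_mx
}.

Lemma pull_eq (aT rT : finGroupType) (A : {group aT})
  (f : {morphism A >-> rT}) : f @*^-1 [set: rT] :==: A.
Proof. by rewrite morphpreT. Qed.

Definition pull_repr (aT rT : finGroupType) (A : {group aT})
    (f : {morphism A >-> rT}) n (V : mx_representation k [set: rT] n) :
  mx_representation k A n :=
  eqg_repr (morphpre_repr f V) (pull_eq f).

Definition outer_repr (aT bT : finGroupType) m n
    (V : mx_representation k [set: aT] m) (W : mx_representation k [set: bT] n) :
  mx_representation k [set: aT * bT] (m * n) :=
  prod_repr (pull_repr (fst_morphism aT bT) V) (pull_repr (snd_morphism aT bT) W).

Section Induction.

Variables (gT : finGroupType) (P : {group gT}) (n : nat).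
Variable V : mx_representation k P n.

Definition zero_ext (x : gT) : 'M[k]_n := if x \in P then V x else 0%R.

Definition coset_rep (i : 'I_#|rcosets P [set: gT]|) : gT := repr (enum_val i).

(* If G is the disjoint union of the cosets P t_i, the (i, j) block of the
   matrix of x on the induced representation is V (t_i x t_j^-1), or 0 when
   t_i x t_j^-1 is not in P. *)
Definition ind_mx (x : gT) :=
  (\mxblock_(i, j) zero_ext (coset_rep i * x * (coset_rep j)^-1)%g)%R.

Lemma coset_repP x : exists i, forall j,
  (x * (coset_rep j)^-1 \in P) = (j == i).
Proof.
have Px : P :* x \in rcosets P [set: gT].
  by apply/rcosetsP; exists x; rewrite ?inE.
have repE j : P :* coset_rep j = enum_val j.
  have /rcosetsP[y _ e] := enum_valP j.
  by rewrite /coset_rep e; apply: rcoset_repr.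
exists (enum_rank_in Px (P :* x)) => j.
rewrite -mem_rcoset -(inj_eq enum_val_inj) enum_rankK_in // -repE.
by apply/rcoset_eqP/eqP => ->.
Qed.

Lemma ind_mx_repr : mx_repr [set: gT] ind_mx.
Proof.
split=> [|x y _ _].
  rewrite -mxdiagZ; apply/eq_mxblock => i j; rewrite mulg1.
  have [l Pl] := coset_repP (coset_rep i).
  have := Pl i; rewrite mulgV group1 => /esym/eqP li.
  rewrite /zero_ext Pl -li eq_sym; case: eqP => [e|//].
  case: j / e; rewrite conform_mx_id mulgV; exact: repr_mx1.
rewrite mul_mxblock; apply/eq_mxblock => i j.
have [i' Pi'] := coset_repP (coset_rep i * x).
rewrite (bigD1 i') //= big1 ?addr0 => [|l /negPf nl].
  have Pix : coset_rep i * x * (coset_rep i')^-1 \in P by rewrite Pi' eqxx.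
  rewrite /zero_ext Pix.
  move: Pix; set p := coset_rep i * x * (coset_rep i')^-1 => Pix.
  have -> : coset_rep i * (x * y) * (coset_rep j)^-1
            = p * (coset_rep i' * y * (coset_rep j)^-1).
    by rewrite /p !mulgA mulgKV.
  rewrite groupMl //; case: ifP => Pj; first by rewrite repr_mxM //; apply: Pj.
  by rewrite mulmx0.
by rewrite /zero_ext Pi' nl mul0mx.
Qed.

Definition ind_repr := MxRepresentation ind_mx_repr.

End Induction.

End Representations.

Section CompositionFactors.

Variables (k : fieldType) (gT : finGroupType) (G : {group gT}) (n : nat).
Variable V : mx_representation k G n.

Lemma composition_series_exists : exists U : seq 'M[k]_n,
  mx_composition_series V U /\ (last 0%R U :=: (1%:M)%R)%MS.
Proof.
have /classicP Schreier := @mx_Schreier _ _ _ _ V [::] isT isT.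
apply: contrapT => no; apply: Schreier => -[U [sU lU _]].
by apply: no; exists U.
Qed.

Definition comp_series : seq 'M[k]_n := sval (cid composition_series_exists).

Lemma comp_seriesP : mx_composition_series V comp_series.
Proof. by rewrite /comp_series; case: cid => U []. Qed.

Definition comp_factor (i : 'I_(size comp_series)) : irrep k G :=
  Irrep (mx_series_repr_irr comp_seriesP (ltn_ord i)).

(* In the Grothendieck group of Rep(G), free abelian on the irreducible
   representations, the class of V is the sum of its composition factors. *)
Definition comp_factors : seq (irrep k G) := codom comp_factor.

End CompositionFactors.

Section TrivialRepresentation.

Variables (k : fieldType) (gT : finGroupType).

Lemma triv_mx_repr : mx_repr [set: gT] (fun=> 1%:M : 'M[k]_1)%R.
Proof. by split=> // x y _ _; rewrite mulmx1. Qed.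

Definition triv_repr := MxRepresentation triv_mx_repr.

Definition triv_irrep : irrep k [set: gT] :=
  Irrep (mx_abs_irrW (linear_mx_abs_irr triv_repr erefl)).

End TrivialRepresentation.

Section Similarity.

Variable k : fieldType.

Lemma rsim_pointwise (gT : finGroupType) (G : {group gT}) n
    (V W : mx_representation k G n) :
  {in G, V =1 W} -> mx_rsim V W.
Proof.
move=> e; apply: (@MxReprSim _ _ _ _ _ _ _ (1%:M)%R); rewrite ?row_free_unit ?unitmx1 //.
by move=> x Gx; rewrite mulmx1 mul1mx e.
Qed.

Lemma rsim_pull (aT rT : finGroupType) (A : {group aT})
    (f : {morphism A >-> rT}) m n
    (V : mx_representation k [set: rT] m) (W : mx_representation k [set: rT] n) :
  mx_rsim V W -> mx_rsim (pull_repr f V) (pull_repr f W).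
Proof.
case=> B mn Bfree hom; apply: (@MxReprSim _ _ _ _ _ _ _ B) => // x _.
by apply: hom; rewrite inE.
Qed.

End Similarity.

Section BasisOfR.

Variables (k : fieldType) (Y : young_set) (H : finGroupType).

Local Notation G_ N := [set: ygroup Y H N].

Definition Ad (N M : finType) (w : bijection N M) n
    (V : mx_representation k (G_ N) n) : mx_representation k (G_ M) n :=
  pull_repr (yg_conj_morphism Y H w) V.

Lemma yg_conj_onto (N M : finType) (w : bijection N M) :
  G_ N \subset yg_conj_morphism Y H w @* G_ M.
Proof.
apply/subsetP => g _; apply/morphimP.
exists (yg_conj (Bijection (bij_ofK w) (bij_toK w)) g); rewrite ?inE //=.
apply: ygroupP => [|y] /=.
  by apply/permP => x; rewrite !permE /= ?permE /= !bij_toK.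
rewrite !ffunE -ymap_compE -[in LHS](ymap_idE y); congr (yg_fun g _).
by apply: ymap_eq => x; rewrite inj_cmpE inj_idmE bij_toK.
Qed.

(* An irreducible representation of G_N for some finite set N. *)
Record any_irrep := AnyIrrep {
  any_set : finType;
  any_rep : irrep k (G_ any_set)
}.

Definition irr_equiv (d e : any_irrep) : Prop :=
  exists w : bijection (any_set d) (any_set e),
    mx_rsim (Ad w (any_rep d)) (any_rep e).

Lemma irr_equiv_refl d : irr_equiv d d.
Proof.
have idK : cancel (inj_idm (any_set d)) (inj_idm (any_set d)).
  by move=> x; rewrite !inj_idmE.
exists (Bijection idK idK); apply: rsim_pointwise => g _ /=.
congr (any_rep d _); apply: ygroupP => [|y] /=.
  by apply/permP => x; rewrite permE !inj_idmE.
by rewrite ffunE ymap_idE.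
Qed.

Lemma irr_equiv_sym d e : irr_equiv d e -> irr_equiv e d.
Proof.
case=> w sw; exists (Bijection (bij_ofK w) (bij_toK w)).
apply: mx_rsim_trans (rsim_pull _ (mx_rsim_sym sw)) _.
apply: rsim_pointwise => g _ /=; congr (any_rep d _); apply: ygroupP => [|y] /=.
  by apply/permP => x; rewrite !permE /= ?permE /= !bij_toK.
rewrite !ffunE -ymap_compE -[in RHS](ymap_idE y); congr (yg_fun g _).
by apply: ymap_eq => x; rewrite inj_cmpE inj_idmE bij_toK.
Qed.

Lemma irr_equiv_trans d e f : irr_equiv d e -> irr_equiv e f -> irr_equiv d f.
Proof.
case=> v sv [w sw].
have toK : cancel (inj_cmp (bij_to w) (bij_to v)) (inj_cmp (bij_of v) (bij_of w)).
  by move=> x; rewrite !inj_cmpE !bij_toK.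
have ofK : cancel (inj_cmp (bij_of v) (bij_of w)) (inj_cmp (bij_to w) (bij_to v)).
  by move=> x; rewrite !inj_cmpE !bij_ofK.
exists (Bijection toK ofK); apply: mx_rsim_trans sw.
apply: mx_rsim_trans (rsim_pull _ sv).
apply: rsim_pointwise => g _ /=; congr (any_rep d _); apply: ygroupP => [|y] /=.
  by apply/permP => x; rewrite !permE /= ?permE !inj_cmpE.
by rewrite !ffunE ymap_compE.
Qed.

(* The quotient of [any_irrep] by [irr_equiv] is the basis of R.  As
   [any_irrep] lives in a larger universe than the elements of a [choiceType],
   an equivalence class is represented by its trace on the irreducible
   representations attached to the sets ['I_n]; [irr_classP] and [irr_reprK]
   state that this is the quotient set. *)
Record small_irrep := SmallIrrep {
  small_card : nat;
  small_rep : irrep k (G_ 'I_small_card)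
}.

Definition small_any (s : small_irrep) : any_irrep := AnyIrrep (small_rep s).

Definition irr_basis_sort :=
  {c : small_irrep -> Prop | exists d, c = fun s => irr_equiv d (small_any s)}.

Definition irr_basis : choiceType := {classic irr_basis_sort}.

Definition irr_class (d : any_irrep) : irr_basis :=
  exist _ _ (ex_intro _ d erefl).

Definition irr_repr (b : irr_basis) : any_irrep := sval (cid (svalP b)).

Lemma irr_reprK : cancel irr_repr irr_class.
Proof.
move=> b; rewrite /irr_repr; case: cid => d /= e.
by case: b e => c pc /= e; apply: eq_exist.
Qed.

Lemma small_equiv d : exists s, irr_equiv d (small_any s).
Proof.
case: d => N V.
pose w := Bijection
  (fun x => etrans (congr1 _ (mk_injE (@enum_rank_inj N) x))
             (etrans (mk_injE (@enum_val_inj N (mem N)) _) (enum_rankK x)))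
  (fun i => etrans (congr1 _ (mk_injE (@enum_val_inj N (mem N)) i))
             (etrans (mk_injE (@enum_rank_inj N) _) (enum_valK i))).
have irrW : mx_irreducible (Ad w V).
  apply/eqg_mx_irr/morphpre_mx_irr; last exact: irrepP.
  exact: yg_conj_onto.
exists (SmallIrrep (Irrep irrW)); exists w; exact: mx_rsim_refl.
Qed.

Lemma irr_classP d e : irr_class d = irr_class e <-> irr_equiv d e.
Proof.
split=> [E | de].
  have [s es] := small_equiv e.
  have : sval (irr_class e) s by [].
  by rewrite -E /= => ds; apply: irr_equiv_trans ds (irr_equiv_sym es).
rewrite /irr_class; apply: eq_exist; apply: funext => s; apply: propext.
split; apply: irr_equiv_trans => //; exact: irr_equiv_sym.
Qed.

End BasisOfR.

(* [fgen b] is the basis element b of {freeg B}, and {freeg B * C} is the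
   tensor product of {freeg B} and {freeg C}. *)
Section FreeAbelian.

Local Open Scope ring_scope.

Definition fgen (B : choiceType) (b : B) : {freeg B} := [freeg [:: (1, b)]].

Definition flift (B : choiceType) (M : lmodType int) (f : B -> M) :
  {freeg B} -> M := fglift f.

HB.instance Definition _ (B : choiceType) (M : lmodType int) (f : B -> M) :=
  GRing.isZmodMorphism.Build {freeg B} M (flift f) (lift_is_additive f).

Definition tensor (B C : choiceType) (x : {freeg B}) (y : {freeg C}) :
  {freeg B * C} := flift (fun b => flift (fun c => fgen (b, c)) y) x.

Definition tensor_map (B B' C C' : choiceType)
    (f : {freeg B} -> {freeg B'}) (g : {freeg C} -> {freeg C'}) :
  {freeg B * C} -> {freeg B' * C'} :=
  flift (fun p => tensor (f (fgen p.1)) (g (fgen p.2))).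

Definition tensor_assoc (B C D : choiceType) :
  {freeg B * C * D} -> {freeg B * (C * D)} :=
  flift (fun p => fgen (p.1.1, (p.1.2, p.2))).

Definition tensor_swap (B C : choiceType) : {freeg B * C} -> {freeg C * B} :=
  flift (fun p => fgen (p.2, p.1)).

Definition tensor_swap_mid (B C D E : choiceType) :
  {freeg (B * C) * (D * E)} -> {freeg (B * D) * (C * E)} :=
  flift (fun p => fgen ((p.1.1, p.2.1), (p.1.2, p.2.2))).

Definition nonneg (B : choiceType) (x : {freeg B}) : Prop :=
  forall b, 0 <= coeff b x.

Definition inner (B : choiceType) (x y : {freeg B}) : int :=
  \sum_(b <- dom x) coeff b x * coeff b y.

Section Hopf.

Variables (B : choiceType) (gr : B -> nat).
Variable m : {additive {freeg B * B} -> {freeg B}}.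
Variable D : {additive {freeg B} -> {freeg B * B}}.
Variable e : {additive int -> {freeg B}}.
Variable eps : {additive {freeg B} -> int}.

Implicit Types (x y z : {freeg B}).

Definition homogeneous (n : nat) x : Prop :=
  forall b, coeff b x != 0 -> gr b = n.

Definition homogeneous2 (n : nat) (t : {freeg B * B}) : Prop :=
  forall p, coeff p t != 0 -> (gr p.1 + gr p.2)%N = n.

Record is_algebra : Prop := {
  mul_assoc : forall x y z,
    m (tensor (m (tensor x y)) z) = m (tensor x (m (tensor y z)));
  mul_unit_l : forall x, m (tensor (e 1) x) = x;
  mul_unit_r : forall x, m (tensor x (e 1)) = x
}.

Record is_coalgebra : Prop := {
  comul_coassoc : forall x,
    tensor_assoc (tensor_map D idfun (D x)) = tensor_map idfun D (D x);
  comul_counit_l : forall x, flift (fun p => eps (fgen p.1) *: fgen p.2) (D x) = x;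
  comul_counit_r : forall x, flift (fun p => eps (fgen p.2) *: fgen p.1) (D x) = x
}.

Record is_bialgebra : Prop := {
  bialg_algebra : is_algebra;
  bialg_coalgebra : is_coalgebra;
  comul_mul : forall x y, D (m (tensor x y)) =
    tensor_map m m (tensor_swap_mid (tensor (D x) (D y)));
  comul_unit : D (e 1) = tensor (e 1) (e 1);
  counit_mul : forall x y, eps (m (tensor x y)) = eps x * eps y;
  counit_unit : eps (e 1) = 1
}.

Record is_graded : Prop := {
  mul_graded : forall i j x y, homogeneous i x -> homogeneous j y ->
    homogeneous (i + j) (m (tensor x y));
  comul_graded : forall n x, homogeneous n x -> homogeneous2 n (D x);
  unit_graded : forall c : int, homogeneous 0 (e c);
  counit_graded : forall n x, homogeneous n x -> (0 < n)%N -> eps x = 0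
}.

Definition is_antipode (S : {freeg B} -> {freeg B}) : Prop := forall x,
  m (tensor_map S idfun (D x)) = e (eps x) /\
  m (tensor_map idfun S (D x)) = e (eps x).

Record is_graded_hopf : Prop := {
  hopf_bialgebra : is_bialgebra;
  hopf_graded : is_graded;
  hopf_antipode : exists S : {additive {freeg B} -> {freeg B}},
    is_antipode S /\ (forall n x, homogeneous n x -> homogeneous n (S x))
}.

Definition is_connected : Prop :=
  injective e /\
  (forall c : int, homogeneous 0 (e c)) /\
  (forall x, homogeneous 0 x -> exists c : int, e c = x).

Definition is_commutative : Prop := forall t, m (tensor_swap t) = m t.

Definition is_cocommutative : Prop := forall x, tensor_swap (D x) = D x.

Record is_positive : Prop := {
  mul_pos : forall t, nonneg t -> nonneg (m t);
  comul_pos : forall x, nonneg x -> nonneg (D x);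
  unit_pos : forall c : int, 0 <= c -> nonneg (e c);
  counit_pos : forall x, nonneg x -> 0 <= eps x
}.

Record is_self_adjoint : Prop := {
  mul_comul_adj : forall t x, inner (m t) x = inner t (D x);
  unit_counit_adj : forall (c : int) x, inner (e c) x = c * eps x
}.

Record is_PSH : Prop := {
  psh_hopf : is_graded_hopf;
  psh_connected : is_connected;
  psh_positive : is_positive;
  psh_self_adjoint : is_self_adjoint
}.

End Hopf.
End FreeAbelian.

Section StructureMaps.

Variables (k : fieldType) (Y : young_set) (H : finGroupType).

Local Notation G_ N := [set: ygroup Y H N].
Local Notation basis := (irr_basis k Y H).
Local Notation RY := {freeg basis}.
Local Notation RY2 := {freeg basis * basis}.

(* The composite Rep(G_N) -> R(G_N) -> R. *)
Definition Rclass (N : finType) n (V : mx_representation k (G_ N) n) : RY :=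
  (\sum_(W <- comp_factors V) fgen (irr_class (AnyIrrep W)))%R.

Section KL.

Variables (K L N : finType) (a : injection K N) (b : injection L N).

(* The irreducible representation of G_{K,L} = G_K * G_L corresponding to a
   pair of irreducible representations of G_K and G_L. *)
Definition levi_tensor (V : irrep k (G_ K)) (W : irrep k (G_ L)) :=
  pull_repr (levi_iso Y H a b) (outer_repr V W).

(* R(G_{K,L}) -> R(G_K) * R(G_L) on an irreducible representation; over an
   algebraically closed field the default value 0 is never used. *)
Definition levi_irr_class (X : irrep k (levi Y H a b)) : RY2 :=
  if pselect (exists p : irrep k (G_ K) * irrep k (G_ L),
                mx_rsim X (levi_tensor p.1 p.2)) is left ex
  then let p := sval (cid ex) in
       fgen (irr_class (AnyIrrep p.1), irr_class (AnyIrrep p.2))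
  else 0%R.

Definition levi_class n (X : mx_representation k (levi Y H a b) n) : RY2 :=
  (\sum_(W <- comp_factors X) levi_irr_class W)%R.

(* i_{K,L}^N, precomposed with R(G_K) * R(G_L) = R(G_{K,L}) *)
Definition i_repr m n (V : mx_representation k (G_ K) m)
    (W : mx_representation k (G_ L) n) :=
  ind_repr (pull_repr (parabolic_proj_morphism Y H a b) (outer_repr V W)).

Variables (n : nat) (V : mx_representation k (G_ N) n).

Definition res_repr : mx_representation k (levi Y H a b) n :=
  subg_repr V (subsetT (levi Y H a b)).

Lemma fixed_module : mxmodule res_repr (rfix_mx V (unipotent Y H a b)).
Proof.
rewrite /mxmodule /res_repr rstabs_subg subsetI subxx /=.
apply: subset_trans (norm_sub_rstabs_rfix_mx V (subsetT _)).
by rewrite subsetI subsetT levi_norm_unipotent.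
Qed.

(* r_{K,L}^N *)
Definition r_repr := submod_repr fixed_module.

End KL.

Definition orbit_reps (N : finType) : {set {set N}} :=
  orbit_transversal ('P^*)%act [set: {perm N}] [set: {set N}].

Definition Rdeg (b : basis) : nat := #|any_set (irr_repr b)|.

Definition mul_irr (p : basis * basis) : RY :=
  let V := irr_repr p.1 in let W := irr_repr p.2 in
  Rclass (i_repr (inj_left (any_set V) (any_set W))
                 (inj_right (any_set V) (any_set W)) (any_rep V) (any_rep W)).

Definition Delta_irr (b : basis) : RY2 :=
  let V := irr_repr b in
  (\sum_(K in orbit_reps (any_set V))
    levi_class (res_repr (inj_sub K) (inj_sub (~: K)) (any_rep V)))%R.

Definition delta_irr (b : basis) : RY2 :=
  let V := irr_repr b in
  (\sum_(K in orbit_reps (any_set V))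
    levi_class (r_repr (inj_sub K) (inj_sub (~: K)) (any_rep V)))%R.

Definition triv_class : basis :=
  irr_class (AnyIrrep (triv_irrep k (ygroup Y H void))).

Definition Rmul : {additive RY2 -> RY} := flift mul_irr.
Definition RDelta : {additive RY -> RY2} := flift Delta_irr.
Definition Rdelta : {additive RY -> RY2} := flift delta_irr.
Definition Runit : {additive int -> RY} := intmul (fgen triv_class).
Definition Rcounit : {additive RY -> int} := coeff triv_class.

End StructureMaps.

(* Main.v *)
From HB Require Import structures.
From mathcomp Require Import all_boot all_order all_algebra all_fingroup.
From mathcomp Require Import mxrepresentation character boolp.
From mathcomp.multinomials Require Import freeg.
Require Import Defs.

Set Implicit Arguments.
Unset Strict Implicit.
Unset Printing Implicit Defensive.

Import Order.TTheory GroupScope GRing.Theory Num.Theory.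
Local Open Scope ring_scope.

(** Everything is read off characters.  For an irreducible d of G_M, let
    [char_of d g] be its character at g in G_N, transported along any bijection
    of N with M, and 0 if there is none.  Extended additively, an element x of
    R becomes a function [ch g x] of all pairs of a finite set N and an element
    g of G_N; it is invariant under bijections and conjugation, and by the
    orthogonality relations it determines x ([ch_inj]).  The same holds on the
    tensor square and cube of R.  So every identity of the theorem may be
    checked on these functions, once the structure maps are known there.

    Restriction.  If g preserves a subset A of N, it restricts to an element
    g|A of G_A (permutation of A, values on Y_A), and more generally it pulls
    back along injections K -> N with stable image ([yg_pull]).

    Multiplication.  The cosets of P_{K,L} in G_{K+L} are the subsets of K+L
    with #K elements, and the formula for induced characters becomes
      (F1 F2)(N, g) = sum over g-stable A in N of F1(A, g|A) F2(A^c, g|A^c)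
    ([cmul], [char_induced], [ch_mul]).  Associativity, commutativity and unit
    are then statements about sums over subsets.

    Comultiplication.  Elements x of G_K and y of G_L, with a function v on
    Y_{K+L}, are glued to an element [glue x y v] of G_{K+L}: it is x on K and
    Y_K, y on L and Y_L, and v on the rest of Y_{K+L}.  The character of Delta
    at (x, y) is the character of the given representation at [glue x y 1], and
    that of delta is the average over all v, because averaging over U_{K,L}
    projects onto the fixed vectors.  Both are instances of one formula, the
    expectation over v with independent values distributed with weight p on H:
    p is the unit mass at 1 for Delta and is uniform for delta
    ([ev_Delta_irr], [ev_delta_irr]).  Thus both Hopf algebras come from one
    argument, valid for every p of total weight 1 ([graded_hopf]).

    Coassociativity says that two ways of gluing three elements agree
    ([glue_assoc]).  For the compatibility of product and coproduct, a stable
    subset of K+L is a pair of stable subsets A1, A2 of K and L, and the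
    restriction of [glue x y v] to it is the gluing of x|A1 and y|A2 along the
    restriction of v ([glue_pull_sum]); this is where Y_A and Y_B must meet in
    the set attached to the intersection of A and B.  As Y of the empty set is
    empty, the values of v that matter for a subset and for its complement are
    disjoint, so the expectation of the product is the product of expectations
    ([wavg_indep], [comul_multiplicative]).

    The antipode of a connected graded bialgebra is a geometric series for the
    convolution product.  Self-adjointness of m and delta is Frobenius
    reciprocity: the inner product of an induced character with a character of
    G_{K+L} is an average over P_{K,L}, and that average is taken first over v
    and then over x and y ([parabolic_average], [Rmul_Rdelta_reciprocity]). *)

(** * Traces of composition factors *)
Section TraceOfFactors.

Variable k : fieldType.

(** The coordinate maps of a submodule and of its quotient are right
    multiplications.  Only the existence of the matrix is recorded, so that
    associativity steps do not unfold the Gaussian elimination behind it. *)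
Lemma in_submod_mulE m (U : 'M[k]_m) :
  exists I, forall p (A : 'M_(p, m)), in_submod U A = A *m I.
Proof. by exists (in_submod U 1%:M) => p A; apply: in_submodE. Qed.

Lemma val_submod_mulE m (U : 'M[k]_m) :
  exists I, forall p (A : 'M_(p, \rank U)), val_submod A = A *m I.
Proof. by exists (val_submod 1%:M) => p A; apply: val_submodE. Qed.

Lemma in_factmod_mulE m (U : 'M[k]_m) :
  exists I, forall p (A : 'M_(p, m)), in_factmod U A = A *m I.
Proof. by exists (in_factmod U 1%:M) => p A; apply: in_factmodE. Qed.

Lemma val_factmod_mulE m (U : 'M[k]_m) :
  exists I, forall p (A : 'M_(p, \rank (cokermx U))), val_factmod A = A *m I.
Proof. by exists (val_factmod 1%:M) => p A; apply: val_factmodE. Qed.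

(** The coordinate maps give a projection E onto U whose complementary
    projection factors through the quotient by U; this splits traces along U. *)
Lemma submod_proj m (U : 'M[k]_m) : exists E : 'M_m,
  [/\ (E <= U)%MS, forall p (A : 'M_(p, m)), (A <= U)%MS -> A *m E = A &
      forall p (A : 'M_(p, m)), A *m E + val_factmod (in_factmod U A) = A].
Proof.
exists (val_submod (in_submod U 1%:M)).
have EE p (A : 'M_(p, m)) : 
    A *m val_submod (in_submod U 1%:M) = val_submod (in_submod U A).
  by rewrite val_submodE mulmxA -in_submodE -val_submodE.
split=> [|p A AU|p A]; first exact: val_submodP.
  by rewrite EE in_submodK.
by rewrite EE add_sub_fact_mod.
Qed.

Variables (gT : finGroupType) (G : {group gT}).

(** By the cyclicity of the trace, applied to the inclusion of U and the
    projection E. *)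
Lemma mxtrace_submod_proj n (V : mx_representation k G n) (U : 'M_n)
    (modU : mxmodule V U) (E : 'M_n) x :
    x \in G -> (E <= U)%MS ->
    (forall p (A : 'M_(p, n)), (A <= U)%MS -> A *m E = A) ->
  \tr (submod_repr modU x) = \tr (V x *m E).
Proof.
move=> Gx EU fixE.
rewrite -[E in RHS](in_submodK EU) /= /submod_mx.
have EV : (val_submod (1%:M : 'M_(\rank U)) *m V x <= U)%MS.
  by apply: submx_trans (submxMr _ (val_submodP _)) (mxmoduleP modU x Gx).
rewrite -(fixE _ _ EV) {EV}.
have [I IE] := in_submod_mulE U; have [J JE] := val_submod_mulE U.
by rewrite !IE !JE mul1mx mulmxA [RHS]mxtrace_mulC !mulmxA.
Qed.

(** If E projects onto U and F projects the quotient by U onto the image of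
    W, then E plus the lift of F is a projection onto W. *)
Lemma mxtrace_section n (V : mx_representation k G n) (U W : 'M_n)
    (modU : mxmodule V U) (modW : mxmodule V W) x :
    x \in G -> (U <= W)%MS ->
  \tr (submod_repr modW x)
  = \tr (submod_repr modU x) + \tr (section_repr modU modW x).
Proof.
move=> Gx UW; pose S := <<in_factmod U W>>%MS.
have [E [EU fixE dec]] := submod_proj U; have [F [FS fixF _]] := submod_proj S.
rewrite /section_repr (mxtrace_submod_proj _ Gx FS fixF).
rewrite (mxtrace_submod_proj _ Gx EU fixE) /= /factmod_mx.
have [I IE] := in_factmod_mulE U; have [J JE] := val_factmod_mulE U.
have dec' p (A : 'M_(p, n)) : A *m E + A *m I *m J = A by rewrite -IE -JE dec.
rewrite [in_factmod U (_ *m _)]IE [val_factmod 1%:M]JE mul1mx -!mulmxA.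
rewrite [\tr (J *m _)]mxtrace_mulC -!mulmxA -mxtraceD -mulmxDr.
apply: mxtrace_submod_proj => // [|p A AW].
  rewrite addmx_sub ?(submx_trans EU) // mulmxA -JE.
  apply: (submx_trans (_ : _ <= val_factmod (in_factmod U W))%MS).
    by rewrite val_factmodS -(genmxE (in_factmod U W)) mulmx_sub.
  have -> : val_factmod (in_factmod U W) = W - W *m E.
    by rewrite JE IE -[X in X - _](dec' _ W) addrC addKr.
  by rewrite addmx_sub // eqmx_opp mulmx_sub // (submx_trans EU).
rewrite mulmxDr !mulmxA fixF ?dec' //.
by rewrite /S genmxE -IE submxMr.
Qed.

Variables (n : nat) (V : mx_representation k G n).

(** The traces on the terms of a composition series telescope. *)
Lemma mxtrace_comp_factors x : x \in G ->
  \tr (V x) = \sum_(W <- comp_factors V) \tr (W x).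
Proof.
move=> Gx; rewrite /comp_factors /codom big_image /=.
have := comp_seriesP V; rewrite /comp_factor.
have lastS : (last 0 (comp_series V) :=: 1%:M)%MS.
  by rewrite /comp_series; case: cid => U [].
move: (comp_seriesP V) => P0 _.
pose T i := \tr (submod_repr (mx_subseries_module' i (proj1 P0)) x).
transitivity (T (size (comp_series V)) - T 0%N).
  rewrite [T 0%N]big1 ?subr0 => [|i _]; last first.
    by case: (cast_ord (mxrank0 k n n) i).
  rewrite /T (mxtrace_submod1 _ _ Gx) //.
  by rewrite (last_nth 0) in lastS.
rewrite -telescope_sumr // big_mkord; apply: eq_bigr => i _.
have [_ /(_ i (ltn_ord i))[/ltmxW lei _]] := P0.
have := mxtrace_section (mx_subseries_module' i (proj1 P0)) 
  (mx_subseries_module i (proj1 P0)) Gx lei.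
by rewrite /T => /(canLR (addKr _)) <-; rewrite addrC.
Qed.

End TraceOfFactors.

(** * Orthogonality of characters and outer tensor products *)
Section Schur.

Variables (k : fieldType) (gT : finGroupType) (G : {group gT}).

(** Schur's lemma: the kernel and the image of an intertwiner are
    submodules. *)
Lemma irr_hom_rsim n1 n2 (V : mx_representation k G n1)
    (W : mx_representation k G n2) (A : 'M_(n1, n2)) :
    mx_irreducible V -> mx_irreducible W -> A != 0 ->
    {in G, forall x, V x *m A = A *m W x} ->
  mx_rsim V W.
Proof.
move=> irrV irrW nzA homA; have /mx_irrP[n1_gt0 minV] := irrV.
have /mx_irrP[n2_gt0 minW] := irrW.
have freeA : row_free A.
  rewrite -kermx_eq0; apply: contraNT nzA => nzK.
  have /minV/(_ nzK) : mxmodule V (kermx A).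
    apply/mxmoduleP => x Gx; apply/sub_kermxP.
    by rewrite -mulmxA homA // mulmxA mulmx_ker mul0mx.
  by rewrite -sub1mx => /sub_kermxP; rewrite mul1mx => ->.
have fullA : row_full A.
  have modA : mxmodule W <<A>>%MS.
    apply/mxmoduleP => x Gx; rewrite (eqmxMr _ (genmxE A)) genmxE -homA //.
    exact: submxMl.
  have := minW _ modA; rewrite -mxrank_eq0 genmxE mxrank_eq0 => /(_ nzA).
  by rewrite /row_full genmxE.
apply: (@MxReprSim _ _ _ _ _ _ _ A) => //.
by rewrite -(eqP freeA) (eqP fullA).
Qed.

Lemma mxtrace_mul_sum n1 n2 (A : 'M[k]_n1) (B : 'M[k]_n2) :
  \tr A * \tr B = \sum_i \sum_j (A *m delta_mx i j *m B) i j.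
Proof.
rewrite /mxtrace big_distrl; apply: eq_bigr => i _; rewrite big_distrr.
apply: eq_bigr => j _ /=; rewrite mxE (bigD1 j) //= big1 ?addr0 => [|l nl].
  rewrite mxE (bigD1 i) //= big1 ?addr0 => [|l nl]; rewrite !mxE.
    by rewrite !eqxx mulr1.
  by rewrite (negPf nl) mulr0.
rewrite mxE big1 ?mul0r // => m _.
by rewrite mxE (negPf nl) andbF mulr0.
Qed.

(** Averaging a matrix over G (up to the factor #|G|) makes it commute with
    the action of G. *)
Definition average n1 n2 (V : mx_representation k G n1)
    (W : mx_representation k G n2) (M : 'M_(n1, n2)) :=
  \sum_(g in G) V g^-1%g *m M *m W g.

Lemma average_hom n1 n2 (V : mx_representation k G n1)
    (W : mx_representation k G n2) (M : 'M_(n1, n2)) :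
  {in G, forall x, V x *m average V W M = average V W M *m W x}.
Proof.
move=> x Gx; rewrite /average mulmx_suml mulmx_sumr.
rewrite [RHS](reindex_inj (mulIg x^-1%g)) /=; apply: eq_big => g.
  by rewrite groupMr ?groupV.
move=> Gg; rewrite invMg invgK repr_mxM ?groupV // -!mulmxA.
by rewrite -repr_mxM ?groupM ?groupV // mulgKV.
Qed.

(** A product of two traces is a sum of entries of averages of elementary
    matrices, to which Schur's lemma applies. *)
Lemma mxtrace_rep_mul_sum n1 n2 (V : mx_representation k G n1)
    (W : mx_representation k G n2) :
  \sum_(g in G) \tr (V g^-1%g) * \tr (W g)
  = \sum_i \sum_j average V W (delta_mx i j) i j.
Proof.
under eq_bigr do rewrite mxtrace_mul_sum.
rewrite exchange_big; apply: eq_bigr => i _ /=.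
by rewrite exchange_big; apply: eq_bigr => j _ /=; rewrite summxE.
Qed.

End Schur.

Section Orthogonality.

Variables (k : closedFieldType) (k_char0 : [pchar k] =i pred0).
Variables (gT : finGroupType) (G : {group gT}).

Lemma natk_eq0 n : (n%:R == 0 :> k) = (n == 0)%N.
Proof. by move/pcharf0P: k_char0. Qed.

Lemma natk_neq0 n : (0 < n)%N -> n%:R != 0 :> k.
Proof. by rewrite natk_eq0 -lt0n. Qed.

Lemma natk_eq1 n : (n%:R == 1 :> k) -> n = 1%N.
Proof.
case: n => [|n]; first by rewrite eq_sym oner_eq0.
by rewrite -natr1 -subr_eq0 addrK natk_eq0 => /eqP->.
Qed.

(** Averages of elementary matrices vanish between representations that
    are not similar, and are scalars otherwise; the scalar is found from its
    trace. *)
Lemma irr_orthogonal (V W : irrep k G) :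
  \sum_(g in G) \tr (V g^-1%g) * \tr (W g)
  = if `[< mx_rsim V W >] then #|G|%:R else 0.
Proof.
case: asboolP => [VW | nVW]; last first.
  rewrite mxtrace_rep_mul_sum big1 // => i _; rewrite big1 // => j _.
  suff -> : average V W (delta_mx i j) = 0 by rewrite mxE.
  apply: contra_notP nVW => /eqP nzA.
  by apply: irr_hom_rsim nzA (average_hom _ _ _); apply: irrepP.
under eq_bigr => g Gg do rewrite -(mxtrace_rsim VW Gg).
rewrite mxtrace_rep_mul_sum; case: V VW => n V irrV VW /=.
have n_gt0 : (0 < n)%N by have /mx_irrP[] := irrV.
have scalA i j : average V V (delta_mx i j) = ((i == j)%:R * #|G|%:R / n%:R)%:M.
  set A := average _ _ _; have centA : centgmx V A.
    by apply/centgmxP => x Gx; rewrite average_hom.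
  have /is_scalar_mxP[c defA] : is_scalar_mx A.
    by apply: mx_abs_irr_cent_scalar centA; apply: group_closure_closed_field.
  rewrite defA; congr _%:M; have : \tr A = (i == j)%:R * #|G|%:R.
    rewrite /A /average raddf_sum /= mulr_natr -sumr_const.
    apply: eq_bigr => g Gg; rewrite mxtrace_mulC mulmxA repr_mxV //.
    rewrite mulmxV ?repr_mx_unit // mul1mx /mxtrace (bigD1 i) //= big1.
      by rewrite addr0 mxE eqxx.
    by move=> l /negPf nl; rewrite mxE nl.
  rewrite defA mxtrace_scalar => <-.
  by rewrite -[c *+ n]mulr_natr mulfK ?natk_neq0.
transitivity (\sum_(i < n) #|G|%:R / n%:R : k); last first.
  by rewrite sumr_const card_ord -[LHS]mulr_natr divfK ?natk_neq0.
apply: eq_bigr => i _; rewrite (bigD1 i) //= big1 => [|j /negPf nj].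
  by rewrite scalA mxE eqxx addr0 mulr1n mul1r.
by rewrite scalA mxE eq_sym nj.
Qed.

(** A composition series of length one ends with the whole space, so the
    representation is its only factor. *)
Lemma factors_irr n (V : mx_representation k G n) :
  size (comp_factors V) = 1%N -> mx_irreducible V.
Proof.
rewrite /comp_factors /codom size_image card_ord.
have := comp_seriesP V.
have : (last 0 (comp_series V) :=: 1%:M)%MS.
  by rewrite /comp_series; case: cid => U [].
case: (comp_series V) => [|U []] //= U1 [_ /(_ 0%N isT)[/= lt0U maxU]] _.
split=> [||W modW _ nzW]; first exact: mxmodule1.
  by rewrite -mxrank_eq0 -U1 mxrank_eq0 -submx0; case/andP: lt0U.
rewrite -U1; apply: contraPT (maxU W) => nUW; apply/not_implyP; split.
  split; [exact: modW | | ].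
    by rewrite lt0mx.
  by rewrite /ltmx nUW U1 submx1.
by [].
Qed.

(** The norm of a character counts the pairs of similar composition factors
    and each factor is similar to itself, so norm one leaves a single factor. *)
Lemma irr_of_norm n (V : mx_representation k G n) :
  \sum_(g in G) \tr (V g^-1%g) * \tr (V g) = #|G|%:R -> mx_irreducible V.
Proof.
move=> norm1; apply: factors_irr; set s := comp_factors V.
have : \sum_(X <- s) \sum_(Z <- s) `[< mx_rsim X Z >]%:R = 1 :> k.
  apply: (mulIf (natk_neq0 (cardG_gt0 G))); rewrite mul1r -[RHS]norm1.
  rewrite big_distrl /=.
  under [LHS]eq_bigr => X _.
    rewrite big_distrl /=; under eq_bigr => Z _.
      rewrite mulr_natl mulrb -irr_orthogonal; over.
    rewrite exchange_big /=; over.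
  rewrite exchange_big /=; apply: eq_bigr => g Gg.
  rewrite !mxtrace_comp_factors ?groupV // big_distrl /=.
  by apply: eq_bigr => X _; rewrite big_distrr.
under eq_bigr do rewrite -natr_sum.
rewrite -natr_sum => /eqP/natk_eq1 sum1.
apply/eqP; rewrite eqn_leq; apply/andP; split.
  rewrite -[X in (_ <= X)%N]sum1; elim: (s) => [|X t IHt] //=.
  rewrite !big_cons (_ : `[< _ >] = true); last by apply/asboolP/mx_rsim_refl.
  rewrite -addnA add1n ltnS (leq_trans IHt) // (leq_trans _ (leq_addl _ _)) //.
  under [X in (_ <= X)%N]eq_bigr do rewrite big_cons.
  by rewrite big_split /= leq_addl.
by move: sum1; case: (s) => //; rewrite big_nil.
Qed.

End Orthogonality.

Section OuterTensor.

Variables (k : closedFieldType) (k_char0 : [pchar k] =i pred0).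
Variables (aT bT : finGroupType).

Lemma mxtrace_outer m n (V : mx_representation k [set: aT] m)
    (W : mx_representation k [set: bT] n) g :
  \tr (outer_repr V W g) = \tr (V g.1) * \tr (W g.2).
Proof. exact: mxtrace_prod. Qed.

(** Norms of characters multiply under outer tensor products. *)
Lemma outer_irr (V : irrep k [set: aT]) (W : irrep k [set: bT]) :
  mx_irreducible (outer_repr V W).
Proof.
apply: (irr_of_norm k_char0).
under eq_bigr do rewrite !mxtrace_outer mulrACA.
rewrite (eq_bigl (fun=> true)) => [|g]; last by rewrite inE.
rewrite -(pair_big xpredT xpredT (fun g h => \tr (V g^-1%g) * \tr (V g) *
           (\tr (W h^-1%g) * \tr (W h)))) /=.
have sumT (gT : finGroupType) (X : irrep k [set: gT]) :
    \sum_g \tr (X g^-1%g) * \tr (X g) = #|gT|%:R.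
  have := irr_orthogonal k_char0 X X.
  rewrite (_ : `[< _ >] = true); last by apply/asboolP/mx_rsim_refl.
  by rewrite -cardsT => <-; apply: eq_bigl => g; rewrite inE.
under eq_bigr do rewrite -big_distrr /= sumT.
by rewrite -big_distrl /= sumT cardsT card_prod natrM.
Qed.

Variables (gT : finGroupType) (A : {group gT}).
Variable f : {morphism A >-> aT * bT}.
Hypotheses (f_inj : 'injm f) (f_onto : f @* A = [set: aT * bT]).

Lemma pull_outer_irr (V : irrep k [set: aT]) (W : irrep k [set: bT]) :
  mx_irreducible (pull_repr f (outer_repr V W)).
Proof.
apply/eqg_mx_irr/morphpre_mx_irr; last exact: outer_irr.
by rewrite f_onto.
Qed.

Lemma mxtrace_regular_repr (hT : finGroupType) (g : hT) :
  \tr (regular_repr k [set: hT] g) = (#|hT| * (g == 1%g))%:R.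
Proof.
have [-> | ntg] := eqVneq g 1%g.
  by rewrite repr_mx1 mxtrace1 muln1 /gcard cardsT.
rewrite muln0 [\tr _]big1 // => i _; rewrite 2!mxE /=.
rewrite -(inj_eq enum_val_inj) gring_indexK ?inE //.
by rewrite eq_mulVg1 mulKg (negbTE ntg).
Qed.

(** The regular character of a product is the product of the regular
    characters, so its composition factors are outer tensor products.  An
    irreducible X has pairing dim X with the regular character; if it were
    orthogonal to all outer tensor products this pairing would vanish. *)
Lemma irr_pull_outer (X : irrep k A) :
  exists p : irrep k [set: aT] * irrep k [set: bT],
    mx_rsim X (pull_repr f (outer_repr p.1 p.2)).
Proof.
apply: contrapT => noX; pose ra := comp_factors (regular_repr k [set: aT]).
pose rb := comp_factors (regular_repr k [set: bT]).
have trA a : \tr (regular_mx k [set: aT] a) = \sum_(V <- ra) \tr (V a).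
  by rewrite -mxtrace_comp_factors ?inE.
have trB b : \tr (regular_mx k [set: bT] b) = \sum_(W <- rb) \tr (W b).
  by rewrite -mxtrace_comp_factors ?inE.
have sum0 : \sum_(g in A) \tr (X g^-1%g) *
    (\tr (regular_repr k [set: aT] (f g).1) * \tr (regular_repr k [set: bT] (f
      g).2)) = 0.
  transitivity (\sum_(V <- ra) \sum_(W <- rb) \sum_(g in A) \tr (X g^-1%g) *
      \tr (pull_repr f (outer_repr V W) g)); last first.
    rewrite big1 // => V _; rewrite big1 // => W _.
    have := irr_orthogonal k_char0 X (Irrep (pull_outer_irr V W)).
    by rewrite asboolF // => sX; apply: noX; exists (V, W).
  rewrite exchange_big /=.
  under [RHS]eq_bigr do rewrite exchange_big /=.
  rewrite [RHS]exchange_big /=; apply: eq_bigr => g Ag.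
  rewrite trA trB big_distrlr /= big_distrr exchange_big /=.
  apply: eq_bigr => V _; rewrite big_distrr; apply: eq_bigr => W _ /=.
  by rewrite mxtrace_prod.
have : \tr (X 1%g) * (#|aT| * #|bT|)%:R != 0.
  have /mx_irrP[n_gt0 _] := irrepP X.
  rewrite repr_mx1 mxtrace1 mulf_neq0 ?natk_neq0 ?muln_gt0 //.
  by rewrite -!cardsT !cardG_gt0.
apply/negP/negPn; rewrite -[X in _ == X]sum0 (bigD1 1%g) //= big1 =>
  [|g /andP[Ag ntg]].
  rewrite invg1 morph1 !mxtrace_regular_repr !eqxx !muln1 addr0 natrM.
  by rewrite eqxx.
rewrite !mxtrace_regular_repr -natrM mulnACA mulnb -xpair_eqE
  -surjective_pairing.
have /negPf-> : f g != (1%g, 1%g) by rewrite (morph_injm_eq1 f_inj Ag).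
by rewrite muln0 mulr0.
Qed.

End OuterTensor.

(** * Additive maps on free abelian groups *)
Section FreeExtension.

Implicit Types B C D E : choiceType.

Lemma freegenE B (x : {freeg B}) :
  x = \sum_(b <- dom x) fgen b *~ coeff b x.
Proof.
rewrite -[LHS]freeg_sumE; apply: eq_bigr => b _.
by rewrite /fgen freegU_mulz intz.
Qed.

Lemma freeg_ext B (M : zmodType) (f g : {additive {freeg B} -> M}) :
  (forall b, f (fgen b) = g (fgen b)) -> f =1 g.
Proof.
move=> fg x; rewrite [x]freegenE !raddf_sum /=; apply: eq_bigr => b _.
by rewrite !raddfMz fg.
Qed.

Lemma flift_fgen B (M : lmodType int) (f : B -> M) b : flift f (fgen b) = f b.
Proof. by rewrite /flift /fgen liftU scale1r. Qed.

Lemma coeff_fgen B (b b' : B) : coeff b (fgen b') = (b' == b)%:R.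
Proof. by rewrite /fgen coeffU mul1r. Qed.

Lemma tensorE B C (x : {freeg B}) (y : {freeg C}) :
  tensor x y
  = \sum_(b <- dom x) flift (fun c => fgen (b, c)) y *~ coeff b x.
Proof.
rewrite {1}[x]freegenE /tensor raddf_sum; apply: eq_bigr => b _ /=.
by rewrite raddfMz /= flift_fgen.
Qed.

Lemma tensor_zmod B C (x : {freeg B}) : zmod_morphism (@tensor B C x).
Proof.
move=> y y'; rewrite !tensorE -sumrB; apply: eq_bigr => b _.
by rewrite raddfB mulrzBl.
Qed.

HB.instance Definition _ B C (x : {freeg B}) :=
  GRing.isZmodMorphism.Build {freeg C} {freeg B * C} (tensor x)
    (tensor_zmod x).

(** [tensor], additive in its first argument. *)
Definition tensorr B C (y : {freeg C}) (x : {freeg B}) := tensor x y.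

HB.instance Definition _ B C (y : {freeg C}) :=
  GRing.isZmodMorphism.Build {freeg B} {freeg B * C} (tensorr y)
    (raddfB (flift (fun b => flift (fun c => fgen (b, c)) y))).

Lemma tensor_fgen B C (b : B) (c : C) : tensor (fgen b) (fgen c) = fgen (b, c).
Proof. by rewrite /tensor !flift_fgen. Qed.

Section TensorMap.
Variables (B B' C C' : choiceType).
Variables (f : {freeg B} -> {freeg B'}) (g : {freeg C} -> {freeg C'}).

HB.instance Definition _ :=
  GRing.isZmodMorphism.Build {freeg B * C} {freeg B' * C'} (tensor_map f g)
    (raddfB (flift (fun p => tensor (f (fgen p.1)) (g (fgen p.2))))).

Lemma tensor_map_fgen p :
  tensor_map f g (fgen p) = tensor (f (fgen p.1)) (g (fgen p.2)).
Proof. exact: flift_fgen. Qed.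

End TensorMap.

HB.instance Definition _ B C D :=
  GRing.isZmodMorphism.Build {freeg B * C * D} {freeg B * (C * D)}
    (@tensor_assoc B C D) (raddfB (flift _)).

HB.instance Definition _ B C :=
  GRing.isZmodMorphism.Build {freeg B * C} {freeg C * B}
    (@tensor_swap B C) (raddfB (flift _)).

HB.instance Definition _ B C D E :=
  GRing.isZmodMorphism.Build {freeg (B * C) * (D * E)} {freeg (B * D) * (C * E)}
    (@tensor_swap_mid B C D E) (raddfB (flift _)).

Lemma tensor_map_tensor B B' C C' (f : {additive {freeg B} -> {freeg B'}})
    (g : {additive {freeg C} -> {freeg C'}}) x y :
  tensor_map f g (tensor x y) = tensor (f x) (g y).
Proof.
rewrite -/(tensorr y x) -/(tensorr (g y) (f x)).
apply: (freeg_ext (f := tensor_map f g \o tensorr y)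
                  (g := tensorr (g y) \o f)) => b /=.
rewrite /tensorr; apply: (freeg_ext (f := tensor_map f g \o tensor (fgen b))
                  (g := tensor (f (fgen b)) \o g)) => c /=.
by rewrite tensor_fgen tensor_map_fgen.
Qed.

Lemma tensor_assoc_tensor B C D (x : {freeg B}) (y : {freeg C}) (z : {freeg D})
  :
  tensor_assoc (tensor (tensor x y) z) = tensor x (tensor y z).
Proof.
apply: (freeg_ext (f := @tensor_assoc B C D \o tensorr z \o tensorr y)
   (g := tensorr (tensor y z))) => b /=; rewrite /tensorr.
apply: (freeg_ext (f := @tensor_assoc B C D \o tensorr z \o tensor (fgen b))
   (g := tensor (fgen b) \o tensorr z)) => c /=; rewrite /tensorr.
apply: (freeg_ext (f := @tensor_assoc B C D \o tensor (tensor (fgen b) (fgen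
  c)))
   (g := tensor (fgen b) \o tensor (fgen c))) => d /=.
by rewrite !tensor_fgen /tensor_assoc flift_fgen.
Qed.

Lemma tensor_assoc_map B B' C C' D D' (f : {additive {freeg B} -> {freeg B'}})
    (g : {additive {freeg C} -> {freeg C'}})
    (h : {additive {freeg D} -> {freeg D'}}) z :
  tensor_assoc (tensor_map (tensor_map f g) h z)
  = tensor_map f (tensor_map g h) (tensor_assoc z).
Proof.
apply: (freeg_ext (f := @tensor_assoc B' C' D' \o tensor_map (tensor_map f g) h)
   (g := tensor_map f (tensor_map g h) \o @tensor_assoc B C D)) =>
     -[[b c] d] /=.
rewrite -!tensor_fgen tensor_assoc_tensor !tensor_map_tensor /=
  !tensor_map_tensor.
by rewrite tensor_assoc_tensor.
Qed.

End FreeExtension.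

Section Evaluation.

Variable k : comNzRingType.
Implicit Types B C : choiceType.

(** The additive extension of c to the free abelian group; characters are
    extended from the basis to R in this way.  [zmodule k] is k seen as a
    Z-module. *)
Definition ev B (c : B -> k) (x : {freeg B}) : k :=
  flift (c : B -> zmodule k) x.

Lemma ev_zmod B (c : B -> k) : zmod_morphism (ev c).
Proof. exact: (raddfB (flift (c : B -> zmodule k))). Qed.

HB.instance Definition _ B (c : B -> k) :=
  GRing.isZmodMorphism.Build {freeg B} k (ev c) (ev_zmod c).

Lemma ev_fgen B (c : B -> k) b : ev c (fgen b) = c b.
Proof. by rewrite /ev (flift_fgen (c : B -> zmodule k)). Qed.

Lemma evE B (c : B -> k) x :
  ev c x = \sum_(b <- dom x) (coeff b x)%:~R * c b.
Proof.
rewrite {1}[x]freegenE raddf_sum; apply: eq_bigr => b _ /=.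
by rewrite raddfMz /= ev_fgen mulrzl.
Qed.

Lemma eq_ev B (c c' : B -> k) : c =1 c' -> ev c =1 ev c'.
Proof. by move=> cc x; apply: freeg_ext => b /=; rewrite !ev_fgen. Qed.

Lemma ev_coeff B (b : B) z : (coeff b z)%:~R = ev (fun b' =>
  (b' == b)%:R : k) z.
Proof.
rewrite evE; case: (boolP (b \in dom z)) => [bz | nbz].
  rewrite (bigD1_seq b) ?uniq_dom //= eqxx mulr1 big1 ?addr0 // => b' /negPf->.
  by rewrite mulr0.
rewrite coeff_outdom // big1_seq // => b' /andP[_ bz].
by case: eqP bz nbz => [->->|]; rewrite // mulr0.
Qed.

Lemma ev_mulr B (c : B -> k) a x : ev c x * a = ev (fun b => c b * a) x.
Proof. by rewrite !evE big_distrl; apply: eq_bigr => b _; rewrite /= mulrA. Qed.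

Lemma ev_mull B (c : B -> k) a x : a * ev c x = ev (fun b => a * c b) x.
Proof. by rewrite mulrC ev_mulr; apply: eq_ev => b; rewrite mulrC. Qed.

Lemma ev_sum B (I : Type) (r : seq I) (c : I -> B -> k) x :
  \sum_(i <- r) ev (c i) x = ev (fun b => \sum_(i <- r) c i b) x.
Proof.
rewrite evE; under eq_bigr do rewrite evE.
by rewrite exchange_big; apply: eq_bigr => b _; rewrite big_distrr.
Qed.

Lemma ev_tensor B C (c : B -> k) (d : C -> k) x y :
  ev (fun p => c p.1 * d p.2) (tensor x y) = ev c x * ev d y.
Proof.
rewrite ev_mulr; apply: (freeg_ext (f := ev _ \o tensorr y)) => b /=.
rewrite ev_fgen ev_mull.
apply: (freeg_ext (f := ev _ \o tensor (fgen b))) => c' /=.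
by rewrite tensor_fgen !ev_fgen.
Qed.

Lemma ev_comp B C (c : C -> k) (f : {additive {freeg B} -> {freeg C}}) x :
  ev c (f x) = ev (fun b => ev c (f (fgen b))) x.
Proof. by apply: (freeg_ext (f := ev c \o f)) => b; rewrite /= ev_fgen. Qed.

Lemma ev_tensor_map B B' C C' (c : B' -> k) (d : C' -> k)
    (f : {freeg B} -> {freeg B'}) (g : {freeg C} -> {freeg C'}) z :
  ev (fun p => c p.1 * d p.2) (tensor_map f g z)
  = ev (fun p => ev c (f (fgen p.1)) * ev d (g (fgen p.2))) z.
Proof.
apply: (freeg_ext (f := ev _ \o tensor_map f g)) => p /=.
by rewrite tensor_map_fgen ev_tensor ev_fgen.
Qed.

End Evaluation.

Section Separation.

Variables (k : fieldType) (k_char0 : [pchar k] =i pred0).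

(** The coordinates of the basis are finite combinations of the functionals
    [c t], as the orthogonality relations give for characters.  The combination
    is indexed by a finite type, not by a list of elements of T, because T will
    be the large type of all pairs of a finite set and a group element. *)
Definition separating (B : eqType) (T : Type) (c : T -> B -> k) : Prop :=
  forall b, exists (I : finType) (w : I -> k) (t : I -> T),
    forall b', \sum_i w i * c (t i) b' = (b' == b)%:R.

Lemma intk_inj (x y : int) : x%:~R = y%:~R :> k -> x = y.
Proof.
move=> /eqP; rewrite -subr_eq0 -mulrzBr => /eqP xy; apply/eqP;
  rewrite -subr_eq0.
suff -> : x - y = 0 by [].
have nat0 n : n%:R = 0 :> k -> n = 0%N.
  by move=> /eqP; have /pcharf0P-> := k_char0; move/eqP.
case: (x - y) xy => n; first by move/nat0->.
by rewrite NegzE mulrNz => /eqP; rewrite oppr_eq0 => /eqP/nat0.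
Qed.

Section Coefficients.

Variables (B : choiceType) (T : Type) (c : T -> B -> k).
Hypothesis c_sep : separating c.

Lemma separating_inj x y : (forall t, ev (c t) x = ev (c t) y) -> x = y.
Proof.
move=> xy; apply/eqP/freeg_eqP => b; apply: intk_inj.
have [I [w [t wt]]] := c_sep b.
have evS z : (coeff b z)%:~R = \sum_i w i * ev (c (t i)) z.
  rewrite ev_coeff -(eq_ev wt) -ev_sum.
  by apply: eq_bigr => i _; rewrite ev_mull.
by rewrite !evS; apply: eq_bigr => i _; rewrite xy.
Qed.

(** An element on which all functionals outside degree n vanish is not
    separated from its part of degree n. *)
Lemma ev_degree (dB : B -> nat) (dT : T -> nat) n x :
    (forall b t, c t b != 0 -> dB b = dT t) ->
    (forall t, dT t <> n -> ev (c t) x = 0) ->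
  forall b, coeff b x != 0 -> dB b = n.
Proof.
move=> cd x0 b; apply: contra_neq_eq => /eqP bn.
pose y : {freeg B} := \sum_(b' <- dom x | dB b' == n) fgen b' *~ coeff b' x.
suff -> : x = y.
  rewrite raddf_sum /= big1 // => b' /eqP bn'; rewrite raddfMz /= coeff_fgen.
  by case: eqP => [e|]; rewrite ?mul0rz //; rewrite e in bn'.
apply: separating_inj => t; have [tn | /eqP tn] := eqVneq (dT t) n.
  rewrite {1}[x]freegenE !raddf_sum [RHS]big_mkcond /=; apply: eq_bigr => b' _.
  rewrite raddfMz /= ev_fgen; case: eqP => [//|bn'].
  have [->|/cd e] := eqVneq (c t b') 0; first by rewrite mul0rz.
  by case: bn'; rewrite e.
rewrite x0 // raddf_sum big1 // => b' /eqP bn'; rewrite raddfMz /= ev_fgen.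
have [->|/cd e] := eqVneq (c t b') 0; first by rewrite mul0rz.
by case: tn; rewrite -e.
Qed.

Lemma ev_degree0 (dB : B -> nat) (dT : T -> nat) n x t :
    (forall b t, c t b != 0 -> dB b = dT t) ->
    (forall b, coeff b x != 0 -> dB b = n) -> dT t <> n ->
  ev (c t) x = 0.
Proof.
move=> cd xn tn; rewrite evE big1_seq // => b /andP[_]; rewrite mem_dom =>
  /xn bn.
have [->|/cd e] := eqVneq (c t b) 0; first by rewrite mulr0.
by case: tn; rewrite -e.
Qed.

End Coefficients.

Lemma separating_prod (B C : choiceType) (T U : Type) (c : T -> B -> k)
    (d : U -> C -> k) :
    separating c -> separating d ->
  @separating (B * C)%type _ (fun (t : T * U) p => c t.1 p.1 * d t.2 p.2).
Proof.
move=> sc sd [b1 b2]; have [I [w [t wt]]] := sc b1; have [J [v [u vu]]] :=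
  sd b2.
exists (I * J)%type, (fun i => w i.1 * v i.2), (fun i => (t i.1, u i.2)) =>
  -[b1' b2'] /=.
rewrite -pair_eqE /= -mulnb natrM -wt -vu big_distrlr pair_bigA /=.
by apply: eq_bigr => i _; rewrite mulrACA.
Qed.

End Separation.

(** * The antipode of a connected graded bialgebra *)
Section Antipode.

Variables (B : choiceType) (gr : B -> nat).
Variable m : {additive {freeg B * B} -> {freeg B}}.
Variable D : {additive {freeg B} -> {freeg B * B}}.
Variable e : {additive int -> {freeg B}}.
Variable eps : {additive {freeg B} -> int}.

Hypothesis bialg : is_bialgebra m D e eps.
Hypothesis graded : is_graded gr m D e eps.
Hypothesis conn : is_connected gr e.

Local Notation V := {freeg B}.

Definition conv (f g : {additive V -> V}) : {additive V -> V} :=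
  m \o tensor_map f g \o D.

Definition conv_one : {additive V -> V} := e \o eps.

(** The projection onto the augmentation ideal; the identity is the sum of it
    and of the unit for the convolution product. *)
Definition conv_reduced : {additive V -> V} := idfun \- conv_one.

Fixpoint conv_pow n : {additive V -> V} :=
  if n is n'.+1 then conv conv_reduced (conv_pow n') else conv_one.

Let alg := bialg_algebra bialg.
Let coalg := bialg_coalgebra bialg.

Lemma eq_conv (f f' g g' : {additive V -> V}) x :
  f =1 f' -> g =1 g' -> conv f g x = conv f' g' x.
Proof.
move=> ff gg /=; congr (m _); apply: freeg_ext => p.
by rewrite /= !tensor_map_fgen ff gg.
Qed.

Lemma mul_assoc_map w :
  m (tensor_map m idfun w) = m (tensor_map idfun m (tensor_assoc w)).
Proof.
apply: (freeg_ext (f := m \o tensor_map m idfun)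
  (g := m \o tensor_map idfun m \o @tensor_assoc B B B)) => -[[b c] d] /=.
rewrite -!tensor_fgen tensor_assoc_tensor !tensor_map_tensor /=.
exact: mul_assoc alg _ _ _.
Qed.

Lemma convA f g h x : conv (conv f g) h x = conv f (conv g h) x.
Proof.
rewrite /conv /=.
have -> z : tensor_map (conv f g) h z
    = tensor_map m idfun (tensor_map (tensor_map f g) h (tensor_map D idfun z)).
  apply: (freeg_ext (f := tensor_map (conv f g) h)
    (g := tensor_map m idfun \o tensor_map (tensor_map f g) h \o tensor_map D
      idfun)) => p /=.
  by rewrite !tensor_map_fgen !tensor_map_tensor.
have -> z : tensor_map f (conv g h) z
    = tensor_map idfun m (tensor_map f (tensor_map g h) (tensor_map idfun D z)).
  apply: (freeg_ext (f := tensor_map f (conv g h))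
    (g := tensor_map idfun m \o tensor_map f (tensor_map g h) \o tensor_map
      idfun D)) => p /=.
  by rewrite !tensor_map_fgen !tensor_map_tensor.
by rewrite mul_assoc_map tensor_assoc_map (comul_coassoc coalg).
Qed.

Lemma scale_mulz (W : lmodType int) (c : int) (x : W) : c *: x = x *~ c.
Proof. by rewrite -scaler_int intz. Qed.

Lemma conv_one_scale x : conv_one x = e 1 *~ eps x.
Proof. by rewrite /conv_one /= -raddfMz intz. Qed.

Lemma conv1l f x : conv conv_one f x = f x.
Proof.
rewrite -[in RHS](comul_counit_l coalg x).
apply: (freeg_ext (f := m \o tensor_map conv_one f)
  (g := f \o flift (fun p => eps (fgen p.1) *: fgen p.2))) => p /=.
rewrite tensor_map_fgen flift_fgen conv_one_scale -/(tensorr _ _).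
rewrite raddfMz raddfMz /= /tensorr mul_unit_l //.
by rewrite scale_mulz raddfMz.
Qed.

Lemma conv1r f x : conv f conv_one x = f x.
Proof.
rewrite -[in RHS](comul_counit_r coalg x).
apply: (freeg_ext (f := m \o tensor_map f conv_one)
  (g := f \o flift (fun p => eps (fgen p.2) *: fgen p.1))) => p /=.
rewrite tensor_map_fgen flift_fgen conv_one_scale.
rewrite raddfMz raddfMz /= mul_unit_r //.
by rewrite scale_mulz raddfMz.
Qed.

(** The powers are defined by multiplication on the left; both sides are
    needed because the antipode is a two-sided inverse. *)
Lemma conv_powSr n x : conv (conv_pow n) conv_reduced x = conv_pow n.+1 x.
Proof.
elim: n x => [|n IHn] x; first by rewrite [LHS]conv1l [RHS]conv1r.
by rewrite [LHS]convA; apply: eq_conv.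
Qed.

Lemma homogeneous_fgen n b : gr b = n -> homogeneous gr n (fgen b).
Proof. by move=> <- b'; rewrite coeff_fgen; have [<-|] := eqVneq b b';
  rewrite ?eqxx. Qed.

Lemma conv_reduced0 b : gr b = 0%N -> conv_reduced (fgen b) = 0.
Proof.
have [_ [_ e_onto]] := conn => b0.
have [c <-] := e_onto _ (homogeneous_fgen b0).
rewrite /conv_reduced /conv_one /=.
suff -> : eps (e c) = c by rewrite subrr.
by rewrite -[c]intz !raddfMz /= (counit_unit bialg).
Qed.

Lemma comul_degree b p : coeff p (D (fgen b)) != 0 -> (gr p.1 + gr p.2)%N = gr
  b.
Proof.
exact: (comul_graded graded (homogeneous_fgen (erefl (gr b)))).
Qed.

Lemma conv_dom f g x :
  conv f g x = \sum_(p <- dom (D x))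
      m (tensor (f (fgen p.1)) (g (fgen p.2))) *~ coeff p (D x).
Proof.
rewrite /conv /= [in LHS](freegenE (D x)) !raddf_sum; apply: eq_bigr => p _.
by rewrite raddfMz /= tensor_map_fgen raddfMz.
Qed.

(** Each of the n factors kills degree 0, so a nonzero term needs degree at
    least n in total. *)
Lemma conv_pow_eq0 n b : (gr b < n)%N -> conv_pow n (fgen b) = 0.
Proof.
elim: n b => // n IHn b bn; rewrite [LHS]conv_dom big1_seq // => p /andP[_].
rewrite mem_dom => /comul_degree db.
have [d1 | d1] := posnP (gr p.1).
  rewrite conv_reduced0 // -/(tensorr _ 0) raddf0 raddf0 mul0rz //.
by rewrite IHn ?raddf0 ?raddf0 ?mul0rz // -ltnS (leq_trans _ bn) //
  ltnS -db -add1n leq_add2r.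
Qed.

(** The geometric series for the convolution inverse of 1 + [conv_reduced];
    by [conv_pow_eq0] it stops at the degree of b. *)
Definition antipode : {additive V -> V} :=
  flift (fun b => \sum_(0 <= i < (gr b).+1) conv_pow i (fgen b) *~ (-1) ^+ i).

Lemma antipode_upto d b : (gr b <= d)%N ->
  antipode (fgen b) = \sum_(0 <= i < d.+1) conv_pow i (fgen b) *~ (-1) ^+ i.
Proof.
move=> bd; rewrite /antipode /= flift_fgen.
rewrite [RHS](big_cat_nat (n := (gr b).+1)) //= [X in _ = _ + X]big_nat_cond.
by rewrite [X in _ = _ + X]big1 ?addr0 // => i /andP[/andP[bi _] _];
  rewrite conv_pow_eq0 ?mul0rz.
Qed.

Lemma conv_idfun_r f x : conv f idfun x = conv f conv_reduced x + f x.
Proof.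
rewrite -[in RHS](conv1r f x) !conv_dom -big_split; apply: eq_bigr => p _ /=.
by rewrite -mulrzDl -!raddfD /= subrK.
Qed.

Lemma conv_idfun_l f x : conv idfun f x = conv conv_reduced f x + f x.
Proof.
rewrite -[in RHS](conv1l f x) !conv_dom -big_split; apply: eq_bigr => p _ /=.
by rewrite -mulrzDl -raddfD -!/(tensorr (f _) _) -raddfD /= subrK.
Qed.

Lemma alternating_telescope (F : nat -> V) d : F d.+1 = 0 ->
  \sum_(0 <= i < d.+1) (F i.+1 + F i) *~ (-1) ^+ i = F 0%N.
Proof.
move=> Fd; pose G i := - (F i *~ (-1) ^+ i).
rewrite (eq_bigr (fun i => G i.+1 - G i)) => [|i _]; last first.
  by rewrite /G exprS mulN1r mulrNz opprK opprK mulrzDl.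
by rewrite telescope_sumr // /G Fd mul0rz oppr0 sub0r opprK.
Qed.

(** On a basis element of degree d the comultiplication only involves degrees
    at most d, where the series may be cut at d; then the sums telescope. *)
Lemma antipode_spec : is_antipode m D e eps antipode.
Proof.
have key b : m (tensor_map antipode idfun (D (fgen b))) = e (eps (fgen b)) /\
    m (tensor_map idfun antipode (D (fgen b))) = e (eps (fgen b)).
  have pow0 : conv_pow (gr b).+1 (fgen b) = 0 by apply: conv_pow_eq0.
  have le_deg p : p \in dom (D (fgen b)) -> (gr p.1 <= gr b)%N /\ (gr p.2 <= gr
    b)%N.
    by rewrite mem_dom => /comul_degree <-; rewrite leq_addr leq_addl.
  split.
    transitivity (\sum_(0 <= i < (gr b).+1) conv (conv_pow i) idfun (fgen b) *~
      (-1) ^+ i).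
      under eq_bigr do rewrite conv_dom.
      rewrite [LHS](conv_dom antipode idfun).
      under [RHS]eq_bigr do rewrite mulrz_suml.
      rewrite exchange_big; apply: eq_big_seq => p /le_deg[p1 _].
      rewrite (antipode_upto p1) -/(tensorr _ _) !raddf_sum mulrz_suml.
      by apply: eq_bigr => i _; rewrite /= !raddfMz /= mulrzAC.
    under eq_bigr do rewrite conv_idfun_r conv_powSr.
    exact: alternating_telescope pow0.
  transitivity (\sum_(0 <= i < (gr b).+1) conv idfun (conv_pow i) (fgen b) *~
    (-1) ^+ i).
    under eq_bigr do rewrite conv_dom.
    rewrite [LHS](conv_dom idfun antipode).
    under [RHS]eq_bigr do rewrite mulrz_suml.
    rewrite exchange_big; apply: eq_big_seq => p /le_deg[_ p2].
    rewrite (antipode_upto p2) !raddf_sum mulrz_suml.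
    by apply: eq_bigr => i _; rewrite /= !raddfMz /= mulrzAC.
  under eq_bigr do rewrite conv_idfun_l.
  exact: alternating_telescope pow0.
move=> x; split.
  by apply: (freeg_ext (f := m \o tensor_map antipode idfun \o D)
    (g := e \o eps)) => b; have [] := key b.
by apply: (freeg_ext (f := m \o tensor_map idfun antipode \o D)
  (g := e \o eps)) => b; have [] := key b.
Qed.

Lemma homogeneous_sum n (I : Type) (r : seq I) (P : pred I) (F : I -> V) :
    (forall i, P i -> homogeneous gr n (F i)) ->
  homogeneous gr n (\sum_(i <- r | P i) F i).
Proof.
move=> hF b; apply: contra_neq_eq => bn; rewrite raddf_sum big1 // => i Pi /=.
by apply: contraNeq bn => /(hF i Pi)->.
Qed.

Lemma homogeneousMz n x c : homogeneous gr n x -> homogeneous gr n (x *~ c).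
Proof.
move=> hx b; rewrite raddfMz /= => nz; apply: hx; move: nz.
by apply: contra => /eqP->; rewrite mul0rz.
Qed.

Lemma homogeneous_ext (f : {additive V -> V}) n :
    (forall b, gr b = n -> homogeneous gr n (f (fgen b))) ->
  forall x, homogeneous gr n x -> homogeneous gr n (f x).
Proof.
move=> hf x hx; rewrite [x]freegenE raddf_sum big_seq.
apply: homogeneous_sum => b; rewrite mem_dom => /hx bn; rewrite raddfMz.
exact/homogeneousMz/hf.
Qed.

Lemma conv_one_homogeneous n x :
  homogeneous gr n x -> homogeneous gr n (conv_one x).
Proof.
move=> hx; have [->|n_gt0] := posnP n; first exact: (unit_graded graded).
rewrite /conv_one /= (counit_graded graded hx n_gt0) raddf0 => b.
by rewrite raddf0 eqxx.
Qed.

Lemma conv_homogeneous (f g : {additive V -> V}) n x :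
    (forall n x, homogeneous gr n x -> homogeneous gr n (f x)) ->
    (forall n x, homogeneous gr n x -> homogeneous gr n (g x)) ->
  homogeneous gr n x -> homogeneous gr n (conv f g x).
Proof.
move=> hf hg; move: x; apply: homogeneous_ext => b <-;
  rewrite [conv f g _]conv_dom big_seq.
apply: homogeneous_sum => p; rewrite mem_dom => /comul_degree <-.
apply/homogeneousMz/(mul_graded graded); [apply: hf | apply: hg].
  exact: homogeneous_fgen.
exact: homogeneous_fgen.
Qed.

Lemma antipode_homogeneous n x :
  homogeneous gr n x -> homogeneous gr n (antipode x).
Proof.
move: x; apply: homogeneous_ext => b bn; rewrite (antipode_upto (leqnn _)).
apply: homogeneous_sum => i _; apply: homogeneousMz.
elim: i (n) (fgen b) (homogeneous_fgen bn) => [|i IHi] d x hx.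
  exact: conv_one_homogeneous.
apply: conv_homogeneous hx => // d' y hy; rewrite /conv_reduced /= => b'.
rewrite raddfB => nz; have [yb|/hy//] := eqVneq (coeff b' y) 0.
apply: (conv_one_homogeneous hy); apply: contraNneq nz.
by rewrite /= yb sub0r => ->; rewrite oppr0.
Qed.

Lemma connected_bialgebra_hopf : is_graded_hopf gr m D e eps.
Proof.
split=> //; exists antipode; split; first exact: antipode_spec.
exact: antipode_homogeneous.
Qed.

End Antipode.

(** * Injections and Young sets *)
Section Injections.

Implicit Types J K L M N : finType.

Lemma inj_imP K N (a : injection K N) y :
  reflect (exists x, y = a x) (y \in inj_im a).
Proof.
by apply: (iffP imsetP) => [[x _ ->] | [x ->]]; exists x.
Qed.

Lemma mem_inj_im K N (a : injection K N) x : a x \in inj_im a.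
Proof. exact: imset_f. Qed.

Lemma card_inj_im K N (a : injection K N) : #|inj_im a| = #|K|.
Proof. by rewrite card_imset //; apply: injP. Qed.

Lemma inj_im_full K N (a : injection K N) :
  #|K| = #|N| -> inj_im a = [set: N].
Proof.
by move=> e; apply/eqP; rewrite eqEcard subsetT cardsT card_inj_im e leqnn.
Qed.

Lemma inj_card K N (a : injection K N) : (#|K| <= #|N|)%N.
Proof. exact: (leq_card a (@injP _ _ a)). Qed.

Lemma bij_card N M (w : bijection N M) : #|N| = #|M|.
Proof. by apply/eqP; rewrite eqn_leq (inj_card (bij_to w)) (inj_card (bij_of
  w)). Qed.

Lemma inj_im_cmp K M N (a : injection M N) (b : injection K M) :
  inj_im (inj_cmp a b) = a @: inj_im b.
Proof.
by rewrite /inj_im -imset_comp; apply: eq_imset => x; rewrite inj_cmpE.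
Qed.

Lemma inj_im_sub N (A : {set N}) : inj_im (inj_sub A) = A.
Proof.
apply/setP => y; apply/inj_imP/idP => [[x ->] | Ay].
  by rewrite mk_injE; apply: valP.
by exists (exist _ y Ay); rewrite mk_injE.
Qed.

Lemma card_sub_fin N (A : {set N}) : #|sub_fin A| = #|A|.
Proof. by rewrite -(card_inj_im (inj_sub A)) inj_im_sub. Qed.

Lemma inj_cmpA J K M N (a : injection M N) (b : injection K M)
    (c : injection J K) :
  inj_cmp (inj_cmp a b) c = inj_cmp a (inj_cmp b c).
Proof. by apply: injection_eqP => x; rewrite !inj_cmpE. Qed.

(** An injection whose image is contained in that of another one factors
    through it; so constructions that depend only on the image of an injection
    can be moved between all injections with this image. *)
Lemma inj_factor K M N (a : injection M N) (b : injection K N) :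
  inj_im b \subset inj_im a -> exists w : injection K M, b = inj_cmp a w.
Proof.
move=> /subsetP ba.
have fP x : exists y, a y == b x.
  by have /ba/inj_imP[y ->] := mem_inj_im b x; exists y.
pose f x := xchoose (fP x).
have fE x : a (f x) = b x by apply/eqP/(xchooseP (fP x)).
have f_inj : injective f by move=> x y fxy; apply: (@injP _ _ b);
  rewrite -!fE fxy.
exists (mk_inj f_inj); apply: injection_eqP => x.
by rewrite inj_cmpE mk_injE fE.
Qed.

Lemma inj_inverse K N (a : injection K N) :
  #|K| = #|N| -> exists b : injection N K, cancel a b /\ cancel b a.
Proof.
move=> e; have [|b bE] := @inj_factor _ _ _ a (inj_idm N).
  by rewrite (inj_im_full a e) subsetT.
have bK : cancel b a by move=> x; rewrite -inj_cmpE -bE inj_idmE.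
by exists b; split=> // x; apply: (@injP _ _ a); rewrite bK.
Qed.

Lemma inj_sum_injective K K' L L' (a : injection K K') (b : injection L L') :
  injective (fun z : K + L =>
    match z with inl x => inl (a x) | inr y => inr (b y) end : K' + L').
Proof. by move=> [x|x] [y|y] // [/injP->]. Qed.

Definition inj_sum K K' L L' (a : injection K K') (b : injection L L') :
  injection (K + L)%type (K' + L')%type := mk_inj (@inj_sum_injective K K' L L'
    a b).

Lemma inj_swap_injective K L :
  injective (fun z : K + L => match z with inl x => inr x | inr y => inl y end).
Proof. by move=> [x|x] [y|y] // [->]. Qed.

Definition inj_swap K L : injection (K + L)%type (L + K)%type :=
  mk_inj (@inj_swap_injective K L).

Lemma inj_assoc_injective K L M :
  injective (fun z : (K + L) + M =>
    match z with
    | inl (inl x) => inl x | inl (inr y) => inr (inl y) | inr z => inr (inr z)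
    end : K + (L + M)).
Proof. by move=> [[x|x]|x] [[y|y]|y] // [->]. Qed.

Definition inj_assoc K L M :
  injection ((K + L) + M)%type (K + (L + M))%type :=
  mk_inj (@inj_assoc_injective K L M).

End Injections.

Section YoungMaps.

Variable Y : young_set.
Implicit Types K L M N : finType.

Lemma ymap_card K N (a : injection K N) : #|K| = #|N| -> #|Y K| = #|Y N|.
Proof.
move=> e; have [b [_ _]] := inj_inverse a e.
by apply/eqP; rewrite eqn_leq (inj_card (ymap Y a)) (inj_card (ymap Y b)).
Qed.

Lemma ymap_im_cmp K M N (a : injection M N) (b : injection K M) :
  #|K| = #|M| -> inj_im (ymap Y (inj_cmp a b)) = inj_im (ymap Y a).
Proof.
move=> e; rewrite ymap_comp inj_im_cmp (inj_im_full (ymap Y b)).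
  by apply/setP => y; apply/imsetP/inj_imP => -[x]; [move=> _ ->|move=> ->];
    exists x.
exact: ymap_card b e.
Qed.

Lemma ymap_im K L N (a : injection K N) (b : injection L N) :
  inj_im a = inj_im b -> inj_im (ymap Y a) = inj_im (ymap Y b).
Proof.
move=> ab; have [|w ->] := @inj_factor _ _ _ b a; first by rewrite ab.
by apply: ymap_im_cmp; rewrite -(card_inj_im a) ab card_inj_im.
Qed.

(** The intersection axiom, freed from the inclusions of subsets in which it
    is stated. *)
Lemma ymap_cap K L M N (a : injection K N) (b : injection L N)
    (c : injection M N) :
    inj_im a :&: inj_im b = inj_im c ->
  inj_im (ymap Y a) :&: inj_im (ymap Y b) = inj_im (ymap Y c).
Proof.
move=> abc; rewrite (ymap_im (b := inj_sub (inj_im a))) ?inj_im_sub //.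
rewrite [in X in _ :&: X](ymap_im (b := inj_sub (inj_im b))) ?inj_im_sub //.
by rewrite yobj_cap; apply: ymap_im; rewrite inj_im_sub.
Qed.

(** The intersection axiom, together with Y of the empty set being
    empty. *)
Lemma ymap_disjoint K L N (a : injection K N) (b : injection L N) :
    inj_im a :&: inj_im b = set0 ->
  forall y z, ymap Y a y <> ymap Y b z.
Proof.
move=> ab y z yz.
have := ymap_cap (c := inj_sub set0) (etrans ab (esym (inj_im_sub _))).
move/setP/(_ (ymap Y a y)); rewrite inE mem_inj_im yz mem_inj_im.
case/esym/inj_imP=> t _; have := yobj_empty Y (N := sub_fin (@set0 N)).
by rewrite card_sub_fin cards0 => /(_ erefl)/card0_eq/(_ t).
Qed.

End YoungMaps.

(** * Restriction of group elements and class functions *)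
Section Pullback.

Variables (Y : young_set) (H : finGroupType).
Implicit Types K L M N : finType.
Local Notation G N := (ygroup Y H N).
Local Notation stab a g := (inj_stab a (yg_perm g)).

(** The element of G_N with permutation s and trivial function. *)
Definition pure_perm N (s : {perm N}) : G N := YGroup s [ffun=> 1%g].

Lemma inj_stab_full K N (a : injection K N) w : #|K| = #|N| -> inj_stab a w.
Proof.
move=> e; rewrite /inj_stab (inj_im_full a e); apply/eqP/setP => y.
by rewrite !inE; apply/imsetP; exists (w^-1%g y); rewrite ?permKV.
Qed.

Lemma inj_stab_im K L N (a : injection K N) (b : injection L N) w :
  inj_im a = inj_im b -> inj_stab a w = inj_stab b w.
Proof. by rewrite /inj_stab => ->. Qed.

Lemma inj_stab_cmp K M N (a : injection M N) (b : injection K M) w :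
  inj_stab a w -> inj_stab (inj_cmp a b) w = inj_stab b (pull_perm a w).
Proof.
move=> sa; rewrite /inj_stab !inj_im_cmp -imset_comp.
rewrite (eq_imset _ (_ : _ =1 a \o pull_perm a w)) => [|x /=].
  by rewrite imset_comp; apply/eqP/eqP => [/(imset_inj (@injP _ _ a))|->].
by rewrite pull_permE.
Qed.

Lemma yg_pull_comp K M N (a : injection M N) (b : injection K M) (g : G N) :
    stab a g -> stab b (yg_pull a g) ->
  yg_pull (inj_cmp a b) g = yg_pull b (yg_pull a g).
Proof.
move=> sa sb; apply: ygroupP => [|y] /=.
  apply/permP => x; apply: (@injP _ _ (inj_cmp a b)).
  by rewrite pull_permE ?inj_stab_cmp // !inj_cmpE pull_permE // pull_permE.
by rewrite !ffunE ymap_compE.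
Qed.

Lemma yg_conjE N M (w : bijection N M) (g : G M) :
  yg_conj w g = yg_pull (bij_to w) g.
Proof.
have eNM := bij_card w.
apply: ygroupP => [|y] //=; apply/permP => x; apply: (@injP _ _ (bij_to w)).
by rewrite permE bij_ofK pull_permE // inj_stab_full.
Qed.

(** Pulling back along a permutation is conjugation by it.  Hence pulling
    back along two bijections between the same sets gives conjugate
    elements. *)
Lemma yg_pull_pure N s (g : G N) : yg_pull (inj_perm s) g = (g ^ pure_perm s)%g.
Proof.
rewrite conjgE; apply: ygroupP => [|y].
  apply/permP => x; apply: (@injP _ _ (inj_perm s)).
  rewrite pull_permE ?inj_stab_full // !yg_permM yg_permV /= !inj_permE !permM.
  by rewrite permKV.
rewrite !yg_funM yg_permM yg_funV /= !ffunE /= invg1 mul1g mulg1.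
by congr (yg_fun g _).
Qed.

Lemma yg_pull1 K N (a : injection K N) : yg_pull a (1%g : G N) = 1%g.
Proof.
apply: ygroupP => [|y] /=; last by rewrite !ffunE.
by apply/permP => x; apply: (@injP _ _ a); rewrite pull_permE ?inj_stab1 //
  !perm1.
Qed.

Lemma yg_pullV K N (a : injection K N) (g : G N) :
  stab a g -> yg_pull a g^-1%g = (yg_pull a g)^-1%g.
Proof.
move=> sa; apply: (mulgI (yg_pull a g)).
by rewrite -yg_pullM ?yg_permV ?inj_stabV // !mulgV yg_pull1.
Qed.

Section ClassFunctions.

Variable k : comNzRingType.

Implicit Types F : forall N, G N -> k.

(** Invariance under transport of structure and under conjugation, the
    properties of a character seen as a function on all the groups G_N. *)
Definition class_invariant F := 
  (forall N M (w : injection N M) g, #|N| = #|M| -> F N (yg_pull w g) = F M g)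
    /\
  (forall N (g t : G N), F N (g ^ t)%g = F N g).

(** The value of F at the restriction of g to the image of a, and 0 if g does
    not preserve this image. *)
Definition restr F K N (a : injection K N) (g : G N) : k :=
  if stab a g then F K (yg_pull a g) else 0.

Lemma restr_im F K L N (a : injection K N) (b : injection L N) g :
  class_invariant F -> inj_im a = inj_im b -> restr F a g = restr F b g.
Proof.
move=> [invF _] ab; rewrite /restr (inj_stab_im _ ab); case: ifP => // sb.
have eKL : #|K| = #|L| by rewrite -(card_inj_im a) ab card_inj_im.
have [|w aE] := @inj_factor _ _ _ b a; first by rewrite ab.
by rewrite aE yg_pull_comp //; [apply: invF | apply: inj_stab_full].
Qed.

Lemma restr_pull F K M N (a : injection M N) (b : injection K M) g :
  stab a g -> restr F b (yg_pull a g) = restr F (inj_cmp a b) g.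
Proof.
move=> sa; rewrite /restr inj_stab_cmp //; case: ifP => // sb.
by rewrite yg_pull_comp.
Qed.

(** Write t as a permutation followed by a function.  The permutation moves
    the image of a; the function conjugates the restriction of g by its own
    restriction, which F does not see. *)
Lemma restr_conj F K N (a : injection K N) (g t : G N) :
  class_invariant F ->
  restr F a (g ^ t)%g = restr F (inj_cmp (inj_perm (yg_perm t)) a) g.
Proof.
move=> [_ invF]; set s := yg_perm t; pose u := ((pure_perm s)^-1 * t)%g.
have pu : yg_perm u = 1%g by rewrite yg_permM yg_permV mulgV.
rewrite -restr_pull ?inj_stab_full // yg_pull_pure.
have -> : (g ^ t = (g ^ pure_perm s) ^ u)%g by rewrite -conjgM /u mulKVg.
move: (g ^ _)%g u pu => h u pu.
have ph : yg_perm (h ^ u)%g = yg_perm h.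
  by rewrite conjgE !yg_permM yg_permV pu invg1 mulg1 mul1g.
rewrite /restr ph; case: ifP => // sh.
have su : stab a u by rewrite pu inj_stab1.
have -> : yg_pull a (h ^ u)%g = (yg_pull a h ^ yg_pull a u)%g.
  rewrite !conjgE -yg_pullV //.
  by rewrite !yg_pullM ?yg_permM ?inj_stabM ?yg_permV ?inj_stabV.
exact: invF.
Qed.

(** The product of class functions that describes the multiplication of R on
    characters. *)
Definition cmul F1 F2 N (g : G N) : k :=
  \sum_(A : {set N}) restr F1 (inj_sub A) g * restr F2 (inj_sub (~: A)) g.

Lemma restr_sub F K N (a : injection K N) (A : {set N}) g :
  class_invariant F -> inj_im a = A -> restr F (inj_sub A) g = restr F a g.
Proof. by move=> invF aA; apply: restr_im; rewrite ?inj_im_sub. Qed.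

Lemma cmul_pull F1 F2 N M (w : injection N M) g :
    class_invariant F1 -> class_invariant F2 -> #|N| = #|M| ->
  cmul F1 F2 (yg_pull w g) = cmul F1 F2 g.
Proof.
move=> inv1 inv2 eNM; have [v [wK vK]] := inj_inverse w eNM.
have vwK : cancel (fun A : {set N} => w @: A) (fun A : {set M} => v @: A).
  move=> A; rewrite -imset_comp (eq_imset _ (_ : _ =1 id)) ?imset_id //.
have wvK : cancel (fun A : {set M} => v @: A) (fun A : {set N} => w @: A).
  move=> A; rewrite -imset_comp (eq_imset _ (_ : _ =1 id)) ?imset_id //.
rewrite /cmul [RHS](reindex (fun A : {set N} => w @: A)) /=; last first.
  by exists (fun A : {set M} => v @: A) => A _.
apply: eq_bigr => A _; rewrite !restr_pull ?inj_stab_full //.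
congr (_ * _); apply: restr_im => //; rewrite inj_im_cmp !inj_im_sub //.
apply/setP => y; rewrite -[y]vK mem_imset ?inE ?mem_imset //; exact: injP.
Qed.

End ClassFunctions.

End Pullback.

Arguments class_invariant {Y H k} F.
Arguments restr {Y H k} F {K N} a g.
Arguments cmul {Y H k} F1 F2 {N} g.

(** * Gluing two group elements *)
Section Glue.

Variables (Y : young_set) (H : finGroupType).
Implicit Types K L M N : finType.
Local Notation G N := (ygroup Y H N).
Local Notation stab a g := (inj_stab a (yg_perm g)).
Local Notation lft K L := (inj_left K L).
Local Notation rgt K L := (inj_right K L).

Lemma yg_pull_permE K N (a : injection K N) (g : G N) i :
  stab a g -> a (yg_perm (yg_pull a g) i) = yg_perm g (a i).
Proof. exact: pull_permE. Qed.

Lemma inj_sumE_l K K' L L' (a : injection K K') (b : injection L L') :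
  inj_cmp (inj_sum a b) (lft K L) = inj_cmp (lft K' L') a.
Proof. by apply: injection_eqP => x; rewrite !inj_cmpE !mk_injE. Qed.

Lemma inj_sumE_r K K' L L' (a : injection K K') (b : injection L L') :
  inj_cmp (inj_sum a b) (rgt K L) = inj_cmp (rgt K' L') b.
Proof. by apply: injection_eqP => x; rewrite !inj_cmpE !mk_injE. Qed.

Lemma left_right_disjoint K L : inj_im (lft K L) :&: inj_im (rgt K L) = set0.
Proof.
apply/setP => z; rewrite !inE; apply/negP => /andP[/inj_imP[x ->] /inj_imP[y]].
by rewrite !mk_injE.
Qed.

Lemma left_right_cover K L : inj_im (lft K L) :|: inj_im (rgt K L) = [set: K +
  L].
Proof.
apply/setP => z; rewrite !inE; apply/orP.
by case: z => z; [left | right]; apply/inj_imP; exists z; rewrite mk_injE.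
Qed.

Lemma yleft_neq_right K L y z : ymap Y (lft K L) y <> ymap Y (rgt K L) z.
Proof. exact: ymap_disjoint (left_right_disjoint K L) y z. Qed.

Variables (K L : finType) (x : G K) (y : G L) (v : {ffun Y (K + L)%type -> H}).

Lemma glue_perm_inj : injective (fun z : K + L =>
  match z with inl i => inl (yg_perm x i) | inr j =>
    inr (yg_perm y j) end : K + L).
Proof. by move=> [i|i] [j|j] // [/perm_inj->]. Qed.

(** The element of G_{K+L} given by x on K and Y_K, by y on L and Y_L, and by
    v on the remaining points of Y_{K+L}.  With v = 1 these are the elements of
    the Levi subgroup, with arbitrary v those of the parabolic subgroup. *)
Definition glue : G (K + L)%type :=
  YGroup (perm glue_perm_inj)
    [ffun z => if [pick i | ymap Y (lft K L) i == z] is Some i then yg_fun x i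
               else if [pick j | ymap Y (rgt K L) j == z] is Some j then yg_fun
                 y j
               else v z].

Lemma glue_fun_l i : yg_fun glue (ymap Y (lft K L) i) = yg_fun x i.
Proof.
rewrite ffunE; case: pickP => [j /eqP/injP-> //|/(_ i)].
by rewrite eqxx.
Qed.

Lemma glue_fun_r j : yg_fun glue (ymap Y (rgt K L) j) = yg_fun y j.
Proof.
rewrite ffunE; case: pickP => [i /eqP/yleft_neq_right //|_].
by case: pickP => [i /eqP/injP-> //|/(_ j)]; rewrite eqxx.
Qed.

Lemma glue_fun_out z : z \notin ysub Y (lft K L) (rgt K L) -> yg_fun glue z = v
  z.
Proof.
rewrite ffunE inE negb_or => /andP[zl zr].
case: pickP => [i /eqP e|_]; first by rewrite -e mem_inj_im in zl.
by case: pickP => [i /eqP e|_] //; rewrite -e mem_inj_im in zr.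
Qed.

Lemma glue_stab_l : stab (lft K L) glue.
Proof.
rewrite /inj_stab eqEcard card_imset ?leqnn ?andbT; last exact: perm_inj.
apply/subsetP => _ /imsetP[_ /inj_imP[i ->] ->].
by rewrite permE mk_injE -[inl _](mk_injE (@inl_injective K L)) mem_inj_im.
Qed.

Lemma glue_stab_r : stab (rgt K L) glue.
Proof.
rewrite /inj_stab eqEcard card_imset ?leqnn ?andbT; last exact: perm_inj.
apply/subsetP => _ /imsetP[_ /inj_imP[i ->] ->].
by rewrite permE mk_injE -[inr _](mk_injE (@inr_injective K L)) mem_inj_im.
Qed.

Lemma glue_stab : KL_stab (lft K L) (rgt K L) (yg_perm glue).
Proof. by rewrite /KL_stab glue_stab_l glue_stab_r. Qed.

Lemma glue_pull_l : yg_pull (lft K L) glue = x.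
Proof.
apply: ygroupP => [|i]; last by rewrite ffunE glue_fun_l.
apply/permP => i; apply: (@injP _ _ (lft K L)).
by rewrite yg_pull_permE ?glue_stab_l // !mk_injE permE.
Qed.

Lemma glue_pull_r : yg_pull (rgt K L) glue = y.
Proof.
apply: ygroupP => [|i]; last by rewrite ffunE glue_fun_r.
apply/permP => i; apply: (@injP _ _ (rgt K L)).
by rewrite yg_pull_permE ?glue_stab_r // !mk_injE permE.
Qed.

Lemma glue_uniq (g : G (K + L)%type) :
    KL_stab (lft K L) (rgt K L) (yg_perm g) ->
    yg_pull (lft K L) g = x -> yg_pull (rgt K L) g = y ->
    (forall z, z \notin ysub Y (lft K L) (rgt K L) -> yg_fun g z = v z) ->
  g = glue.
Proof.
move=> /andP[sl sr] gx gy gv; apply: ygroupP => [|z].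
  apply/permP => -[i|i].
    rewrite -[inl i](mk_injE (@inl_injective K L)) -/(lft K L).
    by rewrite -!yg_pull_permE ?glue_stab_l // gx glue_pull_l.
  rewrite -[inr i](mk_injE (@inr_injective K L)) -/(rgt K L).
  by rewrite -!yg_pull_permE ?glue_stab_r // gy glue_pull_r.
have [|nz] := boolP (z \in ysub Y (lft K L) (rgt K L)); last first.
  by rewrite gv // glue_fun_out.
rewrite inE => /orP[] /inj_imP[i ->].
  by rewrite glue_fun_l -gx ffunE.
by rewrite glue_fun_r -gy ffunE.
Qed.

End Glue.

Section GluePull.

Variables (Y : young_set) (H : finGroupType).
Implicit Types K L M N : finType.
Local Notation G N := (ygroup Y H N).
Local Notation stab a g := (inj_stab a (yg_perm g)).
Local Notation lft K L := (inj_left K L).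
Local Notation rgt K L := (inj_right K L).

Definition pull_vals K N (a : injection K N) (v : {ffun Y N -> H}) :
  {ffun Y K -> H} := [ffun z => v (ymap Y a z)].

Lemma inj_stabP K N (a : injection K N) (w : {perm N}) :
  reflect (forall i, w (a i) \in inj_im a) (inj_stab a w).
Proof.
rewrite /inj_stab eqEcard card_imset ?leqnn ?andbT; last exact: perm_inj.
apply: (iffP subsetP) => [st i | st _ /imsetP[_ /inj_imP[i ->] ->] //].
by apply: st; rewrite imset_f // mem_inj_im.
Qed.

Lemma glue_vals_eq K L (x : G K) (y : G L) (v v' : {ffun Y (K + L)%type -> H}) :
    (forall z, z \notin ysub Y (lft K L) (rgt K L) -> v z = v' z) ->
  glue x y v = glue x y v'.
Proof.
move=> vv; apply: glue_uniq; rewrite ?glue_stab ?glue_pull_l ?glue_pull_r //.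
by move=> z nz; rewrite glue_fun_out ?vv.
Qed.

Lemma inj_stab_sum K L N (c : injection (K + L)%type N) w :
    inj_stab (inj_cmp c (lft K L)) w -> inj_stab (inj_cmp c (rgt K L)) w ->
  inj_stab c w.
Proof.
move=> /inj_stabP sl /inj_stabP sr; apply/inj_stabP => -[i|i].
  have := sl i; rewrite inj_im_cmp inj_cmpE mk_injE => /imsetP[z _ ->].
  exact: mem_inj_im.
have := sr i; rewrite inj_im_cmp inj_cmpE mk_injE => /imsetP[z _ ->].
exact: mem_inj_im.
Qed.

(** An element that preserves two complementary pieces is glued from its
    restrictions to them and its own values. *)
Lemma yg_pull_glue K L N (c : injection (K + L)%type N) (g : G N) :
    stab (inj_cmp c (lft K L)) g -> stab (inj_cmp c (rgt K L)) g ->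
  yg_pull c g = glue (yg_pull (inj_cmp c (lft K L)) g)
                     (yg_pull (inj_cmp c (rgt K L)) g) (pull_vals c (yg_fun g)).
Proof.
move=> sl sr; have sc := inj_stab_sum sl sr.
have sl' : stab (lft K L) (yg_pull c g) by rewrite -inj_stab_cmp.
have sr' : stab (rgt K L) (yg_pull c g) by rewrite -inj_stab_cmp.
apply: glue_uniq => [|||z _]; first by rewrite /KL_stab sl' sr'.
- by rewrite -yg_pull_comp.
- by rewrite -yg_pull_comp.
by rewrite !ffunE.
Qed.

Lemma ymap_notin K M N (c : injection M N) (a : injection K M)
    (b : injection K N) z : inj_cmp c a = b ->
  (ymap Y c z \in inj_im (ymap Y b)) = (z \in inj_im (ymap Y a)).
Proof.
move=> <-; rewrite ymap_comp inj_im_cmp mem_imset //; exact: injP.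
Qed.

Lemma inl_inj_sum K K' L L' (a : injection K' K) (b : injection L' L) i :
  (inl i \in inj_im (inj_sum a b)) = (i \in inj_im a).
Proof.
apply/inj_imP/inj_imP => [[[j|j]] | [j ->]]; rewrite ?mk_injE //.
  by case=> ->; exists j.
by exists (inl j); rewrite mk_injE.
Qed.

Lemma inr_inj_sum K K' L L' (a : injection K' K) (b : injection L' L) i :
  (inr i \in inj_im (inj_sum a b)) = (i \in inj_im b).
Proof.
apply/inj_imP/inj_imP => [[[j|j]] | [j ->]]; rewrite ?mk_injE //.
  by case=> ->; exists j.
by exists (inr j); rewrite mk_injE.
Qed.

Lemma inj_sum_stab K K' L L' (a : injection K' K) (b : injection L' L)
    (x : G K) (y : G L) v :
  stab (inj_sum a b) (glue x y v) = stab a x && stab b y.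
Proof.
apply/inj_stabP/andP => [st | [/inj_stabP sa /inj_stabP sb] [i|i]].
  split; apply/inj_stabP => i.
    by have := st (inl i); rewrite mk_injE permE inl_inj_sum.
  by have := st (inr i); rewrite mk_injE permE inr_inj_sum.
- by rewrite mk_injE permE inl_inj_sum.
by rewrite mk_injE permE inr_inj_sum.
Qed.

(** By the intersection axiom, a point of Y_{K'+L'} sent into Y_K comes from
    Y_{K'}, and likewise for L; so the three cases in the definition of [glue]
    are respected. *)
Lemma glue_pull_sum K K' L L' (a : injection K' K) (b : injection L' L)
    (x : G K) (y : G L) v :
    stab a x -> stab b y ->
  yg_pull (inj_sum a b) (glue x y v)
  = glue (yg_pull a x) (yg_pull b y) (pull_vals (inj_sum a b) v).
Proof.
move=> sa sb; rewrite yg_pull_glue ?inj_sumE_l ?inj_sumE_r; first last.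
- by rewrite inj_stab_cmp ?glue_stab_r // -[pull_perm _ _]/(yg_perm (yg_pull _
  (glue x y v))) glue_pull_r.
- by rewrite inj_stab_cmp ?glue_stab_l // -[pull_perm _ _]/(yg_perm (yg_pull _
  (glue x y v))) glue_pull_l.
rewrite !yg_pull_comp ?glue_stab_l ?glue_stab_r ?glue_pull_l ?glue_pull_r //.
apply: glue_vals_eq => z; rewrite inE negb_or => /andP[zl zr].
rewrite ![in LHS]ffunE [pull_vals _ _ _]ffunE -/(glue _ _ _).
rewrite -[RHS](glue_fun_out x y) ?ffunE // inE negb_or; apply/andP; split.
  apply: contra zl => zl; rewrite -(ymap_notin _ (inj_sumE_l a b)).
  rewrite -(ymap_cap Y (a := inj_sum a b) (b := lft K L)) ?inE ?mem_inj_im //.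
  apply/setP => -[i|i]; rewrite !inE inj_im_cmp.
    rewrite inl_inj_sum -[inl i](mk_injE (@inl_injective K L)) -/(lft K L).
    by rewrite mem_inj_im andbT mem_imset //; apply: injP.
  rewrite -[inr i](mk_injE (@inr_injective K L)) -/(rgt K L).
  apply/andP/imsetP => [[_ /inj_imP[j]]|[j _]]; rewrite !mk_injE //.
apply: contra zr => zr; rewrite -(ymap_notin _ (inj_sumE_r a b)).
rewrite -(ymap_cap Y (a := inj_sum a b) (b := rgt K L)) ?inE ?mem_inj_im //.
apply/setP => -[i|i]; rewrite !inE inj_im_cmp.
  rewrite -[inl i](mk_injE (@inl_injective K L)) -/(lft K L).
  apply/andP/imsetP => [[_ /inj_imP[j]]|[j _]]; rewrite !mk_injE //.
rewrite inr_inj_sum -[inr i](mk_injE (@inr_injective K L)) -/(rgt K L).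
by rewrite mem_inj_im andbT mem_imset //; apply: injP.
Qed.

Lemma inj_swapE_l K L : inj_cmp (inj_swap L K) (lft L K) = rgt K L.
Proof. by apply: injection_eqP => x; rewrite inj_cmpE !mk_injE. Qed.

Lemma inj_swapE_r K L : inj_cmp (inj_swap L K) (rgt L K) = lft K L.
Proof. by apply: injection_eqP => x; rewrite inj_cmpE !mk_injE. Qed.

Lemma glue_swap K L (x : G K) (y : G L) v :
  yg_pull (inj_swap L K) (glue x y v) = glue y x (pull_vals (inj_swap L K) v).
Proof.
rewrite yg_pull_glue ?inj_swapE_l ?inj_swapE_r ?glue_stab_l ?glue_stab_r //.
rewrite glue_pull_l glue_pull_r; apply: glue_vals_eq => z.
rewrite inE negb_or => /andP[zl zr]; rewrite [LHS]ffunE [RHS]ffunE.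
apply: glue_fun_out; rewrite inE negb_or.
by rewrite (ymap_notin _ (inj_swapE_l K L)) (ymap_notin _ (inj_swapE_r K L)) zl
  zr.
Qed.

Section Assoc.

Variables (K L M : finType) (x : G K) (y : G L) (z : G M).

(** The two ways of gluing three elements along a single function v, which
    also supplies the values for the inner gluing. *)
Definition glue3l v := glue (glue x y (pull_vals (lft (K + L)%type M) v)) z v.
Definition glue3r v := glue x (glue y z (pull_vals (rgt K (L + M)%type) v)) v.

Let al := inj_assoc K L M.

Lemma glue3r_out v u :
    u \notin inj_im (ymap Y (lft K (L + M)%type)) ->
    u \notin inj_im (ymap Y (inj_cmp (rgt K (L + M)%type) (lft L M))) ->
    u \notin inj_im (ymap Y (inj_cmp (rgt K (L + M)%type) (rgt L M))) ->
  yg_fun (glue3r v) u = v u.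
Proof.
move=> uK; have [/inj_imP[t ->] tL tM|uR _ _] :=
  boolP (u \in inj_im (ymap Y (rgt K (L + M)%type))); last first.
  by apply: glue_fun_out; rewrite inE negb_or uK.
rewrite glue_fun_r glue_fun_out ?ffunE // inE negb_or.
by rewrite (ymap_notin _ (erefl _)) in tL; rewrite (ymap_notin _ (erefl _)) in
  tM; rewrite tL.
Qed.

(** Both sides are the given elements on Y_K, Y_L and Y_M and have the values
    of v elsewhere. *)
Lemma glue_assoc v : yg_pull al (glue3r v) = glue3l (pull_vals al v).
Proof.
have eK : inj_cmp al (inj_cmp (lft (K + L)%type M) (lft K L)) = lft K (L +
  M)%type.
  by apply: injection_eqP => i; rewrite !inj_cmpE !mk_injE.
have eL : inj_cmp al (inj_cmp (lft (K + L)%type M) (rgt K L))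
    = inj_cmp (rgt K (L + M)%type) (lft L M).
  by apply: injection_eqP => i; rewrite !inj_cmpE !mk_injE.
have eM : inj_cmp al (rgt (K + L)%type M) = inj_cmp (rgt K (L + M)%type) (rgt L
  M).
  by apply: injection_eqP => i; rewrite !inj_cmpE !mk_injE.
have sr := glue_stab_r x (glue y z (pull_vals (rgt K (L + M)%type) v)) v.
have gr := glue_pull_r x (glue y z (pull_vals (rgt K (L + M)%type) v)) v.
have sK : stab (inj_cmp (inj_cmp al (lft _ M)) (lft K L)) (glue3r v).
  by rewrite inj_cmpA eK glue_stab_l.
have sL : stab (inj_cmp (inj_cmp al (lft _ M)) (rgt K L)) (glue3r v).
  rewrite inj_cmpA eL inj_stab_cmp // -[pull_perm _ _]/(yg_perm (yg_pull _
    (glue3r v))).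
  by rewrite gr glue_stab_l.
have sM : stab (inj_cmp al (rgt _ M)) (glue3r v).
  rewrite eM inj_stab_cmp // -[pull_perm _ _]/(yg_perm (yg_pull _ (glue3r v))).
  by rewrite gr glue_stab_r.
rewrite yg_pull_glue //; last exact: inj_stab_sum.
rewrite [yg_pull (inj_cmp al (lft _ M)) _]yg_pull_glue //.
rewrite inj_cmpA eK glue_pull_l inj_cmpA eL eM !yg_pull_comp ?gr ?glue_stab_l
  ?glue_stab_r //.
rewrite glue_pull_l glue_pull_r /glue3l.
have -> : glue x y (pull_vals (inj_cmp al (lft _ M)) (yg_fun (glue3r v)))
   = glue x y (pull_vals (lft _ M) (pull_vals al v)).
  apply: glue_vals_eq => t; rewrite inE negb_or => /andP[tK tL].
  rewrite [LHS]ffunE [RHS]ffunE [RHS]ffunE -ymap_compE; apply: glue3r_out.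
  - by rewrite -eK -inj_cmpA (ymap_notin _ (erefl _)).
  - by rewrite -eL -inj_cmpA (ymap_notin _ (erefl _)).
  apply/inj_imP => -[t' e]; move: e; rewrite -eM !ymap_compE => /injP.
  exact: yleft_neq_right.
apply: glue_vals_eq => t; rewrite inE negb_or => /andP[tK tM].
rewrite [LHS]ffunE [RHS]ffunE; apply: glue3r_out.
- rewrite -eK (ymap_notin _ (erefl _)); apply: contra tK => /inj_imP[s ->].
  by rewrite ymap_compE mem_inj_im.
- rewrite -eL (ymap_notin _ (erefl _)); apply: contra tK => /inj_imP[s ->].
  by rewrite ymap_compE mem_inj_im.
by rewrite -eM (ymap_notin _ (erefl _)).
Qed.

End Assoc.

End GluePull.

(** * Expectations for independent values *)
Section ProductWeight.

Variables (k : comNzRingType) (H : finType) (p : H -> k).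
Hypothesis p_sum1 : \sum_h p h = 1.

(** The expectation of f(v) when the values of v are independent, each
    distributed with weight p. *)
Definition wavg (T : finType) (f : {ffun T -> H} -> k) : k :=
  \sum_(v : {ffun T -> H}) (\prod_t p (v t)) * f v.

Lemma eq_wavg (T : finType) (f f' : {ffun T -> H} -> k) :
  f =1 f' -> wavg f = wavg f'.
Proof. by move=> ff; apply: eq_bigr => v _; rewrite ff. Qed.

(** The values of v outside the image of i are independent of the others
    and have total weight one. *)
Lemma wavg_restrict (T' T : finType) (i : T' -> T) (f : {ffun T' -> H} -> k) :
  injective i -> wavg (fun v => f [ffun t => v (i t)]) = wavg f.
Proof.
move=> i_inj.
rewrite /wavg (partition_big (fun v : {ffun T -> H} => [ffun t =>
  v (i t)]) xpredT) //=.
apply: eq_bigr => w _.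
under eq_bigr => v /eqP-> do rewrite mulrC.
rewrite -big_distrr /= mulrC; congr (_ * _).
(* The functions on T that restrict to w are those with values allowed by Q. *)
pose Q t h := if [pick t' | i t' == t] is Some t' then h == w t' else true.
have Qi t' h : Q (i t') h = (h == w t').
  rewrite /Q; case: pickP => [s /eqP/i_inj-> //|/(_ t')]; by rewrite eqxx.
transitivity (\sum_(v in family Q) \prod_t p (v t)).
  apply: eq_bigl => v; apply/eqP/familyP => [e t|vQ].
    by rewrite unfold_in /Q; case: pickP => [t' /eqP <-|] //; rewrite -e ffunE.
  by apply/ffunP => t'; rewrite ffunE; have := vQ (i t');
    rewrite -[_ \in _]/(Q _ _) Qi => /eqP.
rewrite -(bigA_distr_big_dep Q (fun _ h => p h)) (bigID (mem (i @: T'))) /= [X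
  in _ * X]big1 ?mulr1.
  rewrite big_imset /=; last by move=> ? ? _ _; apply: i_inj.
  apply: eq_bigr => t' _; rewrite (bigD1 (w t')) /= ?Qi // big1 ?addr0 // => h.
  by rewrite Qi => /andP[->].
move=> t nt; rewrite -[RHS]p_sum1; apply: eq_bigl => h; rewrite /Q.
by case: pickP => // t' /eqP e; rewrite -e imset_f in nt.
Qed.

Lemma wavg_sum (T1 T2 : finType) (f : {ffun T1 + T2 -> H} -> k) :
  wavg f = wavg (fun v1 => wavg (fun v2 =>
    f [ffun t => match t with inl t1 => v1 t1 | inr t2 => v2 t2 end])).
Proof.
rewrite /wavg; under [RHS]eq_bigr do rewrite big_distrr /=.
rewrite pair_bigA /=.
pose j (v : {ffun T1 -> H} * {ffun T2 -> H}) : {ffun T1 + T2 -> H} :=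
  [ffun t => match t with inl t1 => v.1 t1 | inr t2 => v.2 t2 end].
rewrite (reindex j) /=; last first.
  exists (fun v => ([ffun t => v (inl t)], [ffun t => v (inr t)])) =>
    [[v1 v2]|v] _.
    by congr (_, _); apply/ffunP => t; rewrite !ffunE.
  by apply/ffunP => -[t|t]; rewrite !ffunE.
apply: eq_bigr => v _; rewrite mulrA big_sumType /=; congr (_ * _ * _).
  by apply: eq_bigr => t _; rewrite ffunE.
by apply: eq_bigr => t _; rewrite ffunE.
Qed.

Lemma wavg_mull (T : finType) c (f : {ffun T -> H} -> k) :
  c * wavg f = wavg (fun v => c * f v).
Proof. by rewrite /wavg big_distrr; apply: eq_bigr => v _ /=; rewrite mulrCA.
  Qed.

Lemma wavg_mulr (T : finType) c (f : {ffun T -> H} -> k) :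
  wavg f * c = wavg (fun v => f v * c).
Proof. by rewrite mulrC wavg_mull; apply: eq_wavg => v; rewrite mulrC. Qed.

Lemma wavg_bigsum (T I : finType) (P : pred I) (f : I -> {ffun T -> H} -> k) :
  wavg (fun v => \sum_(i | P i) f i v) = \sum_(i | P i) wavg (f i).
Proof.
rewrite /wavg exchange_big; apply: eq_bigr => v _.
by rewrite big_distrr.
Qed.

Lemma wavg_const (T : finType) c : wavg (fun _ : {ffun T -> H} => c) = c.
Proof.
rewrite /wavg -big_distrl /= -(bigA_distr_bigA (fun _ => p)) /=.
by rewrite big1 ?mul1r.
Qed.

(** The expectation of a product of functions of disjoint sets of values is
    the product of the expectations. *)
Lemma wavg_indep (T1 T2 T : finType) (i1 : T1 -> T) (i2 : T2 -> T)
    (f1 : {ffun T1 -> H} -> k) (f2 : {ffun T2 -> H} -> k) :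
    injective i1 -> injective i2 -> (forall t1 t2, i1 t1 <> i2 t2) ->
  wavg (fun v => f1 [ffun t => v (i1 t)] * f2 [ffun t => v (i2 t)])
  = wavg f1 * wavg f2.
Proof.
move=> inj1 inj2 dis.
pose i (t : T1 + T2) := match t with inl t1 => i1 t1 | inr t2 => i2 t2 end.
have i_inj : injective i.
  by move=> [t|t] [s|s] /= => [/inj1->|/dis|/esym/dis|/inj2->].
transitivity (wavg (fun w : {ffun T1 + T2 -> H} =>
   f1 [ffun t => w (inl t)] * f2 [ffun t => w (inr t)])).
  rewrite -(wavg_restrict _ i_inj); apply: eq_wavg => v.
  by congr (f1 _ * f2 _); apply/ffunP => t; rewrite !ffunE.
rewrite wavg_sum wavg_mulr; apply: eq_wavg => v1; rewrite wavg_mull.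
by apply: eq_wavg => v2; congr (f1 _ * f2 _); apply/ffunP => t; rewrite !ffunE.
Qed.

(** If f does not see the values of v on the image of i, then drawing these
    again as v' amounts to using the values of v itself. *)
Lemma wavg_merge (T' T : finType) (i : T' -> T)
    (f : {ffun T' -> H} -> {ffun T -> H} -> k) :
    injective i ->
    (forall v' (v u : {ffun T -> H}), (forall t,
      t \notin codom i -> v t = u t) -> f v' v = f v' u) ->
  wavg (fun v => wavg (fun v' => f v' v)) = wavg (fun v => f [ffun t =>
    v (i t)] v).
Proof.
move=> i_inj fE.
(* Points of the image of i read their value from v', the others from v. *)
pose j t : T + T' := if [pick t' | i t' == t] is Some t' then inr t' else inl t.
have ji t' : j (i t') = inr t'.
  by rewrite /j; case: pickP => [s /eqP/i_inj->|/(_ t')] //; rewrite eqxx.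
have jn t : t \notin codom i -> j t = inl t.
  rewrite /j; case: pickP => // s /eqP <-; by rewrite codom_f.
have j_inj : injective j.
  move=> t s; have [/codomP[t' ->]|nt] := boolP (t \in codom i);
    have [/codomP[s' ->]|ns] := boolP (s \in codom i);
    rewrite ?ji ?jn //; by case=> ->.
rewrite -[RHS](wavg_restrict _ j_inj) [RHS]wavg_sum.
apply: eq_wavg => v; apply: eq_wavg => v'.
rewrite (fE v' v [ffun t => [ffun t0 => match t0 with
   | inl t1 => v t1 | inr t2 => v' t2 end] (j t)]).
  congr f; apply/ffunP => t; by rewrite !ffunE ji.
by move=> t /jn jt; rewrite !ffunE jt.
Qed.

End ProductWeight.

(** * Characters of the basis elements *)
Section Characters.

Variables (k : closedFieldType) (k_char0 : [pchar k] =i pred0).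
Variables (Y : young_set) (H : finGroupType).
Implicit Types K L M N : finType.
Local Notation G N := (ygroup Y H N).
Local Notation GT N := [set: ygroup Y H N].
Local Notation stab a g := (inj_stab a (yg_perm g)).
Local Notation basis := (irr_basis k Y H).
Local Notation RY := {freeg basis}.

Lemma card_inj_injective K N (e : #|K| = #|N|) :
  injective (fun x : K => enum_val (cast_ord e (enum_rank x))).
Proof. by move=> x y /enum_val_inj/cast_ord_inj/enum_rank_inj. Qed.

Definition card_inj K N (e : #|K| = #|N|) : injection K N :=
  mk_inj (@card_inj_injective K N e).

(** The character of d, transported to any set N with as many elements as the
    set that carries d.  The bijection is arbitrary by [char_ofE]. *)
Definition char_of (d : any_irrep k Y H) N (g : G N) : k :=
  if #|any_set d| =P #|N| is ReflectT e
  then \tr (any_rep d (yg_pull (card_inj e) g)) else 0.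

Lemma mxtrace_conj (gT : finGroupType) n (V : mx_representation k [set: gT] n) g
  t :
  \tr (V (g ^ t)%g) = \tr (V g).
Proof.
rewrite conjgE !repr_mxM ?inE // mxtrace_mulC repr_mxV ?inE //.
by rewrite mulmxK // repr_mx_unit ?inE.
Qed.

Lemma self_inj_perm K (a : injection K K) : exists s, a = inj_perm s.
Proof.
exists (perm (@injP _ _ a)); apply: injection_eqP => x.
by rewrite inj_permE permE.
Qed.

(** Two bijections differ by a permutation, which acts by conjugation. *)
Lemma char_ofE d N (w : injection (any_set d) N) (g : G N) :
  #|any_set d| = #|N| -> char_of d g = \tr (any_rep d (yg_pull w g)).
Proof.
move=> e; rewrite /char_of; case: eqP => // e'.
have [|s ->] := @inj_factor _ _ _ w (card_inj e').
  by rewrite (inj_im_full w) ?subsetT.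
have [t ->] := self_inj_perm s.
by rewrite yg_pull_comp ?inj_stab_full // yg_pull_pure mxtrace_conj.
Qed.

Lemma char_of_card d N (g : G N) : #|any_set d| <> #|N| -> char_of d g = 0.
Proof. by rewrite /char_of; case: eqP. Qed.

Lemma char_of_neq0 d N (g : G N) : char_of d g != 0 -> #|any_set d| = #|N|.
Proof. by move=> nz; apply/eqP; apply: contraNT nz => /eqP/char_of_card->. Qed.

Lemma yg_pull_conj K N (a : injection K N) (g t : G N) : #|K| = #|N| ->
  yg_pull a (g ^ t)%g = (yg_pull a g ^ yg_pull a t)%g.
Proof.
move=> e; have sa (h : G N) : stab a h by apply: inj_stab_full.
apply: (mulgI (yg_pull a t)); rewrite -conjgC -!yg_pullM //.
by rewrite -conjgC.
Qed.

Lemma char_of_invariant d : class_invariant (char_of d).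
Proof.
split=> [N M w g eNM | N g t].
  have [dN|dN] := #|any_set d| =P #|N|; last first.
    by rewrite !char_of_card // -eNM.
  rewrite (char_ofE (card_inj dN)) // (char_ofE (inj_cmp w (card_inj dN))).
    by rewrite yg_pull_comp ?inj_stab_full // -eNM.
  by rewrite dN.
have [dN|dN] := #|any_set d| =P #|N|; last by rewrite !char_of_card.
by rewrite !(char_ofE (card_inj dN)) // yg_pull_conj // mxtrace_conj.
Qed.

Lemma yg_pull_id N (g : G N) : yg_pull (inj_idm N) g = g.
Proof.
apply: ygroupP => [|y] /=; last by rewrite ffunE ymap_idE.
apply/permP => x; rewrite -[LHS]inj_idmE pull_permE ?inj_stab_full //.
by rewrite inj_idmE.
Qed.

Lemma char_of_self d (g : G (any_set d)) : char_of d g = \tr (any_rep d g).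
Proof. by rewrite (char_ofE (inj_idm _)) // yg_pull_id. Qed.

Lemma char_of_equiv d e N (g : G N) : irr_equiv d e -> char_of d g = char_of e
  g.
Proof.
case=> w sde; have cde := bij_card w.
have [eN|eN] := #|any_set e| =P #|N|; last by rewrite !char_of_card // cde.
rewrite (char_ofE (card_inj eN)) // -(mxtrace_rsim sde) ?inE //=.
rewrite (char_ofE (inj_cmp (card_inj eN) (bij_to w))) ?cde //.
by rewrite yg_conjE yg_pull_comp ?inj_stab_full.
Qed.

Lemma char_of_class d N (g : G N) : char_of (irr_repr (irr_class d)) g = char_of
  d g.
Proof. by apply/char_of_equiv/irr_classP; rewrite irr_reprK. Qed.

Record point := Point { point_set : finType; point_elt : G point_set }.

Definition chi (t : point) (b : basis) : k :=
  char_of (irr_repr b) (point_elt t).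

Definition ch N (g : G N) (x : RY) : k := ev (chi (Point g)) x.

Lemma ch_invariant x : class_invariant (fun N (g : G N) => ch g x).
Proof.
split=> [N M w g eNM | N g t]; apply: eq_ev => b.
  by case: (char_of_invariant (irr_repr b)) => + _; apply.
by case: (char_of_invariant (irr_repr b)) => _; apply.
Qed.

Lemma ch_Rclass N n (V : mx_representation k (GT N) n) M (w : injection N M) (g
  : G M) :
  #|N| = #|M| -> ch g (Rclass V) = \tr (V (yg_pull w g)).
Proof.
move=> eNM; rewrite /ch /Rclass raddf_sum mxtrace_comp_factors ?inE //.
apply: eq_bigr => W _ /=; rewrite ev_fgen /chi char_of_class.
exact: (char_ofE (d := AnyIrrep W)).
Qed.

Lemma ch_Rclass_card N n (V : mx_representation k (GT N) n) M (g : G M) :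
  #|N| <> #|M| -> ch g (Rclass V) = 0.
Proof.
move=> nNM; rewrite /ch /Rclass raddf_sum big1 // => W _ /=.
by rewrite ev_fgen /chi char_of_class char_of_card.
Qed.

(** Basis elements are classes for similarity up to transport, so two
    different ones stay dissimilar after transport to the same set. *)
Lemma char_orthogonal (b b' : basis) :
  \sum_(g : G (any_set (irr_repr b)))
     \tr (any_rep (irr_repr b) g^-1%g) * char_of (irr_repr b') g
  = (b' == b)%:R * #|GT (any_set (irr_repr b))|%:R.
Proof.
have sumT N (F : G N -> k) : \sum_g F g = \sum_(g in GT N) F g.
  by apply: eq_bigl => g; rewrite inE.
have [<-|bb'] := eqVneq b' b.
  under eq_bigr do rewrite char_of_self.
  rewrite sumT irr_orthogonal // asboolT ?mul1r //; exact: mx_rsim_refl.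
rewrite mul0r; have [e|e] := #|any_set (irr_repr b')| =P #|any_set (irr_repr
  b)|; last first.
  by rewrite big1 // => g _; rewrite char_of_card ?mulr0.
have [v [wK vK]] := inj_inverse (card_inj e) e.
pose w := Bijection wK vK.
have irrW : mx_irreducible (Ad w (any_rep (irr_repr b'))).
  apply/eqg_mx_irr/morphpre_mx_irr; last exact: irrepP.
  exact: yg_conj_onto.
transitivity (\sum_(g in GT (any_set (irr_repr b)))
    \tr (any_rep (irr_repr b) g^-1%g) * \tr (Irrep irrW g)).
  rewrite sumT; apply: eq_bigr => g _; congr (_ * _).
  by rewrite (char_ofE (card_inj e)) //= yg_conjE.
rewrite irr_orthogonal // asboolF // => sbb'.
move/eqP: bb'; apply; rewrite -[b]irr_reprK -[b']irr_reprK; apply/irr_classP.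
by exists w; apply: mx_rsim_sym.
Qed.

(** Pairing with the character of b extracts the coordinate at b. *)
Lemma chi_separating : separating chi.
Proof.
move=> b; set N := any_set (irr_repr b).
exists (ygroup Y H N), (fun g => \tr (any_rep (irr_repr b) g^-1%g) / #|GT
  N|%:R).
exists (@Point N) => b' /=.
under eq_bigr do rewrite mulrAC.
rewrite -big_distrl /= char_orthogonal mulfK //.
by rewrite natk_neq0 // cardG_gt0.
Qed.

Lemma chi_degree b t : chi t b != 0 -> Rdeg b = #|point_set t|.
Proof. exact: char_of_neq0. Qed.

End Characters.

(** * The character of a product *)
Section Products.

Variables (k : closedFieldType) (k_char0 : [pchar k] =i pred0).
Variables (Y : young_set) (H : finGroupType).
Implicit Types K L M N : finType.
Local Notation G N := (ygroup Y H N).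
Local Notation GT N := [set: ygroup Y H N].
Local Notation lft K L := (inj_left K L).
Local Notation rgt K L := (inj_right K L).
Local Notation basis := (irr_basis k Y H).
Local Notation RY := {freeg basis}.

Lemma mxtrace_ind (gT : finGroupType) (P : {group gT}) n
    (V : mx_representation k P n) g :
  \tr (ind_repr V g)
  = \sum_i \tr (zero_ext V (coset_rep i * g * (coset_rep (P := P) i)^-1)%g).
Proof. by rewrite /= mxtrace_mxblock. Qed.

Section Induced.

Variables (K L : finType).
Local Notation P := (parabolic Y H (lft K L) (rgt K L)).
Local Notation t := (coset_rep (P := P)).

(** The set of points that a coset representative of the parabolic subgroup
    sends into K; this identifies the cosets with the subsets of K+L having as
    many elements as K. *)
Definition coset_subset i : {set (K + L)%type} :=
  inj_im (inj_cmp (inj_perm (yg_perm (t i)^-1%g)) (lft K L)).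

Lemma perm_subset_compl N (A : {set N}) (s : {perm N}) : s @: (~: A) = ~: (s @:
  A).
Proof.
apply/setP => y; rewrite inE -[y](permKV s) !mem_imset ?inE //; exact: perm_inj.
Qed.

Lemma im_rgt : inj_im (rgt K L) = ~: inj_im (lft K L).
Proof.
apply/setP => z; rewrite inE; have := left_right_disjoint K L.
move/setP/(_ z); have /setP/(_ z) := left_right_cover K L; rewrite !inE.
by case: (z \in _) => //= ->.
Qed.

Lemma inj_im_perm N M (a : injection M N) (s : {perm N}) :
  inj_im (inj_cmp (inj_perm s) a) = s @: inj_im a.
Proof. by rewrite inj_im_cmp; apply: eq_imset => x; rewrite inj_permE. Qed.

Lemma coset_subset_compl i :
  inj_im (inj_cmp (inj_perm (yg_perm (t i)^-1%g)) (rgt K L)) = ~: coset_subset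
    i.
Proof. by rewrite /coset_subset !inj_im_perm im_rgt perm_subset_compl. Qed.

Lemma mem_parabolic g :
  (g \in P) = (yg_perm g @: inj_im (lft K L) == inj_im (lft K L)).
Proof.
rewrite inE /KL_stab /inj_stab im_rgt perm_subset_compl.
by rewrite (inj_eq (@setC_inj _)) andbb.
Qed.

Lemma imset_permM N (s u : {perm N}) (A : {set N}) :
  (s * u)%g @: A = u @: (s @: A).
Proof. by rewrite (eq_imset _ (permM s u)) imset_comp. Qed.

Lemma imset_perm1 N (A : {set N}) : (1%g : {perm N}) @: A = A.
Proof. by rewrite (eq_imset _ (@perm1 N)) imset_id. Qed.

Lemma coset_subset_mem g i :
    (yg_perm g)^-1%g @: inj_im (lft K L) = coset_subset i ->
  (g * (t i)^-1)%g \in P.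
Proof.
rewrite mem_parabolic yg_permM /coset_subset inj_im_perm imset_permM => <-.
by rewrite -imset_permM mulVg imset_perm1.
Qed.

Lemma coset_subset_inj : injective coset_subset.
Proof.
move=> i j; rewrite {1}/coset_subset inj_im_perm yg_permV => /coset_subset_mem.
have [l Pl] := coset_repP P (t i); rewrite Pl => /eqP->.
by have := Pl i; rewrite mulgV group1 => /esym/eqP.
Qed.

(** Glue a bijection of A with B and one of their complements. *)
Lemma perm_mapping_set N (A B : {set N}) :
  #|A| = #|B| -> exists s : {perm N}, s @: A = B.
Proof.
move=> eAB.
have eA : #|sub_fin A| = #|sub_fin B| by rewrite !card_sub_fin.
have eC : #|sub_fin (~: A)| = #|sub_fin (~: B)|.
  by rewrite !card_sub_fin; have := cardsC A; rewrite -(cardsC B) eAB => /addnI.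
pose f (x : N) : N := match insub x : option (sub_fin A) with
  | Some u => val (card_inj eA u)
  | None => match insub x : option (sub_fin (~: A)) with
            | Some u => val (card_inj eC u) | None => x end end.
have fA x (Ax : x \in A) : f x = val (card_inj eA (exist _ x Ax)).
  by rewrite /f insubT.
have fC x (Ax : x \in ~: A) : f x = val (card_inj eC (exist _ x Ax)).
  by rewrite /f insubF ?insubT //; apply: negbTE; rewrite inE in Ax.
have fB x : (f x \in B) = (x \in A).
  have [Ax|Ax] := boolP (x \in A); first by rewrite fA; apply: valP.
  rewrite -in_setC in Ax; rewrite fC; apply: negbTE; rewrite -in_setC;
    exact: valP.
have f_inj : injective f.
  move=> x y fxy; have [Ax|Ax] := boolP (x \in A).
    have Ay : y \in A by rewrite -fB -fxy fB.
    by move: fxy; rewrite !fA => /val_inj/injP[].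
  have Ay : y \in ~: A by rewrite inE -fB -fxy fB.
  by rewrite -in_setC in Ax; move: fxy; rewrite !fC => /val_inj/injP[].
exists (perm f_inj); apply/eqP; rewrite eqEcard card_imset;
  last exact: perm_inj.
rewrite eAB leqnn andbT; apply/subsetP => _ /imsetP[x Ax ->].
by rewrite permE fB.
Qed.

Lemma coset_subset_onto (A : {set (K + L)%type}) :
  #|A| = #|K| -> exists i, A = coset_subset i.
Proof.
move=> cA; have [|s sA] := @perm_mapping_set _ A (inj_im (lft K L)).
  by rewrite card_inj_im.
have [i Pi] := coset_repP P (pure_perm Y H s); exists i.
have := Pi i; rewrite eqxx mem_parabolic yg_permM imset_permM => /eqP e.
rewrite /coset_subset inj_im_perm; apply: (imset_inj (@perm_inj _ s)).
by rewrite sA -[in LHS]e.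
Qed.

(** The term of the induced character at a coset is the term of [cmul] at
    the corresponding subset, by [restr_conj]; subsets of another cardinality
    contribute 0 because characters vanish on them. *)
Lemma char_induced (V : irrep k (GT K)) (W : irrep k (GT L)) (g : G (K +
  L)%type) :
  \tr (i_repr (lft K L) (rgt K L) V W g)
  = cmul (char_of (AnyIrrep V)) (char_of (AnyIrrep W)) g.
Proof.
have inv d := @char_of_invariant k Y H d.
rewrite /i_repr mxtrace_ind /cmul.
pose T A := restr (char_of (AnyIrrep V)) (inj_sub A) g *
            restr (char_of (AnyIrrep W)) (inj_sub (~: A)) g.
transitivity (\sum_i T (coset_subset i)).
  apply: eq_bigr => i _; rewrite /T.
  rewrite (restr_sub g (inv _) (erefl (coset_subset i))).
  rewrite (restr_sub g (inv _) (coset_subset_compl i)).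
  rewrite -!restr_conj // conjgE invgK.
  rewrite /zero_ext inE /KL_stab /restr mulgA; case: ifP => [/andP[-> ->]|].
    by rewrite [LHS](mxtrace_outer V W) !char_of_self.
  by rewrite mxtrace0; do 2!case: ifP => _; rewrite ?mul0r ?mulr0.
rewrite -(big_imset T) /=; last by move=> ? ? _ _; apply: coset_subset_inj.
rewrite [RHS](bigID (mem (coset_subset @: [set: 'I_#|rcosets P [set: G (K +
  L)%type]|]))) /=.
rewrite [X in _ = _ + X]big1 ?addr0 => [|A nA].
  by apply: eq_bigl => A; apply/imsetP/imsetP => -[i _ ->]; exists i;
    rewrite ?inE.
rewrite /restr; case: ifP => _; last by rewrite mul0r.
rewrite char_of_card ?mul0r //= card_sub_fin => cA.
by have [i Ai] := coset_subset_onto (esym cA); rewrite Ai imset_f ?inE in nA.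
Qed.

End Induced.

Lemma cmul_card (d e : any_irrep k Y H) N (g : G N) :
    #|N| <> (#|any_set d| + #|any_set e|)%N ->
  cmul (char_of d) (char_of e) g = 0.
Proof.
move=> cN; rewrite /cmul big1 // => A _; rewrite /restr.
case: ifP => _; last by rewrite mul0r.
have [dA|dA] := #|any_set d| =P #|A|; last first.
  by rewrite char_of_card ?mul0r ?card_sub_fin.
case: ifP => _; last by rewrite mulr0.
rewrite [X in _ * X]char_of_card ?mulr0 // card_sub_fin => eA.
by case: cN; rewrite dA eA cardsC.
Qed.

Lemma ch_mul_irr (p : basis * basis) N (g : G N) :
  ch g (mul_irr p) = cmul (char_of (irr_repr p.1)) (char_of (irr_repr p.2)) g.
Proof.
have [eN|eN] := (#|any_set (irr_repr p.1)| + #|any_set (irr_repr p.2)|)%N =P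
  #|N|; last first.
  rewrite cmul_card; last by move=> e; case: eN.
  by rewrite ch_Rclass_card // card_sum.
rewrite -card_sum in eN; rewrite /mul_irr (ch_Rclass _ (card_inj eN)) //
  char_induced.
by rewrite (cmul_pull (card_inj eN)) //; apply: char_of_invariant.
Qed.

Lemma ch_Rmul N (g : G N) t :
  ch g (Rmul k Y H t)
  = ev (fun p => cmul (char_of (irr_repr p.1)) (char_of (irr_repr p.2)) g) t.
Proof.
rewrite /ch ev_comp; apply: eq_ev => p.
by rewrite /= flift_fgen; apply: ch_mul_irr.
Qed.

Lemma ch_mul N (g : G N) x y :
  ch g (Rmul k Y H (tensor x y))
  = cmul (fun M (h : G M) => ch h x) (fun M (h : G M) => ch h y) g.
Proof.
have evr M (a : injection M N) (z : RY) :
    restr (fun M (h : G M) => ch h z) a g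
    = ev (fun b => restr (char_of (irr_repr b)) a g) z.
  rewrite /restr; case: ifP => // _; rewrite evE big1 // => b _.
  by rewrite mulr0.
rewrite ch_Rmul /cmul -ev_sum; apply: eq_bigr => A _.
rewrite !evr; exact: (ev_tensor (fun b => restr (char_of (irr_repr b)) (inj_sub
  A) g)
  (fun b => restr (char_of (irr_repr b)) (inj_sub (~: A)) g)).
Qed.

End Products.

(** * The characters of the two comultiplications *)
Section LeviCharacters.

Variables (k : closedFieldType) (k_char0 : [pchar k] =i pred0).
Variables (Y : young_set) (H : finGroupType).
Implicit Types K L M N : finType.
Local Notation G N := (ygroup Y H N).
Local Notation GT N := [set: ygroup Y H N].
Local Notation stab a g := (inj_stab a (yg_perm g)).
Local Notation lft K L := (inj_left K L).
Local Notation rgt K L := (inj_right K L).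
Local Notation basis := (irr_basis k Y H).
Local Notation point := (point Y H).

Section Levi.

Variables (K L N : finType) (a : injection K N) (b : injection L N).
Hypothesis ab : inj_im b = ~: inj_im a.

Lemma complement_card : #|N| = (#|K| + #|L|)%N.
Proof. by rewrite -(card_inj_im a) -(card_inj_im b) ab cardsC. Qed.

Lemma inj_join_injective :
  injective (fun z : K + L => match z with inl i => a i | inr j => b j end).
Proof.
have nab i j : a i = b j -> False.
  by move=> e; have := mem_inj_im b j; rewrite ab -e inE mem_inj_im.
move=> [i|i] [j|j] /=; [by move/injP-> | by move/nab | | by move/injP->].
by move/esym/nab.
Qed.

(** For N decomposed by a and b, maps from K to K' and from L to L' combine
    to a map from N to K'+L'. *)
Lemma inj_split K' L' (w1 : injection K K') (w2 : injection L L') :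
  exists c : injection N (K' + L')%type,
    inj_cmp c a = inj_cmp (lft K' L') w1 /\ inj_cmp c b = inj_cmp (rgt K' L')
      w2.
Proof.
have [|c [jc cj]] := inj_inverse (mk_inj inj_join_injective).
  by rewrite card_sum complement_card.
exists (inj_cmp (inj_sum w1 w2) c); split; rewrite inj_cmpA.
  have -> : inj_cmp c a = lft K L; last by rewrite inj_sumE_l.
  by apply: injection_eqP => i; rewrite inj_cmpE mk_injE -[inl i]jc mk_injE.
have -> : inj_cmp c b = rgt K L; last by rewrite inj_sumE_r.
by apply: injection_eqP => i; rewrite inj_cmpE mk_injE -[inr i]jc mk_injE.
Qed.

Section GluePoint.

Variables (K' L' : finType) (w1 : injection K K') (w2 : injection L L').
Hypotheses (eK : #|K| = #|K'|) (eL : #|L| = #|L'|).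
Variable c : injection N (K' + L')%type.
Hypotheses (ca : inj_cmp c a = inj_cmp (lft K' L') w1)
           (cb : inj_cmp c b = inj_cmp (rgt K' L') w2).
Variables (x : G K') (y : G L').

Lemma split_card : #|N| = #|{: K' + L'}|.
Proof. by rewrite card_sum -eK -eL complement_card. Qed.

Lemma glue_pull_stab v : KL_stab a b (yg_perm (yg_pull c (glue x y v))).
Proof.
have sc : stab c (glue x y v) by apply: inj_stab_full; apply: split_card.
rewrite /KL_stab -!inj_stab_cmp // ca cb.
rewrite !inj_stab_cmp ?glue_stab_l ?glue_stab_r //.
by rewrite !inj_stab_full.
Qed.

Lemma glue_pull_a v : yg_pull a (yg_pull c (glue x y v)) = yg_pull w1 x.
Proof.
have /andP[sa sb] := glue_pull_stab v.
have sc : stab c (glue x y v) by apply: inj_stab_full; apply: split_card.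
rewrite -yg_pull_comp // ca yg_pull_comp ?glue_stab_l ?glue_pull_l //.
exact: inj_stab_full.
Qed.

Lemma glue_pull_b v : yg_pull b (yg_pull c (glue x y v)) = yg_pull w2 y.
Proof.
have /andP[sa sb] := glue_pull_stab v.
have sc : stab c (glue x y v) by apply: inj_stab_full; apply: split_card.
rewrite -yg_pull_comp // cb yg_pull_comp ?glue_stab_r ?glue_pull_r //.
exact: inj_stab_full.
Qed.

Lemma glue_pull_out v z : z \notin ysub Y a b ->
  yg_fun (yg_pull c (glue x y v)) z = v (ymap Y c z).
Proof.
rewrite inE negb_or => /andP[za zb]; rewrite ffunE.
apply: glue_fun_out; rewrite inE negb_or.
rewrite -(ymap_im_cmp Y (lft K' L') w1 eK) -(ymap_im_cmp Y (rgt K' L') w2 eL)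
  -ca -cb.
by rewrite !(ymap_notin _ (erefl _)) za zb.
Qed.

End GluePoint.

(** An element that preserves both pieces is determined by its restrictions
    to them and by its values outside Y_K and Y_L. *)
Lemma stab_ext (g h : G N) :
    KL_stab a b (yg_perm g) -> KL_stab a b (yg_perm h) ->
    yg_pull a g = yg_pull a h -> yg_pull b g = yg_pull b h ->
    (forall z, z \notin ysub Y a b -> yg_fun g z = yg_fun h z) ->
  g = h.
Proof.
move=> /andP[ga gb] /andP[ha hb] ea eb eo; apply: ygroupP => [|z].
  apply/permP => i; have [/inj_imP[j ->]|] := boolP (i \in inj_im a).
    by rewrite -!yg_pull_permE // ea.
  rewrite -in_setC -ab => /inj_imP[j ->].
  by rewrite -!yg_pull_permE // eb.
have [|/eo //] := boolP (z \in ysub Y a b).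
rewrite inE => /orP[] /inj_imP[j ->].
  by have /(congr1 (fun g => yg_fun g j)) := ea; rewrite !ffunE.
by have /(congr1 (fun g => yg_fun g j)) := eb; rewrite !ffunE.
Qed.

Lemma levi_out (l : G N) z :
  l \in levi Y H a b -> z \notin ysub Y a b -> yg_fun l z = 1%g.
Proof. by rewrite inE => /andP[_ /forallP/(_ z)/implyP h] /h/eqP. Qed.

Lemma glue1_levi K' L' (w1 : injection K K') (w2 : injection L L')
    (c : injection N (K' + L')%type) x y :
    #|K| = #|K'| -> #|L| = #|L'| ->
    inj_cmp c a = inj_cmp (lft K' L') w1 -> inj_cmp c b = inj_cmp (rgt K' L') w2
      ->
  yg_pull c (glue x y [ffun=> 1%g]) \in levi Y H a b.
Proof.
move=> eK eL ca cb; rewrite inE (glue_pull_stab eK eL ca cb) /=.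
apply/forallP => z; apply/implyP => nz.
by rewrite (glue_pull_out eK eL ca cb) // ffunE.
Qed.

Lemma levi_iso_inj : 'injm (levi_iso Y H a b).
Proof.
apply/injmP => g h lg lh [ea1 ea2 eb1 eb2].
have [sg sh] := (subsetP (levi_parabolic Y H a b) _ lg,
  subsetP (levi_parabolic Y H a b) _ lh).
rewrite !inE in sg sh; apply: stab_ext => //.
- by apply: ygroupP => //= z; rewrite -[LHS]/(yg_fun (yg_pull a g) z) /= ea2.
- by apply: ygroupP => //= z; rewrite -[LHS]/(yg_fun (yg_pull b g) z) /= eb2.
by move=> z nz; rewrite !levi_out.
Qed.

Lemma levi_iso_onto : levi_iso Y H a b @* levi Y H a b = [set: G K * G L].
Proof.
apply/eqP; rewrite eqEsubset subsetT; apply/subsetP => -[x y] _.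
have [c [ca cb]] := inj_split (inj_idm K) (inj_idm L).
apply/morphimP; exists (yg_pull c (glue x y [ffun=> 1%g])).
- exact: glue1_levi ca cb.
- exact: glue1_levi ca cb.
rewrite /= /parabolic_proj (glue_pull_a _ _ ca cb) //
  (glue_pull_b _ _ ca cb) //.
by rewrite !yg_pull_id.
Qed.

Definition chi2 (t : point * point) (p : basis * basis) : k :=
  chi t.1 p.1 * chi t.2 p.2.

(** The Levi subgroup is a product of two groups, so its irreducible
    representations are outer tensor products and the default value in
    [levi_irr_class] does not occur. *)
Lemma levi_irr_class_rsim (X : irrep k (levi Y H a b)) :
  exists p : irrep k (GT K) * irrep k (GT L),
    mx_rsim X (levi_tensor a b p.1 p.2) /\
    levi_irr_class X = fgen (irr_class (AnyIrrep p.1),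
      irr_class (AnyIrrep p.2)).
Proof.
rewrite /levi_irr_class; case: pselect => [ex | no].
  by exists (sval (cid ex)); split=> //; case: cid.
by case: no; apply: irr_pull_outer levi_iso_inj levi_iso_onto X.
Qed.

Lemma ev_levi_class n (X : mx_representation k (levi Y H a b) n) 
    K' L' (w1 : injection K K') (w2 : injection L L') (x : G K') (y : G L') l :
    #|K| = #|K'| -> #|L| = #|L'| -> l \in levi Y H a b ->
    yg_pull a l = yg_pull w1 x -> yg_pull b l = yg_pull w2 y ->
  ev (chi2 (Point x, Point y)) (levi_class X) = \tr (X l).
Proof.
move=> eK eL ll la lb; rewrite /levi_class raddf_sum mxtrace_comp_factors //.
apply: eq_bigr => W _ /=; have [p [sW ->]] := levi_irr_class_rsim W.
rewrite ev_fgen /chi2 /chi /= !char_of_class.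
rewrite (char_ofE (d := AnyIrrep p.1) w1) // (char_ofE (d :=
  AnyIrrep p.2) w2) //=.
rewrite (mxtrace_rsim sW ll) /= -la -lb.
by rewrite -[RHS]/(\tr (outer_repr p.1 p.2 (yg_pull a l,
  yg_pull b l))) mxtrace_outer.
Qed.

Lemma ev_levi_class_card n (X : mx_representation k (levi Y H a b) n) 
    K' L' (x : G K') (y : G L') :
    #|K| <> #|K'| \/ #|L| <> #|L'| ->
  ev (chi2 (Point x, Point y)) (levi_class X) = 0.
Proof.
move=> ne; rewrite /levi_class raddf_sum big1 // => W _ /=.
have [p [sW ->]] := levi_irr_class_rsim W; rewrite ev_fgen /chi2 /chi /=
  !char_of_class.
by case: ne => ne; [rewrite [X in X * _]char_of_card ?mul0r
  | rewrite [X in _ * X]char_of_card ?mulr0].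
Qed.

End Levi.

Lemma acts_subsets N : [acts [set: {perm N}], on [set: {set N}] | ('P^* )%act].
Proof.
by apply/subsetP => s _; rewrite !inE; apply/subsetP => C _; rewrite !inE.
Qed.

(** The orbits of the symmetric group on subsets are the sets of subsets of
    a given cardinality. *)
Lemma orbit_reps_card N (A B : {set N}) :
  A \in orbit_reps N -> B \in orbit_reps N -> #|A| = #|B| -> A = B.
Proof.
have [_ _ orbE _] := orbit_transversalP (acts_subsets N).
move=> rA rB eAB; apply/eqP; rewrite -orbE //; apply/orbitP.
have [s sA] := perm_mapping_set eAB.
by exists s; rewrite ?inE //= /setact; rewrite -sA; apply: eq_imset.
Qed.

Lemma orbit_reps_exists N n : (n <= #|N|)%N ->
  exists2 A, A \in orbit_reps N & #|A| = n.
Proof.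
move=> leN; have [_ _ _ ex] := orbit_transversalP (acts_subsets N).
have [A cA] : exists A : {set N}, #|A| = n.
  exists [set x in take n (enum N)].
  by rewrite cardsE (card_uniqP _) ?take_uniq ?enum_uniq // size_takel //
    -cardE.
have [s _ As] := ex A (in_setT _); exists (('P^* )%act A s) => //.
by rewrite /= /setact card_imset // => x y /perm_inj.
Qed.

Lemma im_sub_compl N (A : {set N}) : inj_im (inj_sub (~: A)) = ~: inj_im
  (inj_sub A).
Proof. by rewrite !inj_im_sub. Qed.

(** Only the orbit of subsets with #K elements has a nonzero character at
    (x, y), and there the Levi character is evaluated at the element glued
    from x and y. *)
Lemma ev_orbit_sum N (d : {set N} -> nat)
    (X : forall A, mx_representation k (levi Y H (inj_sub A) (inj_sub (~: A)))
      (d A))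
    K L (x : G K) (y : G L) (a : k) :
    #|N| = (#|K| + #|L|)%N ->
    (forall A (w1 : injection (sub_fin A) K) (w2 : injection (sub_fin (~: A)) L)
       (c : injection N (K + L)%type),
       #|sub_fin A| = #|K| -> #|sub_fin (~: A)| = #|L| ->
       inj_cmp c (inj_sub A) = inj_cmp (lft K L) w1 ->
       inj_cmp c (inj_sub (~: A)) = inj_cmp (rgt K L) w2 ->
       \tr (X A (yg_pull c (glue x y [ffun=> 1%g]))) = a) ->
  ev (chi2 (Point x, Point y)) (\sum_(A in orbit_reps N) levi_class (X A)) = a.
Proof.
move=> eN Xa; have [|A rA cA] := @orbit_reps_exists N #|K|.
  by rewrite eN leq_addr.
have eK : #|sub_fin A| = #|K| by rewrite card_sub_fin.
have eL : #|sub_fin (~: A)| = #|L|.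
  by rewrite card_sub_fin; apply: (@addnI #|K|); rewrite -{1}cA cardsC.
rewrite raddf_sum (bigD1 A) //= big1 => [|B /andP[rB nAB]]; last first.
  apply: ev_levi_class_card => //; first exact: im_sub_compl.
  left; rewrite card_sub_fin => eB; move/eqP: nAB; apply.
  by apply: orbit_reps_card => //; rewrite eB.
have [c [ca cb]] := inj_split (im_sub_compl A) (card_inj eK) (card_inj eL).
have ic := im_sub_compl A.
rewrite addr0.
rewrite -(Xa A _ _ c eK eL ca cb).
apply: (@ev_levi_class _ _ _ _ _ ic _ _ _ _ (card_inj eK) (card_inj eL)) => //.
- exact: glue1_levi ca cb.
- exact: glue_pull_a ca cb _ _ _.
exact: glue_pull_b ca cb _ _ _.
Qed.

Lemma ev_orbit_sum_card N (d : {set N} -> nat)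
    (X : forall A, mx_representation k (levi Y H (inj_sub A) (inj_sub (~: A)))
      (d A))
    K L (x : G K) (y : G L) :
    #|N| <> (#|K| + #|L|)%N ->
  ev (chi2 (Point x, Point y)) (\sum_(A in orbit_reps N) levi_class (X A)) = 0.
Proof.
move=> eN; rewrite raddf_sum big1 // => A _; apply: ev_levi_class_card => //.
  exact: im_sub_compl.
rewrite !card_sub_fin; have [cK|] := #|A| =P #|K|; last by left.
by right => cL; case: eN; rewrite -cK -cL cardsC.
Qed.

Definition weight_one (h : H) : k := (h == 1%g)%:R.
Definition weight_unif (h : H) : k := #|H|%:R^-1.

Lemma cardH_neq0 : #|H|%:R != 0 :> k.
Proof. by rewrite natk_neq0 // -cardsT cardG_gt0. Qed.

Lemma weight_one_sum : \sum_h weight_one h = 1.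
Proof.
rewrite (bigD1 1%g) //= big1 ?addr0 /weight_one ?eqxx // => h /negPf->.
by [].
Qed.

Lemma weight_unif_sum : \sum_h weight_unif h = 1.
Proof. by rewrite sumr_const -[LHS]mulr_natr mulVf // cardH_neq0. Qed.

Lemma wavg_one (T : finType) (f : {ffun T -> H} -> k) :
  wavg weight_one f = f [ffun=> 1%g].
Proof.
rewrite /wavg (bigD1 [ffun=> 1%g]) //= [X in _ + X]big1 ?addr0 => [|v nv].
  by rewrite big1 ?mul1r // => t _; rewrite /weight_one ffunE eqxx.
have [t nt] : exists t, v t != 1%g.
  apply/existsP; apply: contraNT nv; rewrite negb_exists => /forallP v1.
  by apply/eqP/ffunP => t; rewrite ffunE; apply/eqP; rewrite -[_ == _]negbK.
by rewrite (bigD1 t) //= /weight_one (negPf nt) !mul0r.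
Qed.

(** The character of the comultiplication with weight p. *)
Definition glue_ch (p : H -> k) (d : any_irrep k Y H) K L (x : G K) (y : G L) :
  k :=
  wavg p (fun v => char_of d (glue x y v)).

Lemma glue_ch_card p d K L (x : G K) (y : G L) :
  #|any_set d| <> (#|K| + #|L|)%N -> glue_ch p d x y = 0.
Proof.
move=> nd; rewrite /glue_ch /wavg big1 // => v _.
by rewrite char_of_card ?mulr0 // card_sum.
Qed.

Lemma ev_Delta_irr (b : basis) K L (x : G K) (y : G L) :
  ev (chi2 (Point x, Point y)) (Delta_irr b)
  = glue_ch weight_one (irr_repr b) x y.
Proof.
have [eN|eN] := #|any_set (irr_repr b)| =P (#|K| + #|L|)%N; last first.
  by rewrite glue_ch_card // ev_orbit_sum_card.
apply: ev_orbit_sum => // A w1 w2 c eK eL ca cb.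
rewrite /glue_ch wavg_one (char_ofE c) //.
by rewrite card_sum.
Qed.

(** The average of V over U is a projection onto the fixed vectors. *)
Lemma mxtrace_rfix (gT : finGroupType) n (V : mx_representation k [set: gT] n)
    (A U : {group gT}) (mod : mxmodule (subg_repr V (subsetT A)) (rfix_mx V U))
      l :
    l \in A ->
  \tr (submod_repr mod l) = #|U|%:R^-1 * \sum_(u in U) \tr (V (l * u)%g).
Proof.
move=> Al; pose E := #|U|%:R^-1 *: \sum_(u in U) V u.
have nzU : #|U|%:R != 0 :> k by rewrite natk_neq0 ?cardG_gt0.
rewrite (@mxtrace_submod_proj _ _ _ _ _ _ mod E) //=.
- rewrite /E -scalemxAr linearZ /= mulmx_sumr raddf_sum /=; congr (_ * _).
  by apply: eq_bigr => u _; rewrite repr_mxM ?inE.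
- apply/rfix_mxP => u Uu; rewrite /E -scalemxAl; congr (_ *: _).
  rewrite mulmx_suml [RHS](reindex_inj (mulIg u)) /=.
  apply: eq_big => [v|v _]; first by rewrite groupMr.
  by rewrite repr_mxM ?inE.
move=> p B BU; rewrite /E -scalemxAr mulmx_sumr.
rewrite (eq_bigr (fun=> B)) => [|u Uu]; last by move/rfix_mxP: BU; apply.
by rewrite sumr_const -scaler_nat scalerA mulVf ?scale1r.
Qed.

Section UnipotentSum.

Variables (K L N : finType) (a : injection K N) (b : injection L N).

Local Notation Yout := {z : Y N | z \notin ysub Y a b}.

(** Elements of the unipotent subgroup are the functions on the points of
    Y_N outside Y_K and Y_L. *)
Definition unipotent_elt (w : {ffun Yout -> H}) : G N :=
  YGroup 1 [ffun z => if insub z is Some z' then w z' else 1%g].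

Lemma unipotent_sum (f : G N -> k) :
  \sum_(u in unipotent Y H a b) f u = \sum_w f (unipotent_elt w).
Proof.
rewrite (reindex_onto unipotent_elt (fun u => [ffun z : Yout =>
  yg_fun u (val z)])) /=.
  apply: eq_bigl => w; rewrite inE /= eqxx /=; apply/andP; split.
    apply/forallP => z; apply/implyP => yz; rewrite ffunE insubF ?eqxx //.
    by rewrite yz.
  by apply/eqP/ffunP => z; rewrite !ffunE valK.
move=> u; rewrite inE => /andP[/eqP u1 /forallP uy].
apply: ygroupP => [|z] /=; rewrite ?u1 // ffunE.
case: insubP => [z' _ <-|]; first by rewrite ffunE.
by rewrite negbK => yz; have /implyP/(_ yz)/eqP-> := uy z.
Qed.

Lemma unipotent_card : #|unipotent Y H a b|%:R = #|H|%:R ^+ #|{: Yout}| :> k.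
Proof.
rewrite -natrX -card_ffun -[LHS]sumr_const unipotent_sum sumr_const.
by rewrite cardT -cardE.
Qed.

End UnipotentSum.

(** The product of a Levi element with an arbitrary element of the unipotent
    subgroup is a gluing along an arbitrary v. *)
Lemma ev_delta_irr (b : basis) K L (x : G K) (y : G L) :
  ev (chi2 (Point x, Point y)) (delta_irr b)
  = glue_ch weight_unif (irr_repr b) x y.
Proof.
have [eN|eN] := #|any_set (irr_repr b)| =P (#|K| + #|L|)%N; last first.
  by rewrite glue_ch_card // ev_orbit_sum_card.
apply: ev_orbit_sum => // A w1 w2 c eK eL ca cb.
have ic := im_sub_compl A; set V := any_rep _.
rewrite mxtrace_rfix; last exact: glue1_levi ca cb.
rewrite unipotent_sum unipotent_card.
set l := yg_pull c _.
pose Yout := {z : Y (any_set (irr_repr b)) | z \notin ysub Y (inj_sub A)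
  (inj_sub (~: A))}.
pose i (z : Yout) := ymap Y c (val z).
have i_inj : injective i by move=> z z' /injP/val_inj.
transitivity (wavg weight_unif (fun w : {ffun Yout -> H} =>
  \tr (V (l * unipotent_elt w)%g))).
  rewrite /wavg big_distrr; apply: eq_bigr => w _ /=; congr (_ * _).
  by rewrite prodr_const exprVn.
rewrite -(wavg_restrict weight_unif_sum _ i_inj); apply: eq_wavg => v.
rewrite (char_ofE c) ?card_sum //; congr (\tr (V _)).
have st v' := glue_pull_stab ic eK eL ca cb x y v'.
have pa v' := glue_pull_a ic eK eL ca cb x y v'.
have pb v' := glue_pull_b ic eK eL ca cb x y v'.
set u := unipotent_elt _; have ul : yg_perm (l * u)%g = yg_perm l.
  by rewrite yg_permM mul1g.
have [sla slb] := andP (st [ffun=> 1%g]).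
have pull1 M (e : injection M (any_set (irr_repr b))) :
    inj_im (ymap Y e) \subset ysub Y (inj_sub A) (inj_sub (~: A)) ->
    stab e l -> yg_pull e (l * u)%g = yg_pull e l.
  move=> sub se; rewrite yg_pullM ?inj_stab1 // -[RHS]mulg1; congr (_ * _)%g.
  apply: ygroupP => [|z] /=.
    by apply/permP => j; apply: (@injP _ _ e); rewrite pull_permE ?inj_stab1 //
      !perm1.
  rewrite !ffunE insubF //.
  by rewrite (subsetP sub) ?mem_inj_im.
apply: (stab_ext ic) => [||||z nz].
- by rewrite ul; apply: st.
- exact: st.
- by rewrite pull1 ?subsetUl // !pa.
- by rewrite pull1 ?subsetUr // !pb.
rewrite (glue_pull_out eK eL ca cb) // yg_funM yact1 (glue_pull_out eK eL ca cb)
  //.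
by rewrite !ffunE mul1g insubT /i ffunE.
Qed.

End LeviCharacters.

(** * The algebra of class functions *)
Section ClassFunctionAlgebra.

Variables (Y : young_set) (H : finGroupType) (k : comNzRingType).
Implicit Types K L M N : finType.
Local Notation G N := (ygroup Y H N).
Local Notation stab a g := (inj_stab a (yg_perm g)).
Implicit Types F : forall N, G N -> k.

Definition restr_set F N (g : G N) (A : {set N}) : k := restr F (inj_sub A) g.

Lemma restr_set_stab F N (g : G N) (A : {set N}) :
  ~~ stab (inj_sub A) g -> restr_set F g A = 0.
Proof. by rewrite /restr_set /restr => /negPf->. Qed.

Lemma stab_setP N (g : G N) (A : {set N}) :
  stab (inj_sub A) g = (yg_perm g @: A == A).
Proof. by rewrite /inj_stab inj_im_sub. Qed.

Lemma restr_set_full F N (g : G N) :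
  class_invariant F -> restr_set F g [set: N] = F N g.
Proof.
move=> invF; rewrite /restr_set (restr_sub _ invF (a := inj_idm N)).
  by rewrite /restr inj_stab_full // yg_pull_id.
exact: inj_im_full.
Qed.

Lemma inj_sub_mem N (A : {set N}) u : inj_sub A u \in A.
Proof. by rewrite mk_injE; apply: valP. Qed.

Lemma val_imset_preim N (A B : {set N}) : B \subset A ->
  inj_sub A @: [set u : sub_fin A | val u \in B] = B.
Proof.
move=> /subsetP BA; apply/setP => x; apply/imsetP/idP => [[u + ->]|Bx].
  by rewrite inE mk_injE.
by exists (exist _ x (BA x Bx)); rewrite ?inE ?mk_injE.
Qed.

Lemma val_preim_imset N (A : {set N}) (B : {set sub_fin A}) :
  [set u : sub_fin A | val u \in inj_sub A @: B] = B.
Proof.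
apply/setP => u; rewrite inE; apply/imsetP/idP => [[v Bv]|Bu].
  by rewrite mk_injE => /val_inj->.
by exists u; rewrite ?mk_injE.
Qed.

(** Subsets of the type of points of A correspond to subsets of N contained
    in A.  If B and its complement in A are stable then so is A, so both sides
    vanish unless A is stable. *)
Lemma restr_cmul F1 F2 N (g : G N) (A : {set N}) :
    class_invariant F1 -> class_invariant F2 ->
  restr_set (fun M (h : G M) => cmul F1 F2 h) g A
  = \sum_(B : {set N} | B \subset A) restr_set F1 g B * restr_set F2 g (A :\:
    B).
Proof.
move=> inv1 inv2; have [sA|nsA] := boolP (stab (inj_sub A) g); last first.
  rewrite restr_set_stab // big1 // => B BA.
  have [sB|nsB] := boolP (stab (inj_sub B) g);
    last by rewrite restr_set_stab ?mul0r.
  have [sC|nsC] := boolP (stab (inj_sub (A :\: B)) g); last first.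
    by rewrite [X in _ * X]restr_set_stab ?mulr0.
  case/negP: nsA; rewrite stab_setP -[A](setID A B) (setIidPr BA) imsetU.
  by rewrite stab_setP in sB; rewrite stab_setP in sC;
    rewrite (eqP sB) (eqP sC).
rewrite /restr_set [in LHS]/restr sA /cmul.
rewrite [RHS](reindex_onto (fun B : {set sub_fin A} => inj_sub A @: B)
   (fun B => [set u : sub_fin A | val u \in B])) /=; last first.
  by move=> B BA; rewrite val_imset_preim.
apply: eq_big => [B | B _].
  rewrite val_preim_imset eqxx andbT; apply/esym/subsetP => _ /imsetP[u _ ->].
  exact: inj_sub_mem.
rewrite !restr_pull //; congr (_ * _); apply: restr_im => //;
  rewrite inj_im_cmp !inj_im_sub //.
apply/setP => x; apply/imsetP/setDP => [[u + ->] | [Ax nBx]].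
  rewrite inE => nBu; split; first exact: inj_sub_mem.
  by rewrite mem_imset //; apply: injP.
exists (exist _ x Ax); rewrite ?mk_injE // inE; apply: contra nBx => Bx.
by apply/imsetP; exists (exist _ x Ax); rewrite ?ffunE.
Qed.

Lemma cmulE F1 F2 N (g : G N) :
  cmul F1 F2 g = \sum_(A : {set N}) restr_set F1 g A * restr_set F2 g (~: A).
Proof. by []. Qed.

(** Both sides are sums over the ordered partitions of N into three
    subsets. *)
Lemma cmulA F1 F2 F3 N (g : G N) :
    class_invariant F1 -> class_invariant F2 -> class_invariant F3 ->
  cmul (fun M (h : G M) => cmul F1 F2 h) F3 g
  = cmul F1 (fun M (h : G M) => cmul F2 F3 h) g.
Proof.
move=> inv1 inv2 inv3; rewrite !cmulE.
under eq_bigr do rewrite restr_cmul // big_distrl /=.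
under [RHS]eq_bigr do rewrite restr_cmul // big_distrr /=.
rewrite (exchange_big_dep xpredT) //=; apply: eq_bigr => B _.
rewrite (reindex_onto (fun C => B :|: C) (fun A => A :\: B)) /= => [|A BA];
  last first.
  by rewrite -{1}(setIidPr BA) setID.
apply: eq_big => [C | C /andP[_ /eqP eC]].
  rewrite subsetUl /= setDUl setDv set0U -disjoints_subset.
  by apply/eqP/idP => [/setDidPl|/setDidPl].
by rewrite eC setCU setDE mulrA.
Qed.

Lemma cmulC F1 F2 N (g : G N) : cmul F1 F2 g = cmul F2 F1 g.
Proof.
rewrite !cmulE (reindex_inj (@setC_inj _)); apply: eq_bigr => A _ /=.
by rewrite setCK mulrC.
Qed.

(** The class function of the unit. *)
Definition cone N (g : G N) : k := (#|N| == 0%N)%:R.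

Lemma cmul1 F N (g : G N) : class_invariant F -> cmul cone F g = F N g.
Proof.
move=> invF; rewrite cmulE (bigD1 set0) //= big1 ?addr0 => [|A nA].
  rewrite setC0 restr_set_full // /restr_set /restr stab_setP imset0 eqxx.
  by rewrite /cone card_sub_fin cards0 eqxx mul1r.
rewrite /restr_set {1}/restr /cone card_sub_fin cards_eq0 (negPf nA).
by rewrite if_same mul0r.
Qed.

Lemma restr_set_void F (g : G void) (A : {set void}) :
  class_invariant F -> restr_set F g A = F void g.
Proof.
move=> invF; rewrite -(restr_set_full g invF); congr (restr_set F g _).
by apply/setP => -[].
Qed.

Lemma cmul_void F1 F2 (g : G void) :
    class_invariant F1 -> class_invariant F2 ->
  cmul F1 F2 g = F1 void g * F2 void g.
Proof.
move=> inv1 inv2; rewrite cmulE (bigD1 set0) //= big1 ?addr0.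
  by rewrite !restr_set_void.
by move=> A; case/eqP; apply/setP => -[].
Qed.

Lemma im_inj_sum_compl K L (A1 : {set K}) (A2 : {set L}) :
  ~: inj_im (inj_sum (inj_sub A1) (inj_sub A2))
  = inj_im (inj_sum (inj_sub (~: A1)) (inj_sub (~: A2))).
Proof.
apply/setP => -[i|i]; first by rewrite inE !inl_inj_sum !inj_im_sub inE.
by rewrite inE !inr_inj_sum !inj_im_sub inE.
Qed.

Lemma sum_set_reindex K L (f : {set (K + L)%type} -> k) :
  \sum_A f A = \sum_(A1 : {set K}) \sum_(A2 : {set L})
     f (inj_im (inj_sum (inj_sub A1) (inj_sub A2))).
Proof.
rewrite pair_bigA /=; apply: reindex.
exists (fun A : {set K + L} => ([set i | inl i \in A],
  [set j | inr j \in A])) => [[A1 A2]|A] _ /=.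
  by congr (_, _); apply/setP => i; rewrite inE ?inl_inj_sum ?inr_inj_sum
    inj_im_sub.
apply/setP => -[i|i]; rewrite ?inl_inj_sum ?inr_inj_sum inj_im_sub inE //.
Qed.

(** Subsets of K+L are pairs of subsets of K and L, and so are their
    complements. *)
Lemma cmul_glue F1 F2 K L (x : G K) (y : G L) v :
    class_invariant F1 -> class_invariant F2 ->
  cmul F1 F2 (glue x y v)
  = \sum_(A1 : {set K}) \sum_(A2 : {set L})
     restr F1 (inj_sum (inj_sub A1) (inj_sub A2)) (glue x y v) *
     restr F2 (inj_sum (inj_sub (~: A1)) (inj_sub (~: A2))) (glue x y v).
Proof.
move=> inv1 inv2; rewrite cmulE sum_set_reindex; apply: eq_bigr => A1 _.
apply: eq_bigr => A2 _; rewrite im_inj_sum_compl /restr_set.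
by congr (_ * _); apply: restr_sub.
Qed.

End ClassFunctionAlgebra.

(** * The Hopf algebra axioms *)
Section HopfAxioms.

Variables (k : closedFieldType) (k_char0 : [pchar k] =i pred0).
Variables (Y : young_set) (H : finGroupType).
Implicit Types K L M N : finType.
Local Notation G N := (ygroup Y H N).
Local Notation stab a g := (inj_stab a (yg_perm g)).
Local Notation lft K L := (inj_left K L).
Local Notation rgt K L := (inj_right K L).
Local Notation basis := (irr_basis k Y H).
Local Notation RY := {freeg basis}.
Local Notation RY2 := {freeg basis * basis}.
Local Notation point := (point Y H).
Local Notation m := (Rmul k Y H).
Local Notation e := (Runit k Y H).
Local Notation eps := (Rcounit k Y H).
Local Notation deg := (@Rdeg k Y H).
Local Notation chf x := (fun N (g : G N) => ch g x).
Local Notation triv := (triv_class k Y H).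

Definition pt2_size (t : point * point) : nat :=
  (#|point_set t.1| + #|point_set t.2|)%N.

Lemma ch_inj (x y : RY) : (forall N (g : G N), ch g x = ch g y) -> x = y.
Proof.
by move=> xy; apply: (separating_inj k_char0 (@chi_separating k k_char0 Y H)) =>
  -[N g]; apply: xy.
Qed.

Lemma chi2_separating : separating (@chi2 k Y H).
Proof. exact: separating_prod (@chi_separating k k_char0 Y H) (@chi_separating k
  k_char0 Y H). Qed.

Lemma chi2_inj (x y : RY2) :
    (forall K L (g : G K) (h : G L),
      ev (@chi2 k Y H (Point g, Point h)) x = ev (chi2 (Point g, Point h)) y) ->
  x = y.
Proof.
by move=> xy; apply: (separating_inj k_char0 chi2_separating) => -[[K g] [L h]];
  apply: xy.
Qed.

Lemma chi2_degree (p : basis * basis) t :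
  chi2 t p != 0 -> (deg p.1 + deg p.2)%N = pt2_size t.
Proof. by rewrite mulf_eq0 negb_or => /andP[/chi_degree-> /chi_degree->]. Qed.

Lemma homogeneousP n (x : RY) :
  homogeneous deg n x <-> forall N (g : G N), #|N| <> n -> ch g x = 0.
Proof.
split=> [hx N g nN | hx b].
  exact: (ev_degree0 (t := Point g) (@chi_degree k Y H) hx).
apply: (ev_degree k_char0 (@chi_separating k k_char0 Y H) (@chi_degree k Y H)).
by move=> [N g]; apply: hx.
Qed.

Lemma homogeneous2P n (z : RY2) :
  homogeneous2 deg n z <->
  forall K L (g : G K) (h : G L), (#|K| + #|L|)%N <> n ->
    ev (chi2 (Point g, Point h)) z = 0.
Proof.
split=> [hz K L g h nN | hz p].
  exact: (ev_degree0 (t := (Point g, Point h)) chi2_degree hz).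
apply: (ev_degree k_char0 chi2_separating chi2_degree).
by move=> [[K g] [L h]]; apply: hz.
Qed.

Lemma chi_triv N (g : G N) : chi (Point g) triv = cone k g.
Proof.
rewrite /chi char_of_class /cone; have [N0|N0] := eqVneq #|N| 0%N; last first.
  by rewrite char_of_card //= card_void; apply/eqP; rewrite eq_sym.
have v0 : #|any_set (AnyIrrep (triv_irrep k (G void)))| = #|N| by rewrite /=
  card_void N0.
by rewrite (char_ofE (card_inj v0)) //= mxtrace1.
Qed.

Lemma ch_unit N (g : G N) c : ch g (e c) = c%:~R * cone k g.
Proof. by rewrite /ch raddfMz /= ev_fgen chi_triv mulrzl. Qed.

Lemma ch_unit1 N (g : G N) : ch g (e 1) = cone k g.
Proof. by rewrite ch_unit mul1r. Qed.

Lemma ch_unit_cone : chf (e 1) = @cone Y H k.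
Proof.
by apply: functional_extensionality_dep => N; apply: funext => g;
  rewrite ch_unit1.
Qed.

(** For empty N the group G_N is trivial, so the pairing of b with the trivial
    representation is the dimension of b, which is not 0. *)
Lemma deg0_triv b : deg b = 0%N -> b = triv.
Proof.
move=> b0; pose N := any_set (irr_repr b).
have NE : #|N| = 0%N by [].
have G1 (g h : G N) : g = h.
  apply: ygroupP => [|y].
    by apply/permP => i; have := card0_eq NE i; rewrite inE.
  by have := card0_eq (yobj_empty Y NE) y; rewrite inE.
have := char_orthogonal k_char0 b triv.
rewrite (eq_bigr (fun=> \tr (any_rep (irr_repr b) 1%g))) => [|g _]; last first.
  rewrite -[char_of _ g]/(chi (Point g) triv) chi_triv /cone NE eqxx mulr1.
  by rewrite (G1 g^-1%g 1%g).
have /mx_irrP[n_gt0 _] := irrepP (any_rep (irr_repr b)).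
rewrite repr_mx1 mxtrace1 sumr_const; have [->//|_] := eqVneq triv b.
move=> /eqP; rewrite mul0r -[X in X == _]mulr_natr mulf_eq0 !(natk_eq0 k_char0).
rewrite eqn0Ngt n_gt0 /= => /eqP/card0_eq/(_ 1%g); by rewrite inE.
Qed.

(** The counit is the character at the empty set. *)
Lemma counitE (x : RY) : (eps x)%:~R = ch (1%g : G void) x.
Proof.
rewrite /Rcounit ev_coeff; apply: eq_ev => b /=.
have [->|nb] := eqVneq b triv; first by rewrite chi_triv /cone card_void.
apply/esym; apply: contra_neq_eq nb => /chi_degree; rewrite card_void.
exact: deg0_triv.
Qed.

Lemma Runit_connected : is_connected deg e.
Proof.
have coeff_e c : coeff triv (e c) = c.
  by rewrite raddfMz /= coeff_fgen eqxx intz.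
split; first by move=> c d /(congr1 (coeff triv)); rewrite !coeff_e.
split=> [c|x /homogeneousP hx].
  by apply/homogeneousP => N g nN; rewrite ch_unit /cone; case: eqP nN;
    rewrite ?mulr0.
exists (eps x); apply: ch_inj => N g; rewrite ch_unit counitE.
have [N0|nN] := eqVneq #|N| 0%N; last first.
  by rewrite [RHS]hx; [rewrite /cone (negPf nN) mulr0 | apply/eqP].
have [inv _] := ch_invariant x.
have v0 : #|{: void}| = #|N| by rewrite card_void N0.
rewrite /cone N0 eqxx mulr1 -(inv _ _ (card_inj v0)) //; congr (ch _ x).
apply: ygroupP => [|y]; first by apply/permP => -[].
by have := card0_eq (yobj_empty Y card_void) y; rewrite inE.
Qed.

Lemma Rmul_algebra : is_algebra m e.
Proof.
split=> [x y z|x|x]; apply: ch_inj => N g.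
- rewrite !ch_mul.
  have ext a b : (fun M (h : G M) => ch h (m (tensor a b)))
      = (fun M (h : G M) => cmul (chf a) (chf b) h).
    by apply: functional_extensionality_dep => M; apply: funext => h;
      rewrite ch_mul.
  by rewrite !ext cmulA //; apply: ch_invariant.
- by rewrite ch_mul ch_unit_cone cmul1 //; apply: ch_invariant.
by rewrite ch_mul cmulC ch_unit_cone cmul1 //; apply: ch_invariant.
Qed.

Lemma Rmul_commutative : is_commutative m.
Proof.
move=> t; apply: (freeg_ext (f := m \o @tensor_swap _ _) (g := m)) => -[b c] /=.
rewrite /tensor_swap flift_fgen /= -!tensor_fgen.
by apply: ch_inj => N g; rewrite !ch_mul cmulC.
Qed.

Lemma Rcounit_mul x y : eps (m (tensor x y)) = eps x * eps y.
Proof.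
apply: (intk_inj k_char0); rewrite intrM !counitE ch_mul cmul_void //.
  exact: ch_invariant.
exact: ch_invariant.
Qed.

Lemma Rcounit_unit : eps (e 1) = 1.
Proof. by rewrite /Rcounit /= coeff_fgen eqxx. Qed.

Lemma Rmul_graded i j x y :
    homogeneous deg i x -> homogeneous deg j y ->
  homogeneous deg (i + j) (m (tensor x y)).
Proof.
move=> /homogeneousP hx /homogeneousP hy; apply/homogeneousP => N g nN.
rewrite ch_mul cmulE big1 // => A _; rewrite /restr_set /restr.
case: ifP => _; last by rewrite mul0r.
have [Ai|Ai] := #|A| =P i; last by rewrite hx ?mul0r // card_sub_fin.
case: ifP => _; last by rewrite mulr0.
rewrite hy ?mulr0 // card_sub_fin => Aj.
by case: nN; rewrite -Ai -Aj cardsC.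
Qed.

Lemma Rcounit_graded n x : homogeneous deg n x -> (0 < n)%N -> eps x = 0.
Proof.
move=> /homogeneousP hx n_gt0; apply: (intk_inj k_char0).
by rewrite counitE hx // card_void => n0; rewrite -n0 in n_gt0.
Qed.

Section Comultiplication.

Variable p : H -> k.
Hypothesis p_sum1 : \sum_h p h = 1.
Variable D : {additive RY -> RY2}.
Hypothesis DE : forall b K L (x : G K) (y : G L),
  ev (chi2 (Point x, Point y)) (D (fgen b)) = glue_ch p (irr_repr b) x y.

Lemma ev_wavg (B : choiceType) (T : finType) (c : {ffun T -> H} -> B -> k) z :
  ev (fun b => wavg p (fun v => c v b)) z = wavg p (fun v => ev (c v) z).
Proof.
rewrite /wavg -ev_sum; apply: eq_bigr => v _; by rewrite ev_mull.
Qed.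

Lemma chi2_comul K L (x : G K) (y : G L) (z : RY) :
  ev (chi2 (Point x, Point y)) (D z) = wavg p (fun v => ch (glue x y v) z).
Proof.
rewrite ev_comp -ev_wavg; apply: eq_ev => b; exact: DE.
Qed.

Lemma ch_glue_l K (g : G K) L (h : G L) v (z : RY) : #|K| = 0%N -> ch (glue g h
  v) z = ch h z.
Proof.
move=> K0; have [inv _] := ch_invariant z.
by rewrite -(inv _ _ (rgt K L)) ?glue_pull_r // card_sum K0.
Qed.

Lemma ch_glue_r K (g : G K) L (h : G L) v (z : RY) : #|L| = 0%N -> ch (glue g h
  v) z = ch g z.
Proof.
move=> L0; have [inv _] := ch_invariant z.
by rewrite -(inv _ _ (lft K L)) ?glue_pull_l // card_sum L0 addn0.
Qed.

Definition chi3 (t : point * (point * point)) (q : basis * (basis * basis)) : k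
  :=
  chi t.1 q.1 * chi2 t.2 q.2.

Lemma chi3_inj (x y : {freeg basis * (basis * basis)}) :
    (forall K L M (g : G K) (h : G L) (i : G M),
      ev (chi3 (Point g, (Point h, Point i))) x
      = ev (chi3 (Point g, (Point h, Point i))) y) ->
  x = y.
Proof.
move=> xy; have sep : separating chi3.
  exact: separating_prod (@chi_separating k k_char0 Y H) chi2_separating.
by apply: (separating_inj k_char0 sep) => -[[K g] [[L h] [M i]]]; apply: xy.
Qed.

Lemma wavg_exchange (T U : finType) (f : {ffun T -> H} -> {ffun U -> H} -> k) :
  wavg p (fun v => wavg p (f v)) = wavg p (fun u => wavg p (fun v => f v u)).
Proof.
rewrite /wavg; under eq_bigr do rewrite big_distrr /=.
rewrite exchange_big; apply: eq_bigr => u _ /=.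
by rewrite big_distrr; apply: eq_bigr => v _ /=; rewrite mulrCA.
Qed.

(** On characters both sides are iterated expectations over an outer and an
    inner function; by [wavg_merge] each is an expectation over a single
    function, and [glue_assoc] compares the two. *)
Lemma comul_coassociative x :
  tensor_assoc (tensor_map D idfun (D x)) = tensor_map idfun D (D x).
Proof.
apply: chi3_inj => K L M g h i.
transitivity (wavg p (fun v => ch (glue3l g h i v) x)).
  rewrite ev_comp (eq_ev (c' := fun q => chi2 (Point g,
    Point h) q.1 * chi (Point i) q.2)); last first.
    by move=> [[b c] d] /=; rewrite /tensor_assoc flift_fgen ev_fgen /chi3 /chi2
      /= mulrA.
  rewrite (ev_tensor_map (chi2 (Point g, Point h)) (chi (Point i)) D idfun).
  rewrite (eq_ev (c' := fun q => wavg p (fun v' => chi2 (Point (glue g h v'),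
    Point i) q))); last first.
    move=> [b c] /=; rewrite ev_fgen DE /glue_ch wavg_mulr; exact: eq_wavg.
  rewrite ev_wavg; under eq_wavg => v' do rewrite chi2_comul.
  rewrite wavg_exchange.
  rewrite (wavg_merge p_sum1 (i := ymap Y (lft (K + L)%type M))
    (f := fun v' v => ch (glue (glue g h v') i v) x)) //.
    exact: injP.
  move=> v' v u vu; congr (ch _ x); apply: glue_vals_eq => z.
  rewrite inE negb_or => /andP[zl _]; apply: vu; apply: contra zl.
  by move/codomP=> [t ->]; apply: mem_inj_im.
transitivity (wavg p (fun v => ch (glue3r g h i v) x)).
  rewrite -[LHS](wavg_restrict p_sum1 _ (@injP _ _ (ymap Y (inj_assoc K L M)))).
  apply: eq_wavg => v; rewrite -[X in glue3l _ _ _ X]/(pull_vals (inj_assoc K L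
    M) v).
  rewrite -glue_assoc; have [inv _] := ch_invariant x.
  by rewrite inv // !card_sum addnA.
symmetry; rewrite (ev_tensor_map (chi (Point g)) (chi2 (Point h,
  Point i)) idfun D).
rewrite (eq_ev (c' := fun q => wavg p (fun v' => chi2 (Point g,
  Point (glue h i v')) q))); last first.
  move=> [b c] /=; rewrite ev_fgen DE /glue_ch wavg_mull; exact: eq_wavg.
rewrite ev_wavg; under eq_wavg => v' do rewrite chi2_comul.
rewrite wavg_exchange.
rewrite (wavg_merge p_sum1 (i := ymap Y (rgt K (L + M)%type))
  (f := fun v' v => ch (glue g (glue h i v') v) x)) //.
  exact: injP.
move=> v' v u vu; congr (ch _ x); apply: glue_vals_eq => z.
rewrite inE negb_or => /andP[_ zr]; apply: vu; apply: contra zr.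
by move/codomP=> [t ->]; apply: mem_inj_im.
Qed.

Lemma comul_coalgebra : is_coalgebra D eps.
Proof.
split=> [x|x|x]; first exact: comul_coassociative.
  apply: ch_inj => N g; rewrite /ch ev_comp.
  rewrite (eq_ev (c' := chi2 (Point (1%g : G void), Point g))) => [|[b c]];
    last first.
    by rewrite /= flift_fgen /= scale_mulz raddfMz /= ev_fgen -mulrzl counitE
      /ch ev_fgen.
  rewrite chi2_comul -[RHS](wavg_const p_sum1 (Y (void + N)%type)).
  by apply: eq_wavg => v; rewrite ch_glue_l // card_void.
apply: ch_inj => N g; rewrite /ch ev_comp.
rewrite (eq_ev (c' := chi2 (Point g, Point (1%g : G void)))) => [|[b c]];
  last first.
  by rewrite /= flift_fgen /= scale_mulz raddfMz /= ev_fgen -mulrzr counitE /ch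
    ev_fgen.
rewrite chi2_comul -[RHS](wavg_const p_sum1 (Y (N + void)%type)).
by apply: eq_wavg => v; rewrite ch_glue_r // card_void.
Qed.

(** Both sides are sums over pairs of stable subsets A1 of K and A2 of L.
    The values of v on Y of A1+A2 and on Y of the complement are independent,
    so the expectation factors. *)
Lemma comul_multiplicative x y : D (m (tensor x y)) =
  tensor_map m m (tensor_swap_mid (tensor (D x) (D y))).
Proof.
apply: chi2_inj => K L g h; rewrite chi2_comul.
(* [c1 A1 A2] evaluates characters at the restrictions to A1 and A2, and is 0
   unless both are stable. *)
pose R K' (g' : G K') (b : basis) (A : {set K'}) :=
  restr_set (char_of (irr_repr b)) g' A.
pose c1 (A1 : {set K}) (A2 : {set L}) (q : basis * basis) :=
  R _ g q.1 A1 * R _ h q.2 A2.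
transitivity (\sum_(A1 : {set K}) \sum_(A2 : {set L})
   ev (c1 A1 A2) (D x) * ev (c1 (~: A1) (~: A2)) (D y)); last first.
  rewrite (ev_tensor_map (chi (Point g)) (chi (Point h)) m m) ev_comp.
  under eq_bigr => A1 _.
    under eq_bigr => A2 _ do rewrite -(ev_tensor (c1 A1 A2) (c1 (~: A1) (~:
      A2))).
    rewrite ev_sum; over.
  rewrite ev_sum; apply: eq_ev => -[[b1 b2] [b3 b4]].
  rewrite /= /tensor_swap_mid flift_fgen ev_fgen /= -/(ch g _) -/(ch h _).
  rewrite !ch_Rmul !ev_fgen /= !cmulE big_distrlr /=.
  apply: eq_bigr => A1 _; apply: eq_bigr => A2 _; rewrite /c1 /=.
  by rewrite mulrACA.
have evc A1 A2 z : ev (c1 A1 A2) (D z)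
   = if stab (inj_sub A1) g && stab (inj_sub A2) h then
       wavg p (fun v => ch (glue (yg_pull (inj_sub A1) g) (yg_pull (inj_sub A2)
         h) v) z)
     else 0.
  rewrite /c1 /R /restr_set /restr; case: ifP => [/andP[-> ->]|].
    by rewrite -chi2_comul.
  move/negbT; rewrite negb_and => /orP[] /negPf->.
    by rewrite evE big1 // => q _; rewrite mul0r mulr0.
  by rewrite evE big1 // => q _; rewrite !mulr0.
under eq_wavg => v.
  rewrite ch_mul cmul_glue; [|exact: ch_invariant|exact: ch_invariant].
  over.
rewrite wavg_bigsum; apply: eq_bigr => A1 _; rewrite wavg_bigsum;
  apply: eq_bigr => A2 _.
rewrite !evc /restr.
have [s12|ns12] := boolP (stab (inj_sub A1) g && stab (inj_sub A2) h);
  last first.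
  rewrite mul0r /wavg big1 // => v _; rewrite inj_sum_stab (negPf ns12).
  by rewrite mul0r mulr0.
have [s34|ns34] := boolP (stab (inj_sub (~: A1)) g && stab (inj_sub (~: A2)) h);
  last first.
  rewrite mulr0 /wavg big1 // => v _; rewrite !inj_sum_stab (negPf ns34).
  by rewrite !mulr0.
have [s1 s2] := andP s12; have [s3 s4] := andP s34.
rewrite -(wavg_indep p_sum1 _ _ (@injP _ _ (ymap Y (inj_sum (inj_sub A1)
  (inj_sub A2))))
  (@injP _ _ (ymap Y (inj_sum (inj_sub (~: A1)) (inj_sub (~: A2)))))).
  by apply: eq_wavg => v; rewrite !inj_sum_stab s12 s34 !glue_pull_sum.
apply: ymap_disjoint; rewrite -im_inj_sum_compl; exact: setICr.
Qed.

Lemma comul_of_unit : D (e 1) = tensor (e 1) (e 1).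
Proof.
apply: chi2_inj => K L g h; rewrite chi2_comul.
rewrite (ev_tensor (chi (Point g)) (chi (Point h))) -!/(ch _ _) !ch_unit1.
under eq_wavg => v do rewrite ch_unit1.
by rewrite wavg_const // /cone card_sum addn_eq0 -mulnb natrM.
Qed.

Lemma comul_homogeneous n x : homogeneous deg n x -> homogeneous2 deg n (D x).
Proof.
move=> /homogeneousP hx; apply/homogeneous2P => K L g h nKL.
rewrite chi2_comul /wavg big1 // => v _; rewrite hx ?mulr0 //.
by rewrite card_sum.
Qed.

Lemma graded_hopf : is_graded_hopf deg m D e eps.
Proof.
apply: connected_bialgebra_hopf; last exact: Runit_connected.
  split; first exact: Rmul_algebra.
  - exact: comul_coalgebra.
  - exact: comul_multiplicative.
  - exact: comul_of_unit.
  - exact: Rcounit_mul.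
  exact: Rcounit_unit.
split; first exact: Rmul_graded.
- exact: comul_homogeneous.
- by case: Runit_connected => _ [].
exact: Rcounit_graded.
Qed.

Lemma cocommutative : is_cocommutative D.
Proof.
move=> x; apply: chi2_inj => K L g h.
transitivity (ev (chi2 (Point h, Point g)) (D x)).
  rewrite ev_comp; apply: eq_ev => -[b c].
  by rewrite /= /tensor_swap flift_fgen ev_fgen /chi2 /= mulrC.
rewrite !chi2_comul.
rewrite -(wavg_restrict p_sum1 _ (@injP _ _ (ymap Y (inj_swap L K)))).
apply: eq_wavg => v; rewrite -/(pull_vals _ _) -glue_swap.
have [inv _] := ch_invariant x.
by rewrite inv // !card_sum addnC.
Qed.

End Comultiplication.

End HopfAxioms.

(** * Self-adjointness and positivity *)
Section InnerProduct.

Variable B : choiceType.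
Implicit Types x y : {freeg B}.

Lemma innerE x y : inner x y = ev (fun b => coeff b y) x.
Proof. by rewrite evE /inner; apply: eq_bigr => b _; rewrite intz. Qed.

Lemma innerC x y : inner x y = inner y x.
Proof.
rewrite [RHS]innerE /inner.
under [LHS]eq_bigr => b _ do rewrite -[coeff b y]intz ev_coeff ev_mull.
rewrite ev_sum; apply: eq_ev => c; rewrite -[RHS]intz ev_coeff evE.
by apply: eq_bigr => b _; rewrite intz eq_sym.
Qed.

Lemma nonneg_sum (I : Type) (r : seq I) (P : pred I) (F : I -> {freeg B}) :
  (forall i, P i -> nonneg (F i)) -> nonneg (\sum_(i <- r | P i) F i).
Proof.
by move=> nF b; rewrite raddf_sum; apply: sumr_ge0 => i Pi; apply: nF.
Qed.

Lemma nonneg_fgen (b : B) : nonneg (fgen b).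
Proof. by move=> b'; rewrite coeff_fgen ler0n. Qed.

Lemma nonnegMz x (c : int) : 0 <= c -> nonneg x -> nonneg (x *~ c).
Proof. by move=> c0 nx b; rewrite raddfMz /= -mulrzl intz mulr_ge0. Qed.

Lemma nonneg_flift (C : choiceType) (f : C -> {freeg B}) (z : {freeg C}) :
  (forall c, nonneg (f c)) -> nonneg z -> nonneg (flift f z).
Proof.
move=> nf nz; rewrite [z]freegenE raddf_sum; apply: nonneg_sum => c _.
by rewrite raddfMz /= flift_fgen; apply: nonnegMz.
Qed.

End InnerProduct.

(** Both sides are biadditive, so adjointness is an equality of matrix
    coefficients. *)
Lemma adjoint_on_generators (B C : choiceType)
    (m : {additive {freeg C} -> {freeg B}}) (D : {additive {freeg B} -> {freeg
      C}}) :
    (forall b c, coeff b (m (fgen c)) = coeff c (D (fgen b))) ->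
  forall t x, inner (m t) x = inner t (D x).
Proof.
move=> mD t x; rewrite !innerE ev_comp; apply: eq_ev => c.
rewrite -innerE innerC innerE.
by apply: (freeg_ext (g := coeff c \o D)) => b; rewrite /= ev_fgen.
Qed.

Section SelfAdjoint.

Variables (k : closedFieldType) (k_char0 : [pchar k] =i pred0).
Variables (Y : young_set) (H : finGroupType).
Implicit Types K L M N : finType.
Local Notation G N := (ygroup Y H N).
Local Notation GT N := [set: ygroup Y H N].
Local Notation lft K L := (inj_left K L).
Local Notation rgt K L := (inj_right K L).
Local Notation basis := (irr_basis k Y H).
Local Notation RY := {freeg basis}.
Local Notation RY2 := {freeg basis * basis}.
Local Notation unif := (@weight_unif k H).

Lemma coeff_char (b : basis) (z : RY) :
  #|GT (any_set (irr_repr b))|%:R * (coeff b z)%:~R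
  = \sum_g char_of (irr_repr b) (g^-1)%g * ch (g : G (any_set (irr_repr b))) z.
Proof.
rewrite ev_coeff ev_mull.
under [RHS]eq_bigr do rewrite ev_mull.
rewrite ev_sum; apply: eq_ev => b'.
rewrite mulrC -char_orthogonal //; apply: eq_bigr => g _.
by rewrite char_of_self.
Qed.

Lemma coeff_char2 (p : basis * basis) (z : RY2) :
  #|GT (any_set (irr_repr p.1))|%:R * #|GT (any_set (irr_repr p.2))|%:R
    * (coeff p z)%:~R
  = \sum_g \sum_h char_of (irr_repr p.1) (g^-1)%g * char_of (irr_repr p.2)
    (h^-1)%g
      * ev (chi2 (Point (g : G (any_set (irr_repr p.1))),
                  Point (h : G (any_set (irr_repr p.2))))) z.
Proof.
rewrite ev_coeff ev_mull.
under [RHS]eq_bigr => g _.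
  under eq_bigr do rewrite ev_mull.
  rewrite ev_sum; over.
rewrite ev_sum; apply: eq_ev => -[b1 b2]; case: p => [p1 p2] /=.
rewrite -pair_eqE /= -mulnb natrM mulrACA ![_ * (_ == _)%:R]mulrC
  -!char_orthogonal //.
rewrite big_distrlr /=; apply: eq_bigr => g _; apply: eq_bigr => h _.
by rewrite mulrACA !char_of_self.
Qed.

Section ParabolicAverage.

Variables K L : finType.
Local Notation P := (parabolic Y H (lft K L) (rgt K L)).
Local Notation Yout := {z : Y (K + L)%type | z \notin ysub Y (lft K L) (rgt K
  L)}.

(** Any extension of w to Y_{K+L} would do, as [glue] ignores the values on
    Y_K and Y_L. *)
Definition extend_out (w : {ffun Yout -> H}) : {ffun Y (K + L)%type -> H} :=
  [ffun z => if insub z is Some z' then w z' else 1%g].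

(** An element of the parabolic subgroup is glued from unique x, y and unique
    values outside Y_K and Y_L. *)
Lemma sum_parabolic (f : G (K + L)%type -> k) :
  \sum_(g in P) f g = \sum_x \sum_y \sum_w f (glue x y (extend_out w)).
Proof.
rewrite pair_bigA pair_bigA /=.
rewrite (reindex_onto (fun q : G K * G L * {ffun Yout -> H} =>
                         glue q.1.1 q.1.2 (extend_out q.2))
  (fun g => (yg_pull (lft K L) g, yg_pull (rgt K L) g,
             [ffun z : Yout => yg_fun g (val z)]))) /=.
  apply: eq_bigl => -[[x y] w]; rewrite inE glue_stab /= glue_pull_l
    glue_pull_r.
  rewrite -pair_eqE /= eqxx /=; apply/eqP/ffunP => z.
  by rewrite ffunE glue_fun_out ?(valP z) // ffunE valK.
move=> g; rewrite inE => sg; apply/esym/glue_uniq => // z nz.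
by rewrite !ffunE insubT ffunE.
Qed.

Lemma wavg_glue (f : G (K + L)%type -> k) x y :
  #|H|%:R ^+ #|{: Yout}| * wavg unif (fun v => f (glue x y v))
  = \sum_w f (glue x y (extend_out w)).
Proof.
have HY : #|H|%:R ^+ #|{: Yout}| != 0 :> k by rewrite expf_neq0 // cardH_neq0.
transitivity (#|H|%:R ^+ #|{: Yout}| * wavg unif (fun w : {ffun Yout -> H} =>
   f (glue x y (extend_out w)))).
  congr (_ * _).
  rewrite -(wavg_restrict (weight_unif_sum k_char0 H) (fun w =>
    f (glue x y (extend_out w)))
    (@val_inj _ _ _ : injective (val : Yout -> _))).
  apply: eq_wavg => v; congr f; apply: glue_vals_eq => z nz.
  by rewrite ffunE insubT ffunE.
rewrite /wavg big_distrr; apply: eq_bigr => w _ /=.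
by rewrite prodr_const exprVn mulrA mulfV ?mul1r.
Qed.

(** The average over the parabolic subgroup is taken in stages. *)
Lemma parabolic_average (f : G (K + L)%type -> k) :
  #|GT K|%:R * #|GT L|%:R * \sum_(g in P) f g
  = #|P|%:R * \sum_x \sum_y wavg unif (fun v => f (glue x y v)).
Proof.
have cP : #|P|%:R = #|GT K|%:R * #|GT L|%:R * #|H|%:R ^+ #|{: Yout}| :> k.
  rewrite -[LHS]sumr_const sum_parabolic.
  under eq_bigr do under eq_bigr do rewrite sumr_const.
  under eq_bigr do rewrite sumr_const.
  rewrite sumr_const !cardsT -natrX -!natrM -card_ffun -!mulrnA; congr _%:R.
  by rewrite [LHS]mulnC mulnAC mulnC mulnA.
rewrite cP -[RHS]mulrA; congr (_ * _); rewrite sum_parabolic big_distrr;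
  apply: eq_bigr => x _ /=.
by rewrite big_distrr; apply: eq_bigr => y _ /=; rewrite wavg_glue.
Qed.

(** Frobenius reciprocity: by conjugation invariance of the character of d,
    every coset contributes the same sum over the parabolic subgroup, and there
    are as many cosets as the index. *)
Lemma induced_pairing (d : any_irrep k Y H) (V : irrep k (GT K)) (W : irrep k
  (GT L)) :
  #|P|%:R * (\sum_(g : G (K + L)%type) char_of d (g^-1)%g *
     cmul (char_of (AnyIrrep V)) (char_of (AnyIrrep W)) g)
  = #|GT (K + L)%type|%:R * \sum_(g in P) char_of d (g^-1)%g *
     (\tr (V (yg_pull (lft K L) g)) * \tr (W (yg_pull (rgt K L) g))).
Proof.
pose psi (g : G (K + L)%type) : k := if g \in P then
  \tr (V (yg_pull (lft K L) g)) * \tr (W (yg_pull (rgt K L) g)) else 0.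
have indE g : cmul (char_of (AnyIrrep V)) (char_of (AnyIrrep W)) g
   = \sum_i psi (g ^ (coset_rep (P := P) i)^-1)%g.
  rewrite -char_induced mxtrace_ind; apply: eq_bigr => i _.
  rewrite conjgE invgK mulgA /zero_ext /psi; case: ifP => _;
    last exact: mxtrace0.
  exact: (mxtrace_outer V W).
under eq_bigr do rewrite indE big_distrr /=.
rewrite exchange_big /=.
have conj t : \sum_g char_of d (g^-1)%g * psi (g ^ t^-1)%g
    = \sum_(g in P) char_of d (g^-1)%g *
      (\tr (V (yg_pull (lft K L) g)) * \tr (W (yg_pull (rgt K L) g))).
  rewrite (reindex_inj (conjg_inj t)) [RHS]big_mkcond /=; apply: eq_bigr => g _.
  rewrite conjgK -conjVg; have [_ ->] := char_of_invariant d.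
  by rewrite /psi; case: ifP; rewrite ?mulr0.
under eq_bigr do rewrite conj.
rewrite sumr_const card_ord -[X in _ * X]mulr_natl mulrA -natrM.
congr (_%:R * _); exact: (Lagrange (subsetT P)).
Qed.

End ParabolicAverage.

Lemma glue_pullV K L (g : G (K + L)%type) :
  KL_stab (lft K L) (rgt K L) (yg_perm g) ->
  yg_pull (lft K L) g^-1%g = (yg_pull (lft K L) g)^-1%g /\
  yg_pull (rgt K L) g^-1%g = (yg_pull (rgt K L) g)^-1%g.
Proof.
move=> /andP[sl sr].
by rewrite !yg_pullV.
Qed.

Lemma pairing_pull (F1 F2 : forall N, G N -> k) N M (w : injection N M) :
    class_invariant F1 ->
    (forall g, F2 N (yg_pull w g) = F2 M g) -> #|N| = #|M| ->
  \sum_g F1 M (g^-1)%g * F2 M g = \sum_g F1 N (g^-1)%g * F2 N g.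
Proof.
move=> [inv1 _] inv2 e; have [v [wv vw]] := inj_inverse w e.
rewrite [RHS](reindex (yg_pull w)) /=; last first.
  have cmp_id A B (a : injection A B) (b : injection B A) (g : G B) :
      #|A| = #|B| -> cancel b a -> yg_pull b (yg_pull a g) = g.
    move=> eAB ba; rewrite -yg_pull_comp ?inj_stab_full // -[RHS]yg_pull_id.
    by congr yg_pull; apply: injection_eqP => x; rewrite inj_cmpE ba inj_idmE.
  by exists (yg_pull v) => g _; apply: cmp_id.
apply: eq_bigr => g _; rewrite inv2; congr (_ * _).
by rewrite -yg_pullV ?inj_stab_full // inv1.
Qed.

(** Each coefficient is a pairing of characters; the left one is an average
    over the parabolic subgroup by [induced_pairing], the right one an average
    over gluings, and [parabolic_average] identifies them. *)
Lemma Rmul_Rdelta_reciprocity (b : basis) (p : basis * basis) :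
  coeff b (Rmul k Y H (fgen p)) = coeff p (Rdelta k Y H (fgen b)).
Proof.
apply: (intk_inj k_char0).
set d := irr_repr b; set K := any_set (irr_repr p.1); set L :=
  any_set (irr_repr p.2).
have nz N : #|GT N|%:R != 0 :> k by rewrite natk_neq0 ?cardG_gt0.
have mulE N (g : G N) : ch g (Rmul k Y H (fgen p))
    = cmul (char_of (irr_repr p.1)) (char_of (irr_repr p.2)) g.
  by rewrite ch_Rmul ev_fgen.
have deltaE (g : G K) (h : G L) :
    ev (chi2 (Point g, Point h)) (Rdelta k Y H (fgen b)) = glue_ch unif d g h.
  by rewrite /= flift_fgen ev_delta_irr.
apply: (mulfI (nz (any_set d))); rewrite coeff_char.
(* If the degrees do not match, both characters vanish identically. *)
have [eN|nN] := #|any_set d| =P (#|K| + #|L|)%N; last first.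
  rewrite big1 => [|g _]; last by rewrite mulE cmul_card ?mulr0.
  apply/esym/eqP; rewrite mulf_eq0 (negPf (nz _)) /=.
  have := coeff_char2 p (Rdelta k Y H (fgen b)).
  rewrite [X in _ = X]big1 => [|g _]; last first.
    by rewrite big1 // => h _; rewrite deltaE glue_ch_card ?mulr0.
  by move/eqP; rewrite !mulf_eq0 !(negPf (nz _)).
under eq_bigr do rewrite mulE.
have eKL : #|{: K + L}| = #|any_set d| by rewrite card_sum eN.
have inv c := @char_of_invariant k Y H c.
rewrite (pairing_pull (F1 := char_of d)
  (F2 := fun N (g : G N) => cmul (char_of (irr_repr p.1)) (char_of (irr_repr
    p.2)) g)
  (w := card_inj eKL)) //; last by move=> g; apply: cmul_pull.
have cG : #|GT (any_set d)|%:R = #|GT (K + L)%type|%:R :> k.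
  have one_inv : class_invariant (fun N (_ : G N) => 1 : k) by [].
  have := pairing_pull (F2 := fun N (_ : G N) => 1) (w := card_inj eKL) one_inv
    (fun=> erefl) eKL.
  by rewrite !sumr_const mulr1 !cardsT.
pose P := parabolic Y H (lft K L) (rgt K L).
have nzP : #|P|%:R != 0 :> k by rewrite natk_neq0 ?cardG_gt0.
apply: (mulfI nzP).
have := induced_pairing d (any_rep (irr_repr p.1)) (any_rep (irr_repr p.2)).
have eta c : AnyIrrep (any_rep c) = c :> any_irrep k Y H by case: c.
rewrite !eta -/P => ->; rewrite -cG mulrCA; congr (_ * _).
apply: (mulfI (mulf_neq0 (nz K) (nz L))); rewrite mulrCA coeff_char2.
rewrite (reindex_inj invg_inj) /=.
rewrite (eq_bigl (mem P)) => [|g]; last by rewrite /= groupV.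
rewrite parabolic_average; congr (_ * _); apply: eq_bigr => x _;
  apply: eq_bigr => y _.
rewrite deltaE /glue_ch wavg_mull; apply: eq_wavg => v; rewrite invgK mulrC.
have [-> ->] := glue_pullV (glue_stab x y v).
by rewrite glue_pull_l glue_pull_r !char_of_self.
Qed.

Lemma Rmul_Rdelta_adjoint :
  is_self_adjoint (Rmul k Y H) (Rdelta k Y H) (Runit k Y H) (Rcounit k Y H).
Proof.
split; first exact: adjoint_on_generators Rmul_Rdelta_reciprocity.
move=> c x; rewrite innerE raddfMz /= ev_fgen -mulrzl.
by rewrite intz.
Qed.

Lemma levi_class_nonneg K L N (a : injection K N) (b : injection L N) n
    (X : mx_representation k (levi Y H a b) n) : nonneg (levi_class X).
Proof.
apply: nonneg_sum => W _; rewrite /levi_irr_class; case: pselect => [ex|_] /=.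
  exact: nonneg_fgen.
by move=> q; rewrite raddf0.
Qed.

Lemma Rmul_Rdelta_positive :
  is_positive (Rmul k Y H) (Rdelta k Y H) (Runit k Y H) (Rcounit k Y H).
Proof.
split=> [t|x|c c0|x nx].
- by apply: nonneg_flift => p; apply: nonneg_sum => W _; apply: nonneg_fgen.
- by apply: nonneg_flift => b; apply: nonneg_sum => A _;
  apply: levi_class_nonneg.
- by apply: nonnegMz => //; apply: nonneg_fgen.
exact: nx.
Qed.

End SelfAdjoint.

Theorem theorem3p2 (k : closedFieldType) (k_char0 : [pchar k]%R =i pred0)
    (Y : young_set) (H : finGroupType) :
  (is_graded_hopf (@Rdeg k Y H) (Rmul k Y H) (RDelta k Y H)
                  (Runit k Y H) (Rcounit k Y H)
   /\ is_connected (@Rdeg k Y H) (Runit k Y H)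
   /\ is_commutative (Rmul k Y H)
   /\ is_cocommutative (RDelta k Y H))
  /\
  is_PSH (@Rdeg k Y H) (Rmul k Y H) (Rdelta k Y H)
         (Runit k Y H) (Rcounit k Y H).
Proof.
have DeltaE b K L (x : ygroup Y H K) (y : ygroup Y H L) :
    ev (chi2 (Point x, Point y)) (RDelta k Y H (fgen b))
    = glue_ch (@weight_one k H) (irr_repr b) x y.
  by rewrite /= flift_fgen ev_Delta_irr.
have deltaE b K L (x : ygroup Y H K) (y : ygroup Y H L) :
    ev (chi2 (Point x, Point y)) (Rdelta k Y H (fgen b))
    = glue_ch (@weight_unif k H) (irr_repr b) x y.
  by rewrite /= flift_fgen ev_delta_irr.
have sum1 := weight_one_sum k H; have sumU := weight_unif_sum k_char0 H.
split; last split.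
- split; first exact: (graded_hopf k_char0 sum1 DeltaE).
  split; first exact: Runit_connected.
  split; first exact: Rmul_commutative.
  exact: (cocommutative k_char0 sum1 DeltaE).
- exact: (graded_hopf k_char0 sumU deltaE).
- exact: Runit_connected.
- exact: Rmul_Rdelta_positive.
exact: Rmul_Rdelta_adjoint.
Qed.
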